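(* Let Assumption E hold. Let $w_1:[0,T]\times\overline{\mathcal O}\to\mathbb R$ be an upper semicontinuous viscosity subsolution on $[0,T)\times\overline{\mathcal O}$ and $w_2:[0,T]\times\overline{\mathcal O}\to\mathbb R$ a lower semicontinuous viscosity supersolution on $[0,T)\times\mathcal O$ of $$\rho\varphi-\partial_t\varphi+\mathcal H(x,D\varphi,D^2\varphi)=0.$$ If $w_1,w_2$ have polynomial growth on $[0,T]\times\overline{\mathcal O}$ and $w_2$ is of class $\mathcal R(\mathcal O)$, then $w_2\ge w_1$ on $\{T\}\times\overline{\mathcal O}$ implies $w_2\ge w_1$ on $[0,T]\times\overline{\mathcal O}$.
   Context: $\mathcal O\subseteq\mathbb R^d$ is open, $\rho>0$ a constant, $\mathbb M^d$ the $d\times d$ (symmetric) matrices, and $\mathcal H:\mathbb R^d\times\mathbb R^d\times\mathbb M^d\to\mathbb R$ is continuous and nonincreasing in its third argument. Viscosity sub/supersolutions are in the Crandall–Ishii–Lions sense, tested with $C^{1,2}$ functions at local maxima (resp. minima) relative to the indicated set. Assumption E: there is $\alpha>0$ such that $$\liminf_{\eta\downarrow0}\big(\mathcal H(y,q,Y^\eta)-\mathcal H(x,p,X^\eta)\big)\le\alpha\Big(|x-y|\big(1+|q|+n^2|x-y|\big)+(1+|x|)|p-q|+(1+|x|^2)|Q|\Big)$$ for all $x,y\in\overline{\mathcal O}$ with $|x-y|\le1$, all $p,q\in\mathbb R^d$, $Q\in\mathbb M^{2d}$, $n\ge1$ and families $(X^\eta,Y^\eta)_{\eta>0}\subset\mathbb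 M^d\times\mathbb M^d$ satisfying $\begin{pmatrix}X^\eta&0\\0&-Y^\eta\end{pmatrix}\le A_n+\eta A_n^2$ for all $\eta>0$, where $A_n:=n^2\begin{pmatrix}I_d&-I_d\\-I_d&I_d\end{pmatrix}+Q$. Class $\mathcal R(\mathcal O)$: $w:[0,T]\times\overline{\mathcal O}\to\mathbb R$ is of class $\mathcal R(\mathcal O)$ if for every $(t,x)\in[0,T)\times\partial\mathcal O$: (i) there exist an open neighborhood $B$ of $x$ and $\ell:\mathbb R_+\to\mathbb R^d$ with $\liminf_{\varepsilon\to0}\varepsilon^{-1}|\ell(\varepsilon)|<\infty$ and such that for every $\psi:\mathbb R_+\to\mathbb R^d$ with $\psi(\varepsilon)=o(\varepsilon)$ there is $r>0$ with $y+\ell(\varepsilon)+\psi(\varepsilon)\in\mathcal O$ for all $y\in\overline{\mathcal O}\cap B$, $\varepsilon\in(0,r)$; (ii) there is $\lambda:\mathbb R_+\to\mathbb R_+$ with $\lambda(\varepsilon)\to0$ and $w(t+\lambda(\varepsilon),x+\ell(\varepsilon))\to w(t,x)$ as $\varepsilon\to0$. *)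

(* Defs.v *)
From Stdlib Require Import Reals.
From mathcomp Require Import all_boot.
Set Implicit Arguments. Unset Strict Implicit.
Open Scope R_scope.

(* vectors and square matrices indexed by a finite type I;
   R^d is vec 'I_d, M^d is mx 'I_d, M^{2d} is mx ('I_d + 'I_d) *)
Definition vec (I : finType) := I -> R.
Definition mx (I : finType) := I -> I -> R.

Definition rsum (I : finType) (F : I -> R) : R := \big[Rplus/0]_(i : I) F i.

Definition vadd (I : finType) (u v : vec I) : vec I := fun i => u i + v i.
Definition vsub (I : finType) (u v : vec I) : vec I := fun i => u i - v i.
Definition vscale (I : finType) (c : R) (u : vec I) : vec I := fun i => c * u i.
Definition vnorm (I : finType) (u : vec I) : R := sqrt (rsum (fun i => u i * u i)).
Definition ebasis (I : finType) (i : I) : vec I := fun j => if j == i then 1 else 0.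

Definition madd (I : finType) (A B : mx I) : mx I := fun i j => A i j + B i j.
Definition msub (I : finType) (A B : mx I) : mx I := fun i j => A i j - B i j.
Definition mscale (I : finType) (c : R) (A : mx I) : mx I := fun i j => c * A i j.
Definition mmul (I : finType) (A B : mx I) : mx I :=
  fun i j => rsum (fun k => A i k * B k j).
Definition mid (I : finType) : mx I := fun i j => if i == j then 1 else 0.
Definition quad (I : finType) (A : mx I) (xi : vec I) : R :=
  rsum (fun i => rsum (fun j => xi i * A i j * xi j)).
Definition mle (I : finType) (A B : mx I) : Prop := forall xi, quad A xi <= quad B xi.
Definition msym (I : finType) (A : mx I) : Prop := forall i j, A i j = A j i.
Definition mnorm (I : finType) (A : mx I) : R :=
  sqrt (rsum (fun i => rsum (fun j => A i j * A i j))).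

Definition bdiag (I : finType) (X Y : mx I) : mx (I + I)%type :=
  fun a b => match a, b with
             | inl i, inl j => X i j
             | inr i, inr j => - Y i j
             | _, _ => 0 end.
Definition Jmat (I : finType) : mx (I + I)%type :=
  fun a b => match a, b with
             | inl i, inl j => mid i j
             | inr i, inr j => mid i j
             | inl i, inr j => - mid i j
             | inr i, inl j => - mid i j end.
Definition An (I : finType) (n : nat) (Q : mx (I + I)%type) : mx (I + I)%type :=
  madd (mscale (INR n ^ 2) (@Jmat I)) Q.

Definition isopen (I : finType) (O : vec I -> Prop) : Prop :=
  forall x, O x -> exists r, 0 < r /\ forall y, vnorm (vsub y x) < r -> O y.
Definition oclosure (I : finType) (O : vec I -> Prop) (x : vec I) : Prop :=
  forall r, 0 < r -> exists y, O y /\ vnorm (vsub y x) < r.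

Definition liminf0_le (f : R -> R) (c : R) : Prop :=
  forall e, 0 < e -> forall delta, 0 < delta ->
    exists eta, 0 < eta < delta /\ f eta <= c + e.
Definition liminf0_finite (f : R -> R) : Prop :=
  exists M, forall delta, 0 < delta -> exists eps, 0 < eps < delta /\ f eps < M.
Definition lim0 (f : R -> R) (L : R) : Prop :=
  forall e, 0 < e -> exists delta, 0 < delta /\
    forall eps, 0 < eps < delta -> Rabs (f eps - L) < e.
Definition small_o (I : finType) (psi : R -> vec I) : Prop :=
  forall c, 0 < c -> exists delta, 0 < delta /\
    forall eps, 0 < eps < delta -> vnorm (psi eps) <= c * eps.

Definition Hcont (I : finType) (H : vec I -> vec I -> mx I -> R) : Prop :=
  forall x p X, msym X -> forall e, 0 < e -> exists delta, 0 < delta /\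
    forall y q Y, msym Y -> vnorm (vsub y x) < delta -> vnorm (vsub q p) < delta ->
      mnorm (msub Y X) < delta -> Rabs (H y q Y - H x p X) < e.
Definition Hnonincr (I : finType) (H : vec I -> vec I -> mx I -> R) : Prop :=
  forall x p X Y, msym X -> msym Y -> mle X Y -> H x p Y <= H x p X.

Definition AssumptionE (I : finType) (O : vec I -> Prop)
  (H : vec I -> vec I -> mx I -> R) : Prop :=
  exists alpha, 0 < alpha /\
  forall x y, oclosure O x -> oclosure O y -> vnorm (vsub x y) <= 1 ->
  forall (p q : vec I) (Q : mx (I + I)%type), msym Q ->
  forall n : nat, (1 <= n)%nat ->
  forall Xf Yf : R -> mx I,
    (forall eta, 0 < eta -> msym (Xf eta) /\ msym (Yf eta) /\
       mle (bdiag (Xf eta) (Yf eta))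
           (madd (An n Q) (mscale eta (mmul (An n Q) (An n Q))))) ->
    liminf0_le (fun eta => H y q (Yf eta) - H x p (Xf eta))
      (alpha * (vnorm (vsub x y) * (1 + vnorm q + INR n ^ 2 * vnorm (vsub x y))
                + (1 + vnorm x) * vnorm (vsub p q)
                + (1 + vnorm x ^ 2) * mnorm Q)).

Definition jcont (I : finType) (f : R -> vec I -> R) : Prop :=
  forall t x e, 0 < e -> exists delta, 0 < delta /\
    forall s y, Rabs (s - t) < delta -> vnorm (vsub y x) < delta ->
      Rabs (f s y - f t x) < e.

Definition C12 (I : finType) (phi phit : R -> vec I -> R)
  (Dphi : R -> vec I -> vec I) (D2phi : R -> vec I -> mx I) : Prop :=
  (forall t x, derivable_pt_lim (fun s => phi s x) t (phit t x)) /\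
  (forall t x i, derivable_pt_lim
       (fun h => phi t (vadd x (vscale h (ebasis i)))) 0 (Dphi t x i)) /\
  (forall t x i j, derivable_pt_lim
       (fun h => Dphi t (vadd x (vscale h (ebasis j))) i) 0 (D2phi t x i j)) /\
  jcont phi /\ jcont phit /\ (forall i, jcont (fun t x => Dphi t x i)) /\
  (forall i j, jcont (fun t x => D2phi t x i j)).

Definition locmax_rel (I : finType) (S : R -> vec I -> Prop) (f : R -> vec I -> R)
  (t : R) (x : vec I) : Prop :=
  exists r, 0 < r /\ forall s y, S s y -> Rabs (s - t) < r -> vnorm (vsub y x) < r ->
    f s y <= f t x.
Definition locmin_rel (I : finType) (S : R -> vec I -> Prop) (f : R -> vec I -> R)
  (t : R) (x : vec I) : Prop :=
  exists r, 0 < r /\ forall s y, S s y -> Rabs (s - t) < r -> vnorm (vsub y x) < r ->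
    f t x <= f s y.

Definition visc_sub (I : finType) (rho : R) (H : vec I -> vec I -> mx I -> R)
  (S : R -> vec I -> Prop) (w : R -> vec I -> R) : Prop :=
  forall t x, S t x -> forall phi phit Dphi D2phi, C12 phi phit Dphi D2phi ->
    locmax_rel S (fun s y => w s y - phi s y) t x ->
    rho * w t x - phit t x + H x (Dphi t x) (D2phi t x) <= 0.
Definition visc_super (I : finType) (rho : R) (H : vec I -> vec I -> mx I -> R)
  (S : R -> vec I -> Prop) (w : R -> vec I -> R) : Prop :=
  forall t x, S t x -> forall phi phit Dphi D2phi, C12 phi phit Dphi D2phi ->
    locmin_rel S (fun s y => w s y - phi s y) t x ->
    rho * w t x - phit t x + H x (Dphi t x) (D2phi t x) >= 0.

Definition usc_on (I : finType) (S : R -> vec I -> Prop) (w : R -> vec I -> R) : Prop :=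
  forall t x, S t x -> forall e, 0 < e -> exists delta, 0 < delta /\
    forall s y, S s y -> Rabs (s - t) < delta -> vnorm (vsub y x) < delta ->
      w s y < w t x + e.
Definition lsc_on (I : finType) (S : R -> vec I -> Prop) (w : R -> vec I -> R) : Prop :=
  forall t x, S t x -> forall e, 0 < e -> exists delta, 0 < delta /\
    forall s y, S s y -> Rabs (s - t) < delta -> vnorm (vsub y x) < delta ->
      w t x - e < w s y.

Definition poly_growth (I : finType) (O : vec I -> Prop) (T : R) (w : R -> vec I -> R) : Prop :=
  exists C (k : nat), forall t x, 0 <= t <= T -> oclosure O x ->
    Rabs (w t x) <= C * (1 + vnorm x ^ k).

Definition classR (I : finType) (O : vec I -> Prop) (T : R) (w : R -> vec I -> R) : Prop :=
  forall t x, 0 <= t < T -> oclosure O x -> ~ O x ->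
  exists (B : vec I -> Prop) (l : R -> vec I),
    isopen B /\ B x /\
    liminf0_finite (fun eps => / eps * vnorm (l eps)) /\
    (forall psi : R -> vec I, small_o psi -> exists r, 0 < r /\
       forall y eps, oclosure O y -> B y -> 0 < eps < r ->
         O (vadd (vadd y (l eps)) (psi eps))) /\
    exists lam : R -> R, (forall eps, 0 < eps -> 0 <= lam eps) /\
      lim0 lam 0 /\
      lim0 (fun eps => w (t + lam eps) (vadd x (l eps))) (w t x).

(* Main.v *)
Require Import Defs.
From HB Require Import structures.
From Stdlib Require Import ZArith Reals Lra Lia Psatz.
From Stdlib Require Import Classical ClassicalEpsilon FunctionalExtensionality.
From mathcomp Require Import all_boot ssralg finalg zmodp.
Set Implicit Arguments. Unset Strict Implicit. Unset Printing Implicit Defensive.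
Open Scope R_scope.

(** The comparison principle follows from doubling of variables, with the second-order information
    supplied by a theorem on sums.  Assumption E is only used for constant families, so it suffices
    to find, for every error, test paraboloids for w1 and w2 near the maximum whose Hessians satisfy
    the matrix inequality up to that error; closures of semijets and limits of matrices do not occur.

    These paraboloids are found without Aleksandrov's and Jensen's theorems.  A function that lies
    within [eps r^2] of a quadratic polynomial on one ball of radius [r] is touched from above by a
    paraboloid with nearly the same Hessian, so second-order differentiability at a single positive
    scale is enough.  For a semiconvex function F with a strict maximum, the approximate maximum
    points of F minus linear functions have gradients that depend on the point in a Lipschitz way,
    so they meet a fixed fraction of the cells of any grid.  Near such points F lies between two
    paraboloids and its second differences are bounded.  Passing from one dyadic scale to the next,
    second differences are averaged, so the sum of their squares drops by their variance; as the sum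
    stays bounded, at some scale and some point near a contact point the second differences are
    almost constant on a large lattice cube, and F is nearly quadratic there. *)

(** [w1] satisfies its inequality up to the boundary, [w2] only inside, so the doubled maximum must
    have its second point in [O]. Class R achieves this: the penalty compares [zeta] with [z] moved
    by the inward shift, and [zeta] lies in [O] once its deviation from the shifted point is at most
    a fixed multiple of [eps]. With [s] fixed, this holds because [N] times the deviation is small
    compared with [s] while [N eps] is comparable to [s]. All remaining errors are of order [s], and
    [rho > 0] turns a positive maximum into a contradiction as [s] shrinks. Polynomial growth is
    handled by a barrier [exp (- kap t) (1 + |x|^2)^(m+2)]. What Assumption E charges for its
    gradient and Hessian is a multiple of the barrier itself, and [kap] is chosen so that its time
    derivative pays for that. Time is one more coordinate, so a single theorem on sums, for
    functions on closed sets, covers the parabolic problem: the time slopes of the two paraboloids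
    nearly cancel, and only the space blocks of their Hessians enter the equation. *)

HB.instance Definition _ := Monoid.isComLaw.Build R 0 Rplus
  (fun x y z => esym (Rplus_assoc x y z)) Rplus_comm Rplus_0_l.

(** * Finite sums of reals *)

Lemma rsum_ext (I : finType) (F G : I -> R) : (forall i, F i = G i) -> rsum F = rsum G.
Proof. by move=> FG; apply: eq_bigr => i _. Qed.

Lemma rsumD (I : finType) (F G : I -> R) : rsum (fun i => F i + G i) = rsum F + rsum G.
Proof. exact: big_split. Qed.

Lemma rsumZ (I : finType) c (F : I -> R) : rsum (fun i => c * F i) = c * rsum F.
Proof.
rewrite /rsum (big_morph (Rmult c) (id1 := 0) (op1 := Rplus)) //; last by rewrite Rmult_0_r.
by move=> x y; ring.
Qed.

Lemma rsumN (I : finType) (F : I -> R) : rsum (fun i => - F i) = - rsum F.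
Proof.
rewrite /rsum (big_morph Ropp (id1 := 0) (op1 := Rplus)) //; last by rewrite Ropp_0.
by move=> x y; ring.
Qed.

Lemma rsumB (I : finType) (F G : I -> R) : rsum (fun i => F i - G i) = rsum F - rsum G.
Proof. by rewrite /Rminus rsumD rsumN. Qed.

Lemma rsum0 (I : finType) (F : I -> R) : (forall i, F i = 0) -> rsum F = 0.
Proof. by move=> F0; apply: big1. Qed.

Lemma rsum_le (I : finType) (F G : I -> R) : (forall i, F i <= G i) -> rsum F <= rsum G.
Proof.
move=> FG; rewrite /rsum; elim/big_ind2: _ => //; first exact: Rle_refl.
by move=> x1 x2 y1 y2; lra.
Qed.

Lemma rsum_ge0 (I : finType) (F : I -> R) : (forall i, 0 <= F i) -> 0 <= rsum F.
Proof. by move=> F0; rewrite -(@rsum0 I (fun=> 0)) //; apply: rsum_le. Qed.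

Lemma rsum_exch (I J : finType) (F : I -> J -> R) :
  rsum (fun i => rsum (F i)) = rsum (fun j => rsum (fun i => F i j)).
Proof. exact: exchange_big. Qed.

Lemma rsumD1 (I : finType) (F : I -> R) i :
  rsum F = F i + \big[Rplus/0]_(j | j != i) F j.
Proof. by rewrite /rsum (bigD1 i). Qed.

Lemma rsum_term (I : finType) (F : I -> R) i : (forall i, 0 <= F i) -> F i <= rsum F.
Proof.
move=> F0; rewrite (rsumD1 F i).
suff: 0 <= \big[Rplus/0]_(j | j != i) F j by lra.
by elim/big_ind: _ => // [|x y]; [exact: Rle_refl|lra].
Qed.

Lemma rsum_delta (I : finType) (F : I -> R) i :
  rsum (fun j => if j == i then F j else 0) = F i.
Proof. by rewrite (rsumD1 _ i) eqxx big1 ?Rplus_0_r // => j /negbTE ->. Qed.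

Lemma rsum_cst (I : finType) c : rsum (fun _ : I => c) = INR #|I| * c.
Proof.
rewrite /rsum big_const cardE; elim: (size _) => [|k IH]; first by rewrite /=; ring.
by rewrite iterS IH S_INR; ring.
Qed.

Lemma rsum_sum (I J : finType) (F : I + J -> R) :
  rsum F = rsum (fun i => F (inl i)) + rsum (fun j => F (inr j)).
Proof. by rewrite /rsum big_sumType. Qed.

Lemma rsum_unit (F : unit -> R) : rsum F = F tt.
Proof. by rewrite (rsumD1 _ tt) big1 ?Rplus_0_r // => [[]]. Qed.

Lemma rsum_pair (I J : finType) (F : I -> J -> R) :
  rsum (fun i => rsum (F i)) = rsum (fun p : I * J => F p.1 p.2).
Proof. exact: pair_big. Qed.

Lemma rsum_card (I : finType) (A : {set I}) :
  rsum (fun i => if i \in A then 1 else 0) = INR #|A|.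
Proof.
rewrite /rsum -big_mkcond /= big_const; elim: #|A| => [|k IH] //.
by rewrite iterS IH S_INR; ring.
Qed.

Lemma Rabs_rsum (I : finType) (F : I -> R) : Rabs (rsum F) <= rsum (fun i => Rabs (F i)).
Proof.
rewrite /rsum; elim/big_ind2: _ => [|x1 x2 y1 y2 h1 h2|i _]; last exact: Rle_refl.
  by rewrite Rabs_R0; lra.
by have := Rabs_triang x2 y2; lra.
Qed.

(** * Euclidean vectors *)

Definition dot (I : finType) (u v : vec I) : R := rsum (fun i => u i * v i).
Local Notation sqn u := (dot u u) (only parsing).

Lemma dotC (I : finType) (u v : vec I) : dot u v = dot v u.
Proof. by apply: rsum_ext => i; ring. Qed.

Lemma dotDr (I : finType) (u v w : vec I) : dot u (vadd v w) = dot u v + dot u w.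
Proof. by rewrite -rsumD; apply: rsum_ext => i; rewrite /vadd; ring. Qed.

Lemma dotZr (I : finType) c (u v : vec I) : dot u (vscale c v) = c * dot u v.
Proof. by rewrite -rsumZ; apply: rsum_ext => i; rewrite /vscale; ring. Qed.

Lemma dotBr (I : finType) (u v w : vec I) : dot u (vsub v w) = dot u v - dot u w.
Proof. by rewrite -rsumB; apply: rsum_ext => i; rewrite /vsub; ring. Qed.

Lemma dotDl (I : finType) (u v w : vec I) : dot (vadd v w) u = dot v u + dot w u.
Proof. by rewrite dotC dotDr !(dotC u). Qed.

Lemma dotBl (I : finType) (u v w : vec I) : dot (vsub v w) u = dot v u - dot w u.
Proof. by rewrite dotC dotBr !(dotC u). Qed.

Lemma dotZl (I : finType) c (u v : vec I) : dot (vscale c v) u = c * dot v u.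
Proof. by rewrite dotC dotZr (dotC u). Qed.

Lemma dot_ebasis (I : finType) (u : vec I) i : dot u (ebasis i) = u i.
Proof.
rewrite -(rsum_delta u i); apply: rsum_ext => j; rewrite /ebasis.
by case: (j == i); ring.
Qed.

Lemma dot_ge0 (I : finType) (u : vec I) : 0 <= dot u u.
Proof. by apply: rsum_ge0 => i; nra. Qed.

Lemma vnorm_sq (I : finType) (u : vec I) : vnorm u * vnorm u = dot u u.
Proof. by apply: sqrt_sqrt; exact: dot_ge0. Qed.

Lemma vnorm_ge0 (I : finType) (u : vec I) : 0 <= vnorm u.
Proof. exact: sqrt_pos. Qed.

Lemma vnorm_dot (I : finType) (u : vec I) : vnorm u = sqrt (dot u u).
Proof. by []. Qed.

Lemma cauchy_schwarz_sq (I : finType) (u v : vec I) :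
  dot u v * dot u v <= dot u u * dot v v.
Proof.
have P s : 0 <= dot u u - 2 * s * dot u v + s * s * dot v v.
  have := dot_ge0 (vsub u (vscale s v)).
  rewrite dotBr !dotBl dotZl !dotZr dotZl (dotC v u); lra.
have v0 := dot_ge0 v; have u0 := dot_ge0 u.
case: (Req_dec (dot v v) 0) => [v_0|vn0].
  case: (Req_dec (dot u v) 0) => [->|d0]; first by nra.
  have := P ((dot u u + 1) / dot u v); rewrite v_0.
  have -> : 2 * ((dot u u + 1) / dot u v) * dot u v = 2 * (dot u u + 1) by field.
  by lra.
have := P (dot u v / dot v v).
have -> : dot u u - 2 * (dot u v / dot v v) * dot u v
   + dot u v / dot v v * (dot u v / dot v v) * dot v v
   = (dot u u * dot v v - dot u v * dot u v) / dot v v by field.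
move=> h; have vp : 0 < dot v v by lra.
have : 0 <= (dot u u * dot v v - dot u v * dot u v) / dot v v * dot v v by nra.
by rewrite /Rdiv Rmult_assoc Rinv_l // Rmult_1_r; lra.
Qed.

Lemma Rle_sqr a b : 0 <= b -> a * a <= b * b -> a <= b.
Proof. by move=> b0 ab; case: (Rle_dec a b) => // ?; nra. Qed.

Lemma cauchy_schwarz (I : finType) (u v : vec I) : Rabs (dot u v) <= vnorm u * vnorm v.
Proof.
apply: Rle_sqr; first by apply: Rmult_le_pos; exact: vnorm_ge0.
have -> : vnorm u * vnorm v * (vnorm u * vnorm v) = dot u u * dot v v.
  by rewrite -!vnorm_sq; ring.
by rewrite -Rabs_mult Rabs_pos_eq; [exact: cauchy_schwarz_sq|nra].
Qed.

Lemma dot_le (I : finType) (u v : vec I) : dot u v <= vnorm u * vnorm v.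
Proof. by apply: Rle_trans (cauchy_schwarz u v); exact: Rle_abs. Qed.

Lemma vnormD (I : finType) (u v : vec I) : vnorm (vadd u v) <= vnorm u + vnorm v.
Proof.
have u0 := vnorm_ge0 u; have v0 := vnorm_ge0 v.
apply: Rle_sqr; first by lra.
rewrite vnorm_sq dotDr !dotDl (dotC v u).
by have := dot_le u v; rewrite -!vnorm_sq; nra.
Qed.

Lemma vnormZ (I : finType) c (u : vec I) : vnorm (vscale c u) = Rabs c * vnorm u.
Proof.
rewrite vnorm_dot dotZl dotZr -Rmult_assoc sqrt_mult_alt; last by nra.
by rewrite -/(Rsqr c) sqrt_Rsqr_abs.
Qed.

Lemma vsubC (I : finType) (u v : vec I) : vnorm (vsub u v) = vnorm (vsub v u).
Proof.
rewrite !vnorm_dot; congr (sqrt _); apply: rsum_ext => i; rewrite /vsub; ring.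
Qed.

Lemma vec_ext (I : finType) (u v : vec I) : (forall i, u i = v i) -> u = v.
Proof. exact: functional_extensionality. Qed.

Ltac vec_ring := apply: vec_ext => ?; rewrite /vsub /vadd /vscale; ring.

Lemma vnorm_tri (I : finType) (x y z : vec I) :
  vnorm (vsub x z) <= vnorm (vsub x y) + vnorm (vsub y z).
Proof.
have -> : vsub x z = vadd (vsub x y) (vsub y z).
  by vec_ring.
exact: vnormD.
Qed.

Lemma vnorm_coord (I : finType) (u : vec I) i : Rabs (u i) <= vnorm u.
Proof.
apply: Rle_sqr (vnorm_ge0 u) _; rewrite vnorm_sq -Rabs_mult Rabs_pos_eq; last by nra.
by apply: (@rsum_term _ (fun i => u i * u i)) => j; nra.
Qed.

Lemma dot_coord_le (I : finType) (u : vec I) a :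
  (forall i, Rabs (u i) <= a) -> dot u u <= INR #|I| * (a * a).
Proof.
move=> ua; rewrite -(rsum_cst I (a * a)); apply: rsum_le => i.
by move: (ua i) (Rabs_pos (u i)); split_Rabs; nra.
Qed.

Lemma vnorm_coord_le (I : finType) (u : vec I) a : 0 <= a ->
  (forall i, Rabs (u i) <= a) -> vnorm u <= (INR #|I| + 1) * a.
Proof.
move=> a0 ua; have n0 := pos_INR #|I|; apply: Rle_sqr; first by nra.
rewrite vnorm_sq; have := dot_coord_le ua.
have : 0 <= INR #|I| * (a * a) by apply: Rmult_le_pos => //; nra.
by nra.
Qed.

Lemma vnorm0P (I : finType) (u : vec I) : vnorm u = 0 -> forall i, u i = 0.
Proof.
move=> u0 i; have := vnorm_coord u i; rewrite u0; have := Rabs_pos (u i).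
by split_Rabs; lra.
Qed.

(** * Quadratic and bilinear forms *)

Lemma quadE (I : finType) (A : mx I) (u : vec I) :
  quad A u = dot u (fun i => rsum (fun j => A i j * u j)).
Proof.
by apply: rsum_ext => i; rewrite -rsumZ; apply: rsum_ext => j; ring.
Qed.

Lemma quadZ (I : finType) (A : mx I) c (u : vec I) : quad A (vscale c u) = c * c * quad A u.
Proof.
rewrite -rsumZ; apply: rsum_ext => i; rewrite -rsumZ; apply: rsum_ext => j.
by rewrite /vscale; ring.
Qed.

Definition bil (I : finType) (A : mx I) (u v : vec I) : R :=
  rsum (fun i => rsum (fun j => u i * A i j * v j)).

Lemma quadD (I : finType) (A : mx I) (u v : vec I) : msym A ->
  quad A (vadd u v) = quad A u + 2 * bil A u v + quad A v.
Proof.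
move=> As; have -> : 2 * bil A u v = bil A u v + bil A v u.
  have -> : bil A v u = bil A u v; last by ring.
  rewrite /bil rsum_exch; apply: rsum_ext => i; apply: rsum_ext => j.
  by rewrite As; ring.
rewrite /quad /bil -!rsumD; apply: rsum_ext => i; rewrite -!rsumD.
by apply: rsum_ext => j; rewrite /vadd; ring.
Qed.

Lemma bilC (I : finType) (A : mx I) (u v : vec I) : msym A -> bil A u v = bil A v u.
Proof.
move=> As; rewrite /bil rsum_exch; apply: rsum_ext => i; apply: rsum_ext => j.
by rewrite As; ring.
Qed.

Lemma quad_madd (I : finType) (A B : mx I) u : quad (madd A B) u = quad A u + quad B u.
Proof.
rewrite /quad -rsumD; apply: rsum_ext => i; rewrite -rsumD; apply: rsum_ext => j.
by rewrite /madd; ring.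
Qed.

Lemma quad_mscale (I : finType) c (A : mx I) u : quad (mscale c A) u = c * quad A u.
Proof.
rewrite /quad -rsumZ; apply: rsum_ext => i; rewrite -rsumZ; apply: rsum_ext => j.
by rewrite /mscale; ring.
Qed.

Lemma quad_mid (I : finType) (u : vec I) : quad (@mid I) u = dot u u.
Proof.
rewrite quadE; apply: rsum_ext => i; congr (_ * _).
rewrite -(rsum_delta u i); apply: rsum_ext => j; rewrite /mid eq_sym.
by case: (j == i); ring.
Qed.

Lemma bil_bound (I : finType) (A : mx I) a u v : 0 <= a ->
  (forall i j, Rabs (A i j) <= a) ->
  Rabs (bil A u v) <= a * (rsum (fun i => Rabs (u i)) * rsum (fun j => Rabs (v j))).
Proof.
move=> a0 Aa; apply: Rle_trans (Rabs_rsum _) _.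
have -> : a * (rsum (fun i => Rabs (u i)) * rsum (fun j => Rabs (v j)))
  = rsum (fun i => rsum (fun j => a * Rabs (u i) * Rabs (v j))).
  transitivity (rsum (fun i => a * rsum (fun j => Rabs (v j)) * Rabs (u i))).
    by rewrite rsumZ; ring.
  apply: rsum_ext => i; transitivity (a * Rabs (u i) * rsum (fun j => Rabs (v j))).
    by ring.
  by rewrite -rsumZ.
apply: rsum_le => i; apply: Rle_trans (Rabs_rsum _) _; apply: rsum_le => j.
rewrite !Rabs_mult.
have := Rmult_le_compat_l _ _ _ (Rmult_le_pos _ _ (Rabs_pos (u i)) (Rabs_pos (v j))) (Aa i j).
by lra.
Qed.

Lemma rsum_abs_le (I : finType) (u : vec I) : rsum (fun i => Rabs (u i)) <= INR #|I| * vnorm u.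
Proof. by rewrite -rsum_cst; apply: rsum_le => i; exact: vnorm_coord. Qed.

Lemma quad_bound (I : finType) (A : mx I) a u : 0 <= a ->
  (forall i j, Rabs (A i j) <= a) ->
  Rabs (quad A u) <= a * INR #|I| * INR #|I| * dot u u.
Proof.
move=> a0 Aa; apply: Rle_trans (bil_bound u u a0 Aa) _.
have h := rsum_abs_le u; have h0 : 0 <= rsum (fun i => Rabs (u i)).
  by apply: rsum_ge0 => i; exact: Rabs_pos.
rewrite -vnorm_sq !Rmult_assoc; apply: Rmult_le_compat_l => //.
have := Rmult_le_compat _ _ _ _ h0 h0 h h; lra.
Qed.

Lemma vnorm_ebasis (I : finType) (i : I) : vnorm (ebasis i) = 1.
Proof.
by rewrite vnorm_dot dot_ebasis /ebasis eqxx sqrt_1.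
Qed.

(* Values are only approximately maximal, so no attainment is needed. *)
Lemma near_sup (T : Type) (F : T -> R) (x0 : T) B s :
  (forall x, F x <= B) -> 0 < s -> exists x, forall y, F y <= F x + s.
Proof.
move=> FB s0; pose E r := exists x, r = F x.
have [l [ub lub]] : {l | is_lub E l}.
  by apply: completeness; [exists B => r [x ->]|exists (F x0), x0].
apply: NNPP => hn; suff: l <= l - s by lra.
apply: lub => r [x ->]; apply: Rnot_lt_le => hx; apply: hn; exists x => y.
by have := ub (F y) (ex_intro _ y erefl); lra.
Qed.

Lemma archi (x : R) : exists n : nat, x < INR n.
Proof.
have [h1 _] := archimed x; exists (Z.to_nat (up x)).
case: (Z_le_gt_dec 0 (up x)) => hz; first by rewrite INR_IZR_INZ Z2Nat.id.
have := pos_INR (Z.to_nat (up x)); have : IZR (up x) < 0 by apply: IZR_lt; lia.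
by lra.
Qed.

Lemma nat_floor (x : R) : 0 <= x -> exists n : nat, INR n <= x < INR n + 1.
Proof.
move=> x0; have [n] := archi x; elim: n => [|n IH] h; first by move: h => /=; lra.
case: (Rle_dec (INR n) x) => hx; last by apply: IH; lra.
by exists n; rewrite -S_INR.
Qed.

(** Sets cut out by undecided propositions must be boolean to be counted as [{set G}]. *)
Definition pbool (P : Prop) : bool := if excluded_middle_informative P then true else false.

Lemma pboolP (P : Prop) : reflect P (pbool P).
Proof. by rewrite /pbool; case: excluded_middle_informative => h; constructor. Qed.

Local Notation "x +g y" := (GRing.add x y) (at level 50, left associativity).
Local Notation "a **g n" := (GRing.natmul a n) (at level 40, left associativity).
Local Notation "a *2^ k" := (GRing.natmul a (expn 2 k)) (at level 40, left associativity).

(** * Second differences on a finite abelian group *)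

Definition fdiff (G : zmodType) (a : G) (u : G -> R) (x : G) : R := u (x +g a) - u x.

Definition sdiff (G : zmodType) (u : G -> R) (a b : G) (k : nat) (x : G) : R :=
  fdiff (a *2^ k) (fdiff (b *2^ k) u) x / 4 ^ k.

(** A difference with doubled step is the sum of two differences with the old step. Doing this in
    both directions gives four terms, and the normalisation by [4 ^ k] makes their sum a mean. *)
Lemma sdiff_refine (G : zmodType) (u : G -> R) (a b : G) k x :
  sdiff u a b k.+1 x =
  (sdiff u a b k x + sdiff u a b k (x +g a *2^ k)
   + sdiff u a b k (x +g b *2^ k)
   + sdiff u a b k (x +g a *2^ k +g b *2^ k)) / 4.
Proof.
rewrite /sdiff /fdiff expnS mul2n -addnn !GRing.mulrnDr.
set A := a **g _; set B := b **g _.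
have e1 y : y +g A +g B = y +g B +g A by rewrite GRing.addrAC.
rewrite !GRing.addrA !e1.
have -> : 4 ^ k.+1 = 4 * 4 ^ k by [].
have h : 4 ^ k <> 0 by apply: pow_nonzero; lra.
move: h; move: (4 ^ k) => p h.
move: (u (x +g B +g B +g A +g A)) (u (x +g B +g B +g A)) (u (x +g B +g A +g A)).
move: (u (x +g B +g B)) (u (x +g A +g A)) (u (x +g B +g A)) (u (x +g A)) (u (x +g B)) (u x).
by move=> *; field.
Qed.

Lemma rsum_shift (G : finZmodType) (t : G) (q : G -> R) :
  rsum (fun x => q (x +g t)) = rsum q.
Proof. by rewrite /rsum [in RHS](reindex_inj (GRing.addIr t)). Qed.

(* Off the good sets the squared difference is replaced by [8 C^2], which makes the total
   decrease from one scale to the next by the variance and by the boundary of the sets. *)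
Definition sq_pot (G : finZmodType) (u : G -> R) (a b : G) (C : R) (S : nat -> {set G})
  (k : nat) (x : G) : R :=
  if x \in S k then sdiff u a b k x * sdiff u a b k x else 8 * (C * C).

Definition osc_small (G : finZmodType) (u : G -> R) (a b : G) (e : R) (S : nat -> {set G})
  (k : nat) (x : G) : Prop :=
  [/\ x \in S k, x +g a *2^ k \in S k, x +g b *2^ k \in S k
    & x +g a *2^ k +g b *2^ k \in S k] /\
  Rabs (sdiff u a b k x - sdiff u a b k (x +g a *2^ k)) <= e /\
  Rabs (sdiff u a b k x - sdiff u a b k (x +g b *2^ k)) <= e.

Definition osc_large (G : finZmodType) (u : G -> R) (a b : G) (e : R) (S : nat -> {set G})
  (k : nat) : {set G} :=
  [set x | (x \in S k.+1) && ~~ pbool (osc_small u a b e S k x)].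

(** Inside the sets this is the inequality between squared mean and mean square, with the variance
    as gain. If one of the four points is outside [S k], its value [8 C^2] makes the right side at
    least [2 C^2], which covers [C^2 + m]. *)
Lemma sq_pot_step (G : finZmodType) (u : G -> R) (a b : G) C e (S : nat -> {set G}) k x m :
  0 < C -> 0 < e -> m <= C * C -> m <= e * e / 16 ->
  (forall x, x \in S k -> Rabs (sdiff u a b k x) <= C) ->
  (forall x, x \in S k.+1 -> Rabs (sdiff u a b k.+1 x) <= C) ->
  (x \in S k -> x \in S k.+1) ->
  (x +g a *2^ k \in S k -> x \in S k.+1) ->
  (x +g b *2^ k \in S k -> x \in S k.+1) ->
  (x +g a *2^ k +g b *2^ k \in S k -> x \in S k.+1) ->
  sq_pot u a b C S k.+1 x + (if x \in osc_large u a b e S k then m else 0) <=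
  (sq_pot u a b C S k x + sq_pot u a b C S k (x +g a *2^ k)
   + sq_pot u a b C S k (x +g b *2^ k)
   + sq_pot u a b C S k (x +g a *2^ k +g b *2^ k)) / 4.
Proof.
move=> C0 e0 mC me h0 h1 i0 ia ib iab.
have sq0 y : 0 <= y * y by nra.
have sqC y : Rabs y <= C -> y * y <= C * C.
  by move=> hy; have := Rabs_pos y; split_Rabs; nra.
have C2 := sq0 C.
(* Outside [S k.+1] none of the four points is in [S k], and both sides equal [8 C^2]. *)
rewrite inE /sq_pot; case: (boolP (x \in S k.+1)) => xk1 /=; last first.
  have := contra i0 xk1; have := contra ia xk1; have := contra ib xk1; have := contra iab xk1.
  by do 4 move/negbTE->; rewrite ?(negbTE xk1); lra.
have S1 := sqC _ (h1 _ xk1).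
case: pboolP => [[[-> -> -> ->] _]|bad] /=.
  rewrite sdiff_refine; set p := sdiff u a b k x; set q := sdiff _ _ _ _ _.
  set r := sdiff _ _ _ _ _; set s := sdiff _ _ _ _ _.
  by have := sq0 (p - q); have := sq0 (p - r); have := sq0 (p - s); have := sq0 (q - r);
     have := sq0 (q - s); have := sq0 (r - s); lra.
have P y : 0 <= (if y \in S k then sdiff u a b k y * sdiff u a b k y else 8 * (C * C)).
  by case: ifP => _; nra.
move: (P x) (P (x +g a *2^ k)) (P (x +g b *2^ k))
  (P (x +g a *2^ k +g b *2^ k)).
case: (boolP (x \in S k)) => [m0|_] /=; last by move=> *; lra.
case: (boolP (x +g a *2^ k \in S k)) => [ma|_] /=; last by move=> *; lra.
case: (boolP (x +g b *2^ k \in S k)) => [mb|_] /=; last by move=> *; lra.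
case: (boolP (x +g a *2^ k +g b *2^ k \in S k)) => [mab|_] /=; last by move=> *; lra.
move=> _ _ _ _; rewrite sdiff_refine.
(* The mean square minus the squared mean is one sixteenth of the sum of the six squared
   differences, so a single difference above [e] gains [e^2 / 16]. *)
have : e < Rabs (sdiff u a b k x - sdiff u a b k (x +g a *2^ k)) \/
       e < Rabs (sdiff u a b k x - sdiff u a b k (x +g b *2^ k)).
  apply: NNPP => hn; apply: bad; split=> //.
  by split; apply: Rnot_lt_le => h; apply: hn; [left|right].
set p := sdiff u a b k x; set q := sdiff _ _ _ _ _.
set r := sdiff _ _ _ _ _; set s := sdiff _ _ _ _ _ => hor.
have E y : e < Rabs y -> e * e < y * y by move=> hy; split_Rabs; nra.
have := sq0 (p - s); have := sq0 (q - r); have := sq0 (q - s); have := sq0 (r - s).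
by case: hor => /E; have := sq0 (p - q); have := sq0 (p - r); lra.
Qed.


Lemma sq_pot_drop (G : finZmodType) (u : G -> R) (a b : G) C e (S : nat -> {set G}) k m :
  0 < C -> 0 < e -> m <= C * C -> m <= e * e / 16 ->
  (forall x, x \in S k -> Rabs (sdiff u a b k x) <= C) ->
  (forall x, x \in S k.+1 -> Rabs (sdiff u a b k.+1 x) <= C) ->
  (forall x, [|| x \in S k, x +g a *2^ k \in S k, x +g b *2^ k \in S k
     | x +g a *2^ k +g b *2^ k \in S k] -> x \in S k.+1) ->
  rsum (sq_pot u a b C S k.+1) + m * INR #|osc_large u a b e S k| <= rsum (sq_pot u a b C S k).
Proof.
move=> C0 e0 mC me h0 h1 hS; set q := sq_pot u a b C S k.
have -> : m * INR #|osc_large u a b e S k|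
    = rsum (fun x => if x \in osc_large u a b e S k then m else 0).
  by rewrite -rsum_card -rsumZ; apply: rsum_ext => x; case: ifP => _; ring.
have -> : rsum q = rsum (fun x => (q x + q (x +g a *2^ k) + q (x +g b *2^ k)
   + q (x +g a *2^ k +g b *2^ k)) / 4).
  have eA := rsum_shift (a *2^ k) q; have eB := rsum_shift (b *2^ k) q.
  have eAB := rsum_shift (a *2^ k) (fun y => q (y +g b *2^ k)).
  transitivity ((/ 4) * (rsum q + rsum (fun x => q (x +g a *2^ k))
    + rsum (fun x => q (x +g b *2^ k))
    + rsum (fun x => q (x +g a *2^ k +g b *2^ k)))).
    by rewrite eAB eA eB; field.
  rewrite -!rsumD -rsumZ.
  by apply: rsum_ext => x; rewrite Rmult_comm.
rewrite -rsumD; apply: rsum_le => x; apply: sq_pot_step => //.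
- by move=> h; apply: hS; rewrite h.
- by move=> h; apply: hS; rewrite h orbT.
- by move=> h; apply: hS; rewrite h !orbT.
- by move=> h; apply: hS; rewrite h !orbT.
Qed.

(** Pigeonhole: the [N + 1] drops add up to at most [B], so one of them is at most their average. *)
Lemma small_drop (f : nat -> R) (N : nat) B :
  f 0%N <= B -> 0 <= f N.+1 -> exists j : nat, (j <= N)%N /\ f j - f j.+1 <= B / INR N.+1.
Proof.
move=> f0 fN; have N0 : 0 < INR N.+1 by apply: lt_0_INR; lia.
apply: NNPP => hn.
have H : forall j : nat, (j <= N.+1)%N -> (j = 0)%N \/ f j + INR j * (B / INR N.+1) < B.
  elim=> [|j IH] jN; [by left|right].
  have h : B / INR N.+1 < f j - f j.+1.
    by apply: Rnot_le_lt => h; apply: hn; exists j.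
  rewrite S_INR; case: (IH (ltnW jN)) => [j0|]; last by lra.
  by move: h; rewrite j0 /=; lra.
case: (H N.+1 (leqnn _)) => //; have -> : INR N.+1 * (B / INR N.+1) = B by field; lra.
by lra.
Qed.

(** [M] is fixed before the group, hence before the mesh of any grid. A monotone quantity bounded by
    a multiple of [|G|] has a small drop at some scale. There, the bad events have total number
    below a fraction of [|G|], while [S k] contains at least [c0 |G|] points, so some point of [S k]
    has no bad translate. *)
Lemma good_scale (V W : finType) (c : nat) (C e c0 : R) :
  0 < C -> 0 < e -> 0 < c0 -> (0 < c)%N ->
  exists M : nat, forall (G : finZmodType) (dir : V -> G) (tr : W -> G) (u : G -> R)
    (S : nat -> {set G}),
  (forall k x a b, (k <= M)%N -> x \in S k -> Rabs (sdiff u (dir a) (dir b) k x) <= C) ->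
  (forall k x a b, (k < M)%N ->
    [|| x \in S k, x +g dir a *2^ k \in S k, x +g dir b *2^ k \in S k
     | x +g dir a *2^ k +g dir b *2^ k \in S k] -> x \in S k.+1) ->
  (forall k x, (k < M)%N -> x \in S k -> x \in S k.+1) ->
  (forall k x w, (k + c <= M)%N -> x \in S k -> x +g tr w *2^ k \in S (k + c)%N) ->
  c0 * INR #|G| <= INR #|S 0%N| ->
  exists (k : nat) (x : G), (k + c <= M)%N /\ x \in S k /\
    forall w, x +g tr w *2^ k \in S k /\
    forall a b, osc_small u (dir a) (dir b) e S k (x +g tr w *2^ k).
Proof.
move=> C0 e0 c00 cpos.
pose m := Rmin (C * C) (e * e / 16).
have m0 : 0 < m by apply: Rmin_glb_lt; nra.
have mC : m <= C * C by exact: Rmin_l.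
have me : m <= e * e / 16 by exact: Rmin_r.
pose nv := INR #|V|; pose nw := INR #|W|.
have nv0 : 0 <= nv by exact: pos_INR.
have nw0 : 0 <= nw by exact: pos_INR.
(* The first summand bounds [P 0] per point of [G], the second bounds the part of [Th] that counts
   the complement of [S 0]. *)
pose B := nv * (nv * (8 * (C * C))) + m.
have B0 : 0 < B by rewrite /B; nra.
have [N hN] := archi (nw * (2 * B) / (m * c0)).
(* Drops are measured over blocks of [c] scales, because a translate of a point of [S k] is only
   known to lie in [S (k + c)]. *)
exists (N.+1 * c)%N => G dir tr u S hC hS hmono htr hc0.
have gG : 0 < INR #|G|.
  apply: lt_0_INR; apply/ltP/card_gt0P.
  by exists (GRing.zero : G).
pose Phi a b k := rsum (sq_pot u (dir a) (dir b) C S k).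
pose P k := rsum (fun a => rsum (fun b => Phi a b k)).
(* The second term charges the growth of the sets to the same budget as the variance. *)
pose Th k := P k + m * (INR #|G| - INR #|S k|).
pose L a b k := osc_large u (dir a) (dir b) e S k.
have drop a b k : (k < N.+1 * c)%N -> Phi a b k.+1 + m * INR #|L a b k| <= Phi a b k.
  move=> kM; apply: sq_pot_drop => // [x xk|x xk|x].
  - by apply: hC => //; exact: ltnW.
  - exact: hC.
  - exact: hS.
have dropP k : (k < N.+1 * c)%N ->
    P k.+1 + m * rsum (fun a => rsum (fun b => INR #|L a b k|)) <= P k.
  move=> kM; rewrite -rsumZ -rsumD; apply: rsum_le => a.
  by rewrite -rsumZ -rsumD; apply: rsum_le => b; exact: drop.
have L0 k : 0 <= rsum (fun a => rsum (fun b => INR #|L a b k|)).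
  by apply: rsum_ge0 => a; apply: rsum_ge0 => b; exact: pos_INR.
have cS k : (k < N.+1 * c)%N -> INR #|S k| <= INR #|S k.+1|.
  move=> kM; apply: le_INR; apply/leP/subset_leq_card/subsetP => x; exact: hmono.
have dropT k : (k < N.+1 * c)%N ->
    Th k.+1 + m * rsum (fun a => rsum (fun b => INR #|L a b k|)) <= Th k.
  by move=> kM; have := dropP _ kM; have := cS _ kM; rewrite /Th; nra.
have monoS j k : (j + k <= N.+1 * c)%N -> INR #|S j| <= INR #|S (j + k)%N|.
  elim: k => [|k IH]; first by rewrite addn0; lra.
  by rewrite addnS => h; apply: Rle_trans (IH (ltnW h)) _; exact: cS.
have monoT j k : (j + k <= N.+1 * c)%N -> Th (j + k)%N <= Th j.
  elim: k => [|k IH]; first by rewrite addn0; lra.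
  rewrite addnS => h; have := IH (ltnW h); have := dropT _ h; have := L0 (j + k)%N; nra.
have monoP j k : (j + k <= N.+1 * c)%N -> P (j + k)%N <= P j.
  elim: k => [|k IH]; first by rewrite addn0; lra.
  rewrite addnS => h; have := IH (ltnW h); have := dropP _ h; have := L0 (j + k)%N; nra.
have SG k : INR #|S k| <= INR #|G| by apply: le_INR; apply/leP; exact: max_card.
have P0 k : 0 <= P k.
  apply: rsum_ge0 => a; apply: rsum_ge0 => b; apply: rsum_ge0 => x.
  by rewrite /sq_pot; case: ifP => _; nra.
have PB : P 0%N <= nv * (nv * (8 * (C * C))) * INR #|G|.
  rewrite [X in _ <= X](_ : _ = rsum (fun _ : V => rsum (fun _ : V => rsum (fun _ : G => 8 * (C * C))))).
    apply: rsum_le => a; apply: rsum_le => b; apply: rsum_le => x.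
    rewrite /sq_pot; case: ifP => [xS|_]; last by lra.
    have := hC 0%N x a b (leq0n _) xS.
    by have := Rabs_pos (sdiff u (dir a) (dir b) 0 x); split_Rabs; nra.
  rewrite !rsum_cst; change (nv * (nv * (8 * (C * C))) * INR #|G|
    = nv * (nv * (INR #|G| * (8 * (C * C))))).
  by ring.
have h0 : Th (0 * c)%N <= B * INR #|G|.
  by rewrite mul0n /Th /B; have := pos_INR #|S 0%N|; nra.
have h1 : 0 <= Th (N.+1 * c)%N.
  by have := P0 (N.+1 * c)%N; have := SG (N.+1 * c)%N; rewrite /Th; nra.
have [j [jN hj]] := @small_drop (fun j => Th (j * c)%N) N (B * INR #|G|) h0 h1.
have jc : (j * c + c <= N.+1 * c)%N by rewrite -mulSnr leq_mul2r ltnS jN orbT.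
have jc' : (j * c < N.+1 * c)%N.
  by apply: leq_trans jc; rewrite -[X in (X < _)%N]addn0 ltn_add2l.
pose k := (j * c)%N; rewrite -/k in jc jc'.
move: hj; rewrite mulSnr -/k => hj.
exists k; apply: NNPP => hn.
pose y x w := x +g tr w *2^ k.
pose ind (A : {set G}) z := if z \in A then 1 else 0.
have ind0 A z : 0 <= ind A z by rewrite /ind; case: ifP; lra.
have kc : forall z, z \in S k -> z \in S (k + c)%N.
  move=> z zk; have : forall i, (k + i <= N.+1 * c)%N -> z \in S (k + i)%N.
    elim=> [|i IH]; first by rewrite addn0.
    by rewrite addnS => h; apply: hmono => //; apply: IH; exact: ltnW.
  exact.
(* The number of ways in which the translate by [w] fails: it has left [S k], or its oscillation is
   large for a pair of directions. It is nonnegative because [S k] is contained in [S (k + c)]. *)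
pose bad x w := ind (S (k + c)%N) (y x w) - ind (S k) (y x w)
  + rsum (fun a => rsum (fun b => ind (L a b k) (y x w))).
have bad0 x w : 0 <= bad x w.
  have : 0 <= rsum (fun a => rsum (fun b => ind (L a b k) (y x w))).
    by apply: rsum_ge0 => a; apply: rsum_ge0 => b.
  rewrite /bad /ind; case: (boolP (y x w \in S k)) => [/kc->|_]; first by lra.
  by case: ifP; lra.
have key x : ind (S k) x <= rsum (bad x).
  rewrite {1}/ind; case: (boolP (x \in S k)) => [xk|_]; last exact: rsum_ge0.
  have [w hw] : exists w, ~ (y x w \in S k /\
     forall a b, osc_small u (dir a) (dir b) e S k (y x w)).
    apply: NNPP => hw; apply: hn; exists x; split=> //; split=> // w.
    by apply: NNPP => hh; apply: hw; exists w.
  apply: Rle_trans (rsum_term w (bad0 x)).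
  case: (boolP (y x w \in S k)) => [yk|yk]; last first.
    have s0 : 0 <= rsum (fun a => rsum (fun b => ind (L a b k) (y x w))).
      by apply: rsum_ge0 => a; apply: rsum_ge0 => b.
    by rewrite /bad /ind (negbTE yk) /y htr //; rewrite -/(y x w); rewrite /ind in s0; lra.
  have [a [b hab]] : exists a b, ~ osc_small u (dir a) (dir b) e S k (y x w).
    apply: NNPP => hh; apply: hw; split=> // a b.
    by apply: NNPP => h3; apply: hh; exists a, b.
  have yL : y x w \in L a b k.
    by rewrite inE hmono //=; apply/negP => /pboolP.
  have t1 : ind (L a b k) (y x w) <= rsum (fun a => rsum (fun b => ind (L a b k) (y x w))).
    apply: Rle_trans (@rsum_term _ (fun a => rsum (fun b => ind (L a b k) (y x w))) a _).
      exact: (@rsum_term _ (fun b => ind (L a b k) (y x w))).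
    by move=> a'; exact: rsum_ge0.
  have t2 : ind (L a b k) (y x w) = 1 by rewrite /ind yL.
  by rewrite /bad {1 2}/ind yk kc //; lra.
have sum_ind A w : rsum (fun x => ind A (y x w)) = INR #|A|.
  by rewrite -rsum_card; exact: (rsum_shift (tr w *2^ k) (ind A)).
(* Double counting: [key] is summed over [x], and for each fixed [w] translation invariance removes
   the shift. *)
have total : INR #|S k| <= nw * (INR #|S (k + c)%N| - INR #|S k|
    + rsum (fun a => rsum (fun b => INR #|L a b k|))).
  rewrite -{1}rsum_card; apply: Rle_trans (rsum_le key) _.
  rewrite rsum_exch -rsum_cst; apply: rsum_le => w.
  rewrite rsumD rsumB !sum_ind; apply: Rplus_le_compat_l.
  rewrite rsum_exch; apply: rsum_le => a; rewrite rsum_exch; apply: rsum_le => b.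
  by rewrite sum_ind; lra.
set s := rsum _ in total.
have s1 : m * s <= Th k - Th (k + c)%N.
  have h := dropT k jc'; rewrite -/s in h.
  have : Th (k + c)%N <= Th k.+1.
    have ec : (k.+1 + c.-1 = k + c)%N by rewrite addSnnS prednK.
    by rewrite -ec; apply: monoT; rewrite ec.
  by lra.
have s2 : m * (INR #|S (k + c)%N| - INR #|S k|) <= Th k - Th (k + c)%N.
  by have := monoP _ _ jc; rewrite /Th; lra.
have s3 : m * INR #|S k| <= nw * (2 * (B * INR #|G| / INR N.+1)).
  have : nw * (m * (INR #|S (k + c)%N| - INR #|S k| + s)) <=
         nw * (2 * (B * INR #|G| / INR N.+1)) by apply: Rmult_le_compat_l => //; lra.
  have : m * INR #|S k| <= m * (nw * (INR #|S (k + c)%N| - INR #|S k| + s)).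
    by apply: Rmult_le_compat_l; lra.
  by lra.
have s4 : c0 * INR #|G| <= INR #|S k|.
  by apply: Rle_trans hc0 _; have := monoS 0%N k; rewrite add0n; apply; exact: ltnW.
have N0 : 0 < INR N.+1 by apply: lt_0_INR; lia.
have s5 : m * c0 * INR N.+1 <= nw * (2 * B).
  have : m * (c0 * INR #|G|) * INR N.+1 <= nw * (2 * (B * INR #|G| / INR N.+1)) * INR N.+1.
    apply: Rmult_le_compat_r; first by lra.
    by apply: Rle_trans s3; apply: Rmult_le_compat_l; lra.
  have -> : nw * (2 * (B * INR #|G| / INR N.+1)) * INR N.+1 = nw * (2 * B) * INR #|G|.
    by field; lra.
  move=> h; apply: (Rmult_le_reg_r (INR #|G|)) gG _; lra.
have mc : 0 < m * c0 by nra.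
have : nw * (2 * B) < m * c0 * INR N.
  apply: (Rmult_lt_reg_r (/ (m * c0))); first exact: Rinv_0_lt_compat.
  have -> : m * c0 * INR N * / (m * c0) = INR N by field; lra.
  exact: hN.
by rewrite S_INR in s5; nra.
Qed.

(* Polarization recovers the mixed differences, since [good_scale] only controls third differences
   that repeat a direction. *)
Lemma fdiff_polar (G : zmodType) (a b : G) (v : G -> R) y :
  2 * fdiff a (fdiff b v) (y +g b) = fdiff (a +g b) (fdiff (a +g b) v) y
    - fdiff a (fdiff a v) (y +g b +g b) - fdiff b (fdiff b v) y.
Proof.
rewrite /fdiff !GRing.addrA.
have e1 z : z +g a +g b = z +g b +g a by rewrite GRing.addrAC.
rewrite !e1.
move: (v (y +g b +g b +g a +g a)) (v (y +g b +g b +g a)) (v (y +g b +g b)) (v (y +g b +g a)).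
by move: (v (y +g b)) (v y) => *; ring.
Qed.

(** * Lattice functions with small third differences *)

Definition nstep (I : finType) (t : I -> nat) (i : I) : I -> nat :=
  fun j => (t j + (j == i))%N.

Definition ndiff (I : finType) (i : I) (U : (I -> nat) -> R) (t : I -> nat) : R :=
  U (nstep t i) - U t.

Definition ncube (I : finType) (N : nat) (t : I -> nat) : Prop := forall j, (t j <= N)%N.

Definition nzero (I : finType) : I -> nat := fun _ => 0%N.

Lemma nstepC (I : finType) (t : I -> nat) i j : nstep (nstep t i) j = nstep (nstep t j) i.
Proof. by apply: functional_extensionality => l; rewrite /nstep addnAC. Qed.

Lemma ndiffC (I : finType) (U : (I -> nat) -> R) i j t :
  ndiff i (ndiff j U) t = ndiff j (ndiff i U) t.
Proof. by rewrite /ndiff nstepC; ring. Qed.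

(** A monotone path from the origin to a point of the cube has at most [#|I| * N] unit steps and
    stays in the cube. *)
Lemma lattice_path (I : finType) N (g : (I -> nat) -> R) eta : 0 <= eta ->
  (forall i t, ncube N t -> Rabs (ndiff i g t) <= eta) ->
  forall t, ncube N t -> Rabs (g t - g (@nzero I)) <= INR (#|I| * N) * eta.
Proof.
move=> eta0 hg t tN.
have bound : INR (\sum_j t j)%N <= INR (#|I| * N).
  apply: le_INR; apply/leP; rewrite -sum_nat_const; exact: leq_sum.
suff H : Rabs (g t - g (@nzero I)) <= INR (\sum_j t j)%N * eta by nra.
have [s ts] : exists s, (\sum_j t j)%N = s by exists (\sum_j t j)%N.
rewrite ts; elim: s t tN ts {bound} => [|s IH] t tN ts.
  have -> : t = @nzero I.
    apply: functional_extensionality => j; apply/eqP; rewrite -leqn0 -ts.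
    by rewrite (bigD1 j) //= leq_addr.
  by rewrite Rminus_diag Rabs_R0 /=; lra.
have [i ti] : exists i, (0 < t i)%N.
  apply: NNPP => hn; suff: (\sum_j t j = 0)%N by rewrite ts.
  apply: big1 => j _; apply/eqP; rewrite -leqn0 leqNgt; apply/negP => h.
  by apply: hn; exists j.
pose t' : I -> nat := fun j => (t j - (j == i))%N.
have tE : t = nstep t' i.
  apply: functional_extensionality => j; rewrite /nstep /t' subnK //.
  by case: eqP => [->|].
have t'N : ncube N t' by move=> j; apply: leq_trans (tN j); exact: leq_subr.
have t's : (\sum_j t' j)%N = s.
  have : (\sum_j t j)%N = (\sum_j t' j + 1)%N.
    rewrite tE big_split /=; congr addn.
    by rewrite (bigD1 i) //= eqxx big1 // => j /negbTE ->.
  by rewrite ts addn1 => -[].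
have h1 := IH _ t'N t's; have h2 := hg i _ t'N.
move: h2; rewrite /ndiff -tE S_INR => h2.
have -> : g t - g (@nzero I) = (g t - g t') + (g t' - g (@nzero I)) by ring.
by have := Rabs_triang (g t - g t') (g t' - g (@nzero I)); lra.
Qed.

Definition lat_hess (I : finType) (U : (I -> nat) -> R) : mx I :=
  fun i j => ndiff i (ndiff j U) (@nzero I).

Definition qpoly (I : finType) (c : R) (b : vec I) (A : mx I) (z : vec I) : R :=
  c + dot b z + quad A z / 2.

(** The first difference of a quadratic polynomial at the origin contains half of the diagonal
    Hessian entry; subtracting it makes the first differences of [qpoly] agree with those of [U]
    there. *)
Definition lat_lin (I : finType) (U : (I -> nat) -> R) : vec I :=
  fun i => ndiff i U (@nzero I) - lat_hess U i i / 2.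

Lemma lat_hess_sym (I : finType) (U : (I -> nat) -> R) : msym (lat_hess U).
Proof. by move=> i j; exact: ndiffC. Qed.

Definition nvec (I : finType) (t : I -> nat) : vec I := fun i => INR (t i).

Lemma nvec_step (I : finType) (t : I -> nat) i : nvec (nstep t i) = vadd (nvec t) (ebasis i).
Proof.
apply: vec_ext => j; rewrite /nvec /nstep /vadd /ebasis plus_INR.
by case: (j == i).
Qed.

Lemma bil_ebasis (I : finType) (A : mx I) (u : vec I) i :
  bil A u (ebasis i) = rsum (fun j => A j i * u j).
Proof.
apply: rsum_ext => j; rewrite -(rsum_delta (fun l => A j l * u j) i).
apply: rsum_ext => l; rewrite /ebasis; case: (l == i); ring.
Qed.

Lemma quad_ebasis (I : finType) (A : mx I) i : quad A (ebasis i) = A i i.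
Proof.
rewrite -[quad _ _]/(bil A (ebasis i) (ebasis i)) bil_ebasis.
rewrite -(rsum_delta (fun j => A j i) i).
by apply: rsum_ext => l; rewrite /ebasis; case: (l == i); ring.
Qed.

Lemma qpoly_step (I : finType) c (b : vec I) (A : mx I) z i : msym A ->
  qpoly c b A (vadd z (ebasis i)) - qpoly c b A z
  = b i + rsum (fun j => A j i * z j) + A i i / 2.
Proof.
move=> As; rewrite /qpoly dotDr dot_ebasis quadD // bil_ebasis quad_ebasis.
by field.
Qed.

(** A discrete Taylor formula: [lattice_path] integrates the bound on third differences three times,
    at the cost of one factor [K] each time. *)
Lemma near_quadratic (I : finType) N (U : (I -> nat) -> R) eta : 0 <= eta ->
  (forall i j l t, ncube N t -> Rabs (ndiff i (ndiff j (ndiff l U)) t) <= eta) ->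
  forall t, ncube N t ->
  Rabs (U t - qpoly (U (@nzero I)) (lat_lin U) (lat_hess U) (nvec t))
    <= INR (#|I| * N) ^ 3 * eta.
Proof.
move=> eta0 h3; set K := INR (#|I| * N); have K0 : 0 <= K by exact: pos_INR.
have h2 i j t : ncube N t -> Rabs (ndiff i (ndiff j U) t - lat_hess U i j) <= K * eta.
  by apply: lattice_path => // l s; exact: h3.
have h1 i t : ncube N t ->
    Rabs (ndiff i U t - ndiff i U (@nzero I) - rsum (fun j => lat_hess U j i * INR (t j)))
    <= K * (K * eta).
  move=> tN.
  pose g t := ndiff i U t - rsum (fun j => lat_hess U j i * INR (t j)).
  have := @lattice_path I N g (K * eta) _ _ t tN; rewrite -/K.
  have -> : g t - g (@nzero I) = ndiff i U t - ndiff i U (@nzero I)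
      - rsum (fun j => lat_hess U j i * INR (t j)).
    rewrite /g [X in _ - (_ - X)]rsum0; first by ring.
    by move=> j /=; ring.
  apply; first by nra.
  move=> l s sN; rewrite /ndiff /g.
  have -> : forall a b c d : R, a - b - (c - d) = (a - c) - (b - d) by move=> *; ring.
  rewrite -rsumB [X in _ - X](_ : _ = lat_hess U l i); first exact: h2.
  rewrite -(rsum_delta (fun j => lat_hess U j i) l); apply: rsum_ext => j.
  by rewrite /nstep plus_INR; case: (j == l) => /=; ring.
move=> t tN.
pose g t := U t - qpoly (U (@nzero I)) (lat_lin U) (lat_hess U) (nvec t).
have := @lattice_path I N g (K * (K * eta)) _ _ t tN; rewrite -/K.
have -> : g (@nzero I) = 0.
  rewrite /g /qpoly /dot /quad !rsum0; first by field.
    by move=> i; rewrite rsum0 // => j; rewrite /nvec /=; ring.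
  by move=> i; rewrite /nvec /=; ring.
rewrite Rminus_0_r -/(g t); have -> : K ^ 3 * eta = K * (K * (K * eta)) by ring.
apply; first by nra.
move=> i s sN; rewrite /ndiff /g nvec_step.
have -> : forall a b c d : R, a - b - (c - d) = (a - c) - (b - d) by move=> *; ring.
rewrite qpoly_step; last exact: lat_hess_sym.
have -> : U (nstep s i) - U s - (lat_lin U i + rsum (fun j => lat_hess U j i * nvec s j)
   + lat_hess U i i / 2) = ndiff i U s - ndiff i U (@nzero I)
   - rsum (fun j => lat_hess U j i * INR (s j)).
  by rewrite /lat_lin /nvec /ndiff; field.
exact: h1.
Qed.

(* Midpoint semiconvexity: a supremum of paraboloids satisfies it without any continuity. *)
Definition semiconvex (I : finType) (F : vec I -> R) (C : R) : Prop :=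
  forall z e, - (C * dot e e) <= F (vadd z e) + F (vsub z e) - 2 * F z.

(** [p] is a supergradient of [F] at [k] up to the error [s], that is, [k] maximises [F] minus the
    linear function [p] up to [s]. *)
Definition contact (I : finType) (F : vec I -> R) (s : R) (k p : vec I) : Prop :=
  forall z, F z <= F k + dot p (vsub z k) + s.

(** The upper bound at the mirror image of [z] in [k] becomes a lower bound at [z] by
    semiconvexity. *)
Lemma contact_affine (I : finType) (F : vec I -> R) C s k p z :
  semiconvex F C -> contact F s k p ->
  - (C * sqn (vsub z k)) - s <= F z - F k - dot p (vsub z k) <= s.
Proof.
move=> sc ct; split; last by have := ct z; lra.
have := sc k (vsub z k); have := ct (vsub k (vsub z k)).
have -> : vsub (vsub k (vsub z k)) k = vscale (-1) (vsub z k).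
  by vec_ring.
have -> : vadd k (vsub z k) = z by vec_ring.
by rewrite dotZr; lra.
Qed.

Lemma contact_affine_abs (I : finType) (F : vec I -> R) C s k p z a : 0 <= C ->
  semiconvex F C -> contact F s k p -> (forall i, Rabs (z i - k i) <= a) ->
  Rabs (F z - (F k + dot p (vsub z k))) <= C * INR #|I| * (a * a) + s.
Proof.
move=> C0 sc ct za; have [h1 h2] := contact_affine z sc ct.
have h3 : sqn (vsub z k) <= INR #|I| * (a * a) by exact: dot_coord_le.
have h4 := dot_ge0 (vsub z k).
have h5 : C * sqn (vsub z k) <= C * (INR #|I| * (a * a)).
  exact: Rmult_le_compat_l.
by apply: Rabs_le; nra.
Qed.

(** The lower bound from the first contact point and the upper bound from the second are compared at
    a point one step [h] beyond [k']. This costs [C] times a squared distance and three errors [s],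
    all of order [h^2]; division by [h] leaves a Lipschitz bound for the slopes. *)
Lemma contact_slopes (I : finType) (F : vec I -> R) C s h k p k' p' i : 0 <= C -> 0 < h ->
  s <= h * h -> semiconvex F C -> contact F s k p -> contact F s k' p' ->
  (forall j, Rabs (k' j - k j) <= h) ->
  p i - p' i <= (4 * INR #|I| * C + 3) * h.
Proof.
move=> C0 h0 sh sc ct ct' kk.
pose z := vadd k' (vscale h (ebasis i)).
have h1 := ct' z; have h2 := ct k'.
have zk j : Rabs (vsub z k j) <= 2 * h.
  rewrite /z /vsub /vadd /vscale /ebasis; have := kk j.
  by case: (j == i); split_Rabs; lra.
have [h3 _] := contact_affine z sc ct; have h4 := dot_coord_le zk.
have h5 := dot_ge0 (vsub z k).
have e1 : dot p (vsub z k) = dot p (vsub k' k) + h * p i.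
  rewrite !dotBr /z dotDr dotZr dot_ebasis; ring.
have e2 : dot p' (vsub z k') = h * p' i.
  rewrite !dotBr /z dotDr dotZr dot_ebasis; ring.
have h6 : C * sqn (vsub z k) <= C * (INR #|I| * (2 * h * (2 * h))).
  exact: Rmult_le_compat_l.
apply: (Rmult_le_reg_r h) => //; rewrite e1 in h3; rewrite e2 in h1; lra.
Qed.

(** Quadratic decay keeps [F] minus a linear function bounded above, so approximate maximisers exist
    for every slope. *)
Lemma contact_exists (I : finType) (F : vec I -> R) g s p : 0 < g -> 0 < s ->
  (forall z, F z <= F (fun _ => 0) - g * dot z z) ->
  exists k, contact F s k p /\ g * dot k k <= s - dot p k /\
    F (fun _ => 0) + dot p k - s <= F k.
Proof.
move=> g0 s0 Fg.
have [k hk] : exists k, forall z, F z - dot p z <= F k - dot p k + s.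
  (* [|p|^2 / (4 g)] is the maximum of [|p| r - g r^2] over [r]. *)
  apply: (near_sup (fun _ => 0) (B := F (fun _ => 0) + vnorm p * vnorm p / (4 * g))) => // z.
  have h1 := Fg z; have h2 := dot_le (vscale (-1) p) z; rewrite dotZl vnormZ in h2.
  rewrite Rabs_left in h2; last by lra.
  have : 0 <= (vnorm p - 2 * g * vnorm z) * (vnorm p - 2 * g * vnorm z) / (4 * g).
    apply: Rmult_le_pos; first exact: Rle_0_sqr.
    by apply: Rlt_le; apply: Rinv_0_lt_compat; lra.
  have -> : (vnorm p - 2 * g * vnorm z) * (vnorm p - 2 * g * vnorm z) / (4 * g)
    = vnorm p * vnorm p / (4 * g) - vnorm p * vnorm z + g * (vnorm z * vnorm z).
    by field; lra.
  by rewrite (vnorm_sq z); lra.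
exists k; have h0 := hk (fun _ => 0).
have e0 : dot p (fun _ => 0) = 0 by apply: rsum0 => i; ring.
split; last by have := Fg k; rewrite e0 in h0; split; lra.
by move=> z; have := hk z; rewrite dotBr; lra.
Qed.

Lemma affine_interp (I : finType) (c : R) (p t th : vec I) :
  c + dot p (vadd t th) = c + dot p t
   + rsum (fun i => th i * ((c + dot p (vadd t (ebasis i))) - (c + dot p t))).
Proof.
rewrite dotDr -Rplus_assoc; congr (_ + _); rewrite dotC; apply: rsum_ext => i.
by rewrite dotDr dot_ebasis; ring.
Qed.

(** Affine functions are determined by the vertices [t] and [t + e_i] of the cell, so the
    interpolation error of a quadratic polynomial involves its Hessian alone. *)
Lemma qpoly_interp (I : finType) (c : R) (b : vec I) (A : mx I) (t th : vec I) : msym A ->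
  qpoly c b A (vadd t th) = qpoly c b A t
   + rsum (fun i => th i * (qpoly c b A (vadd t (ebasis i)) - qpoly c b A t))
   + (quad A th - rsum (fun i => th i * A i i)) / 2.
Proof.
move=> As; rewrite [X in _ + X + _](_ : _ = dot b th + bil A t th + rsum (fun i => th i * A i i) / 2).
  by rewrite /qpoly dotDr quadD //; field.
rewrite (_ : bil A t th = rsum (fun i => th i * rsum (fun j => A j i * t j))).
  rewrite /Rdiv (Rmult_comm (rsum _)) -rsumZ -!rsumD; apply: rsum_ext => i.
  by rewrite qpoly_step //; field.
rewrite /bil rsum_exch; apply: rsum_ext => i; rewrite -rsumZ; apply: rsum_ext => j; ring.
Qed.

Lemma quad_small (I : finType) (A : mx I) a (th : vec I) : 0 <= a ->
  (forall i j, Rabs (A i j) <= a) -> (forall i, Rabs (th i) <= 1) ->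
  Rabs ((quad A th - rsum (fun i => th i * A i i)) / 2) <= a * (INR #|I| + 1) * (INR #|I| + 1).
Proof.
move=> a0 Aa th1; have n0 := pos_INR #|I|.
have h1 := bil_bound th th a0 Aa.
have s1 : rsum (fun i => Rabs (th i)) <= INR #|I|.
  by rewrite -[INR _]Rmult_1_r -rsum_cst; exact: rsum_le.
have s0 : 0 <= rsum (fun i => Rabs (th i)) by apply: rsum_ge0 => i; exact: Rabs_pos.
have h3 : Rabs (rsum (fun i => th i * A i i)) <= INR #|I| * a.
  apply: Rle_trans (Rabs_rsum _) _; rewrite -rsum_cst; apply: rsum_le => i.
  rewrite Rabs_mult; have := Aa i i; have := th1 i; have := Rabs_pos (th i).
  have := Rabs_pos (A i i); nra.
have h4 := Rmult_le_compat_l _ _ _ a0 (Rmult_le_compat _ _ _ _ s0 s0 s1 s1).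
have h5 : Rabs (quad A th) <= a * (INR #|I| * INR #|I|) by exact: Rle_trans h1 h4.
have h6 : 0 <= a * INR #|I| by nra.
rewrite /Rdiv Rabs_mult (Rabs_pos_eq (/ 2)); last by lra.
have := Rabs_triang (quad A th) (- rsum (fun i => th i * A i i)); rewrite Rabs_Ropp -/(Rminus _ _).
nra.
Qed.

Definition lat_pt (I : finType) (y0 : vec I) (s : R) (tau : vec I) : vec I :=
  vadd y0 (vscale s tau).

(** 36 is the square of 6: contact points are within [5 s] of a vertex and the cell adds [s]. The 2
    collects the slack [sg] and the lattice error, the factor [2 n + 2] the interpolation over the
    vertices, and the last term the Hessian remainder. *)
Definition cell_const (n C C4 : R) : R :=
  (36 * n * C + 2) * (2 * n + 2) + C4 * (n + 1) * (n + 1).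

(** In each cell [F] is close to the affine function of a nearby contact point. That function is
    close to the quadratic at the vertices, hence on the whole cell, up to the Hessian remainder.
    The contact points thus replace any modulus of continuity of [F] between lattice points. *)
Lemma cell_estimate (I : finType) (F : vec I -> R) C C4 s sg N y0 c b (A : mx I) tau :
  0 <= C -> 0 <= C4 -> 0 < s -> sg <= s * s -> semiconvex F C ->
  msym A -> (forall i j, Rabs (A i j) <= C4 * (s * s)) ->
  (forall t, ncube N t ->
     Rabs (F (lat_pt y0 s (nvec t)) - qpoly c b A (nvec t)) <= s * s) ->
  (forall t, ncube N t -> exists k p, contact F sg k p /\
     forall i, Rabs (lat_pt y0 s (nvec t) i - k i) <= 5 * s) ->
  (forall i, 0 <= tau i < INR N) ->
  Rabs (F (lat_pt y0 s tau) - qpoly c b A tau) <= cell_const (INR #|I|) C C4 * (s * s).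
Proof.
move=> C0 C40 s0 sgs sc As Ab LQ CT tauN; set n := INR #|I|.
have n0 : 0 <= n by exact: pos_INR.
have fl i := nat_floor (proj1 (tauN i)).
pose t i := proj1_sig (constructive_indefinite_description _ (fl i)).
have tP i : INR (t i) <= tau i < INR (t i) + 1.
  by rewrite /t; case: constructive_indefinite_description.
(* Strictness is needed so that the vertices [t + e_i] are still in the cube. *)
have tN i : (t i < N)%N.
  by apply/ltP; apply: INR_lt; have := tP i; have := tauN i; lra.
have tN0 : ncube N t by move=> i; exact: ltnW.
have tN1 i : ncube N (nstep t i).
  move=> j; rewrite /nstep; case: (j == i); last by rewrite addn0; exact: ltnW.
  by rewrite addn1.
have [k [p [ct kP]]] := CT _ tN0.
pose th i := tau i - INR (t i).
have th1 i : 0 <= th i <= 1 by have := tP i; rewrite /th; lra.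
have tauE : tau = vadd (nvec t) th by apply: vec_ext => i; rewrite /vadd /th /nvec; ring.
pose c' := F k + dot p (vsub y0 k).
pose aff (v : vec I) := c' + dot (vscale s p) v.
have affE v : F k + dot p (vsub (lat_pt y0 s v) k) = aff v.
  by rewrite /aff /c' /lat_pt !dotBr dotDr dotZl dotZr; ring.
pose B := C * n * (6 * s * (6 * s)) + sg.
have near v : (forall i, Rabs (v i - INR (t i)) <= 1) ->
    Rabs (F (lat_pt y0 s v) - aff v) <= B.
  move=> v1; rewrite -affE; apply: contact_affine_abs => // i.
  have := kP i; rewrite /lat_pt /vadd /vscale /nvec => h.
  have -> : y0 i + s * v i - k i = (y0 i + s * INR (t i) - k i) + s * (v i - INR (t i)) by ring.
  have := Rabs_triang (y0 i + s * INR (t i) - k i) (s * (v i - INR (t i))).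
  rewrite Rabs_mult (Rabs_pos_eq s); last by lra.
  by have := v1 i; nra.
pose D := B + s * s.
have d0 : Rabs (aff (nvec t) - qpoly c b A (nvec t)) <= D.
  have h1 := LQ _ tN0; have h2 : Rabs (F (lat_pt y0 s (nvec t)) - aff (nvec t)) <= B.
    by apply: near => i; rewrite /nvec Rminus_diag Rabs_R0; lra.
  by rewrite /D; split_Rabs; lra.
have d1 i : Rabs (aff (vadd (nvec t) (ebasis i)) - qpoly c b A (vadd (nvec t) (ebasis i))) <= D.
  have h1 := LQ _ (tN1 i); rewrite nvec_step in h1.
  have h2 : Rabs (F (lat_pt y0 s (vadd (nvec t) (ebasis i))) - aff (vadd (nvec t) (ebasis i))) <= B.
    apply: near => j; rewrite /vadd /nvec /ebasis.
    by case: (j == i); split_Rabs; lra.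
  by rewrite /D; split_Rabs; lra.
have D0 : 0 <= D by apply: Rle_trans d0; exact: Rabs_pos.
have h1 : Rabs (F (lat_pt y0 s tau) - aff tau) <= B.
  by apply: near => i; have := th1 i; rewrite /th; split_Rabs; lra.
have A0 : 0 <= C4 * (s * s) by nra.
have h2 : Rabs ((quad A th - rsum (fun i => th i * A i i)) / 2)
    <= C4 * (s * s) * (n + 1) * (n + 1).
  by apply: quad_small => // i; have := th1 i; split_Rabs; lra.
have h3 : aff tau - qpoly c b A tau
   = (aff (nvec t) - qpoly c b A (nvec t))
   + rsum (fun i => th i * ((aff (vadd (nvec t) (ebasis i)) - qpoly c b A (vadd (nvec t) (ebasis i)))
                      - (aff (nvec t) - qpoly c b A (nvec t))))
   - (quad A th - rsum (fun i => th i * A i i)) / 2.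
  rewrite tauE {1}/aff affine_interp qpoly_interp // -!/(aff _).
  rewrite [X in _ = _ + X - _](_ : _ =
    rsum (fun i => th i * (aff (vadd (nvec t) (ebasis i)) - aff (nvec t)))
    - rsum (fun i => th i * (qpoly c b A (vadd (nvec t) (ebasis i)) - qpoly c b A (nvec t)))).
    by rewrite /aff; ring.
  by rewrite -rsumB; apply: rsum_ext => i; ring.
have h4 : Rabs (rsum (fun i => th i * ((aff (vadd (nvec t) (ebasis i))
     - qpoly c b A (vadd (nvec t) (ebasis i))) - (aff (nvec t) - qpoly c b A (nvec t)))))
   <= n * (2 * D).
  apply: Rle_trans (Rabs_rsum _) _; rewrite -rsum_cst; apply: rsum_le => i.
  rewrite Rabs_mult; have := d1 i; have := th1 i.
  set x := aff _ - qpoly _ _ _ _; set y := aff _ - qpoly _ _ _ _ in d0 *.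
  move=> t1 dx; have hxy : Rabs (x - y) <= 2 * D by split_Rabs; lra.
  rewrite Rabs_pos_eq; last by lra.
  by have := Rabs_pos (x - y); nra.
have h5 : Rabs (aff tau - qpoly c b A tau) <= D + n * (2 * D) + C4 * (s * s) * (n + 1) * (n + 1).
  rewrite h3; move: h2 h4 d0.
  set x1 := (quad _ _ - _) / 2; set x2 := rsum _; set x3 := _ - qpoly _ _ _ _.
  by split_Rabs; lra.
have h6 : Rabs (F (lat_pt y0 s tau) - qpoly c b A tau)
   <= B + (D + n * (2 * D) + C4 * (s * s) * (n + 1) * (n + 1)).
  by move: h1 h5; split_Rabs; lra.
apply: Rle_trans h6 _; rewrite /cell_const.
have DB : D <= (36 * n * C + 2) * (s * s) by rewrite /D /B; nra.
have BD : B <= D by rewrite /D; nra.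
have : n * D <= n * ((36 * n * C + 2) * (s * s)) by exact: Rmult_le_compat_l.
by lra.
Qed.

(* A large lattice cube turns an error of order [s^2] into a small multiple of the squared radius. *)
Lemma lattice_to_ball (I : finType) (F : vec I -> R) C C4 s sg m y0 c b (A : mx I) eps del :
  0 <= C -> 0 <= C4 -> 0 < s -> sg <= s * s -> semiconvex F C -> 6 < INR m ->
  2 * cell_const (INR #|I|) C C4 <= eps / 4 * ((INR m - 6) * (INR m - 6)) ->
  msym A -> (forall i j, Rabs (A i j) <= C4 * (s * s)) ->
  (forall t, ncube (2 * m) t ->
     Rabs (F (lat_pt y0 s (nvec t)) - qpoly c b A (nvec t)) <= s * s) ->
  (forall t, ncube (2 * m) t -> exists k p, contact F sg k p /\
     (forall i, Rabs (p i) <= del) /\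
     forall i, Rabs (lat_pt y0 s (nvec t) i - k i) <= 5 * s) ->
  exists k b' Z, msym Z /\ (forall i j, Rabs (Z i j) <= C4) /\
    (exists p, contact F sg k p /\ forall i, Rabs (p i) <= del) /\
    forall e, vnorm e <= s * (INR m - 6) ->
      Rabs (F (vadd k e) - F k - dot b' e - quad Z e / 2)
        <= eps / 4 * (s * (INR m - 6) * (s * (INR m - 6))).
Proof.
move=> C0 C40 s0 sgs sc m6 meps As Ab LQ CT.
have s20 : 0 < s * s by nra.
(* The centre of the cube. Its contact point [k] is within 5 lattice steps, so a ball of [m - 6]
   steps around [k] stays in the cube. *)
pose t : I -> nat := fun _ => m.
have tN : ncube (2 * m) t by move=> i; rewrite /t mul2n -addnn leq_addr.
have [k [p [ct [pd kP]]]] := CT _ tN.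
pose tc : vec I := fun i => (k i - y0 i) / s.
have tcE i : s * tc i = k i - y0 i by rewrite /tc; field; lra.
have tcP i : Rabs (INR m - tc i) <= 5.
  have := kP i; rewrite /lat_pt /vadd /vscale /nvec /t.
  have -> : y0 i + s * INR m - k i = s * (INR m - tc i) by rewrite Rmult_minus_distr_l tcE; ring.
  by rewrite Rabs_mult (Rabs_pos_eq s); [nra|lra].
have kE e : vadd k e = lat_pt y0 s (vadd tc (vscale (/ s) e)).
  apply: vec_ext => i; rewrite /lat_pt /vadd /vscale Rmult_plus_distr_l tcE.
  by field; lra.
have est e : vnorm e <= s * (INR m - 6) ->
    Rabs (F (vadd k e) - qpoly c b A (vadd tc (vscale (/ s) e)))
      <= cell_const (INR #|I|) C C4 * (s * s).
  move=> er; rewrite kE; apply: (cell_estimate (N := (2 * m)%N) C0 C40 s0 sgs sc) => // [u uN|i].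
    by have [k1 [p1 [? [_ ?]]]] := CT _ uN; exists k1, p1.
  have h1 := tcP i; have h2 := vnorm_coord e i.
  have h3 : Rabs (/ s * e i) <= INR m - 6.
    rewrite Rabs_mult Rabs_pos_eq; last by apply: Rlt_le; exact: Rinv_0_lt_compat.
    apply: (Rmult_le_reg_l s) => //; rewrite -Rmult_assoc Rinv_r; last by lra.
    by lra.
  rewrite /vadd /vscale mult_INR /=; split_Rabs; lra.
(* From lattice units back to the units of the space; [b'] also recentres the linear part at [k]. *)
pose Z := mscale (/ (s * s)) A.
pose b' : vec I := fun i => (b i + rsum (fun j => A j i * tc j)) / s.
exists k, b', Z; split; first by move=> i j; rewrite /Z /mscale As.
split.
  move=> i j; rewrite /Z /mscale Rabs_mult Rabs_pos_eq; last first.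
    by apply: Rlt_le; exact: Rinv_0_lt_compat.
  apply: (Rmult_le_reg_l (s * s)) => //; rewrite -Rmult_assoc Rinv_r; last by lra.
  by have := Ab i j; lra.
split; first by exists p.
move=> e er.
have h0 : vnorm (fun _ : I => 0) <= s * (INR m - 6).
  rewrite vnorm_dot [dot _ _]rsum0 ?sqrt_0; last by move=> i; ring.
  by nra.
have := est _ h0; have := est _ er.
have -> : vadd k (fun _ => 0) = k by vec_ring.
have -> : vadd tc (vscale (/ s) (fun _ => 0)) = tc.
  by vec_ring.
have -> : qpoly c b A (vadd tc (vscale (/ s) e)) = qpoly c b A tc + dot b' e + quad Z e / 2.
  have -> : dot b' e = / s * dot b e + / s * bil A tc e.
    rewrite /dot /bil rsum_exch -!rsumZ -rsumD; apply: rsum_ext => i.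
    rewrite (_ : rsum (fun j => tc j * A j i * e i) = rsum (fun j => A j i * tc j) * e i).
      by rewrite /b'; field; lra.
    by rewrite Rmult_comm -rsumZ; apply: rsum_ext => j; ring.
  rewrite /Z quad_mscale /qpoly dotDr dotZr quadD // quadZ.
  have -> : bil A tc (vscale (/ s) e) = / s * bil A tc e.
    rewrite /bil -rsumZ; apply: rsum_ext => i; rewrite -rsumZ; apply: rsum_ext => j.
    by rewrite /vscale; ring.
  by field; lra.
set q := qpoly _ _ _ _ => h1 h2.
have h3 : Rabs (F (vadd k e) - F k - dot b' e - quad Z e / 2)
   <= 2 * cell_const (INR #|I|) C C4 * (s * s).
  by split_Rabs; lra.
apply: Rle_trans h3 _.
have -> : eps / 4 * (s * (INR m - 6) * (s * (INR m - 6)))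
  = eps / 4 * ((INR m - 6) * (INR m - 6)) * (s * s) by ring.
by apply: Rmult_le_compat_r => //; lra.
Qed.

(** The expansion of [F] at [k] is compared with the two-sided contact bound. Adding the
    inequalities at opposite points cancels the slopes and bounds [Z] from above; a single point on
    each axis bounds the difference of the slopes. *)
Lemma contact_hessian (I : finType) (F : vec I -> R) C C4 sg k p b (Z : mx I) r eps :
  0 <= C -> 0 <= C4 -> 0 < r -> 0 < eps <= 1 -> sg <= eps / 8 * (r * r) ->
  semiconvex F C -> contact F sg k p -> (forall i j, Rabs (Z i j) <= C4) ->
  (forall e, vnorm e <= r ->
      Rabs (F (vadd k e) - F k - dot b e - quad Z e / 2) <= eps / 4 * (r * r)) ->
  (forall xi, quad Z xi <= eps * dot xi xi) /\
  (forall i, Rabs (b i - p i) <= (C + C4 + 1) * r).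
Proof.
move=> C0 C40 r0 [e0 e1] sgr sc ct Zb ex.
have r20 : 0 < r * r by nra.
have ker e : vsub (vadd k e) k = e by vec_ring.
have main e : vnorm e <= r ->
    - (C * dot e e) - sg - eps / 4 * (r * r) <= dot b e - dot p e + quad Z e / 2
      <= sg + eps / 4 * (r * r).
  move=> er; have := contact_affine (vadd k e) sc ct; rewrite ker => h.
  by have := ex _ er; split_Rabs; lra.
split.
  move=> xi; case: (Req_dec (vnorm xi) 0) => [x0|xn].
    rewrite (_ : quad Z xi = 0); first by have := dot_ge0 xi; nra.
    by rewrite /quad rsum0 // => i; rewrite rsum0 // => j; rewrite (vnorm0P x0 i); ring.
  have xp : 0 < vnorm xi by have := vnorm_ge0 xi; lra.
  (* Both sides scale quadratically, so it suffices to test on the sphere of radius [r], where the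
     error is a fraction of [eps r^2]. *)
  pose l := r / vnorm xi.
  have lE : l * vnorm xi = r by rewrite /l; field.
  have l0 : 0 < l by apply: Rdiv_lt_0_compat.
  have n1 : vnorm (vscale l xi) <= r by rewrite vnormZ Rabs_pos_eq; lra.
  have n2 : vnorm (vscale (- l) xi) <= r by rewrite vnormZ Rabs_left; lra.
  have [_ h1] := main _ n1; have [_ h2] := main _ n2.
  rewrite !dotZr !quadZ in h1 h2.
  apply: (Rmult_le_reg_l (l * l)); first by nra.
  have -> : l * l * (eps * dot xi xi) = eps * (r * r) by rewrite -vnorm_sq -lE; ring.
  by nra.
move=> i.
have hn a : Rabs a = r -> vnorm (vscale a (ebasis i)) <= r.
  by move=> ar; rewrite vnormZ vnorm_ebasis ar; lra.
have h1 := main _ (hn r (Rabs_pos_eq _ (Rlt_le _ _ r0))).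
have nr : Rabs (- r) = r by rewrite Rabs_left; lra.
have h2 := main _ (hn (- r) nr).
rewrite !dotZr !dotZl !quadZ !dot_ebasis quad_ebasis {1 2}/ebasis eqxx in h1 h2.
have Zi := Zb i i; have := Rabs_pos (Z i i) => Zi0.
have h3 : Rabs (r * r * (Z i i / 2)) <= C4 * (r * r).
  by rewrite Rabs_mult Rabs_pos_eq; [split_Rabs; nra|lra].
have h4 : eps * (r * r) <= r * r by nra.
have h5 : 0 <= C * (r * r) by nra.
have h6 : r * (b i - p i) <= r * ((C + C4 + 1) * r).
  by move: h3; split_Rabs; lra.
have h7 : r * - (b i - p i) <= r * ((C + C4 + 1) * r).
  by move: h3; split_Rabs; lra.
by apply: Rabs_le; split; nra.
Qed.

(* A grid with wrap-around makes sums translation invariant; all points that matter stay far from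
   the seam, see [tpos_shift]. *)
Definition torus (I : finType) (L : nat) : Type := {ffun I -> 'I_L.+1}.
HB.instance Definition _ (I : finType) (L : nat) :=
  GRing.Zmodule.copy (torus I L) {ffun I -> 'I_L.+1}.
HB.instance Definition _ (I : finType) (L : nat) :=
  Finite.copy (torus I L) {ffun I -> 'I_L.+1}.

Definition tvec (I : finType) (L : nat) (w : I -> nat) : torus I L :=
  [ffun i => inZp (w i) : 'I_L.+1].

Definition tcoord (I : finType) (L : nat) (v : torus I L) (i : I) : nat :=
  (v : {ffun I -> 'I_L.+1}) i.

Lemma tcoord_lt (I : finType) (L : nat) (v : torus I L) i : (tcoord v i < L.+1)%N.
Proof. exact: ltn_ord. Qed.

Lemma tcoord_add (I : finType) (L : nat) (v w : torus I L) i :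
  tcoord (v +g w) i = ((tcoord v i + tcoord w i) %% L.+1)%N.
Proof. by rewrite /tcoord ffunE. Qed.

Lemma tcoord_tvec (I : finType) (L : nat) w i : tcoord (tvec L w : torus I L) i = (w i %% L.+1)%N.
Proof. by rewrite /tcoord ffunE. Qed.

Lemma tcoord_inj (I : finType) (L : nat) (v w : torus I L) :
  (forall i, tcoord v i = tcoord w i) -> v = w.
Proof. by move=> h; apply/ffunP => i; apply: val_inj; exact: h. Qed.

Lemma tvecD (I : finType) (L : nat) (w w' : I -> nat) :
  tvec L (fun i => (w i + w' i)%N) = tvec L w +g tvec L w'.
Proof. by apply: tcoord_inj => i; rewrite tcoord_add !tcoord_tvec modnDm. Qed.

Lemma tvecM (I : finType) (L : nat) (w : I -> nat) m :
  tvec L w **g m = tvec L (fun i => (w i * m)%N).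
Proof.
elim: m => [|m IH]; last by rewrite GRing.mulrS IH -tvecD; congr tvec;
  apply: functional_extensionality => i; rewrite mulnS.
rewrite GRing.mulr0n; apply: tcoord_inj => i; rewrite tcoord_tvec muln0 mod0n.
by rewrite /tcoord ffunE.
Qed.

Lemma tcoord_shift (I : finType) (L : nat) (v : torus I L) w i :
  (tcoord v i + w i <= L)%N -> tcoord (v +g tvec L w) i = (tcoord v i + w i)%N.
Proof. by move=> h; rewrite tcoord_add tcoord_tvec modnDmr modn_small. Qed.

(** Boxes of half side [4 * 2^k] around the points [q j], with a shift on each side because shifts
    are natural numbers. The 4 is the largest entry of a sum of two directions [dirw]. *)
Definition nearset (I J : finType) (L : nat) (q : J -> torus I L) (k : nat) : {set torus I L} :=
  [set v | pbool (exists j w1 w2, (forall i, (w1 i <= 4 * expn 2 k)%N) /\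
     (forall i, (w2 i <= 4 * expn 2 k)%N) /\ v +g tvec L w2 = q j +g tvec L w1)].

(** Twice [4 * 2^k] is [4 * 2^(k+1)], so undoing a shift costs exactly one scale. This is the
    inclusion that [good_scale] requires. *)
Lemma nearset_back (I J : finType) (L : nat) (q : J -> torus I L) k x w :
  (forall i, (w i <= 4 * expn 2 k)%N) -> x +g tvec L w \in nearset q k ->
  x \in nearset q k.+1.
Proof.
move=> wk; rewrite !inE => /pboolP [j [w1 [w2 [h1 [h2 e]]]]]; apply/pboolP.
exists j, w1, (fun i => (w i + w2 i)%N); split=> [i|].
  by apply: leq_trans (h1 i) _; rewrite leq_mul2l leq_exp2l // leqnSn orbT.
split=> [i|]; last by rewrite tvecD GRing.addrA.
by rewrite expnS mulnCA mul2n -addnn leq_add.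
Qed.

Lemma nearset_fwd (I J : finType) (L : nat) (q : J -> torus I L) k c x w :
  (forall i, (4 * expn 2 k + w i <= 4 * expn 2 (k + c))%N) -> x \in nearset q k ->
  x +g tvec L w \in nearset q (k + c).
Proof.
move=> wk; rewrite !inE => /pboolP [j [w1 [w2 [h1 [h2 e]]]]]; apply/pboolP.
exists j, (fun i => (w1 i + w i)%N), w2; split=> [i|].
  by apply: leq_trans (wk i); rewrite leq_add2r.
split=> [i|]; last by rewrite tvecD GRing.addrA -e GRing.addrAC.
by apply: leq_trans (h2 i) _; apply: leq_trans (wk i); rewrite leq_addr.
Qed.

(** Away from the seam, closeness modulo [L + 1] is closeness of the coordinates themselves. *)
Lemma nearset_val (I J : finType) (L : nat) (q : J -> torus I L) k v :
  (forall j i, (4 * expn 2 k <= tcoord (q j) i)%N /\ (tcoord (q j) i + 4 * expn 2 k <= L)%N) ->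
  v \in nearset q k ->
  exists j, forall i, (tcoord v i <= tcoord (q j) i + 4 * expn 2 k)%N /\
     (tcoord (q j) i <= tcoord v i + 4 * expn 2 k)%N.
Proof.
move=> hq; rewrite !inE => /pboolP [j [w1 [w2 [h1 [h2 e]]]]]; exists j => i.
have [l1 l2] := hq j i.
have e' : tcoord (v +g tvec L w2) i = tcoord (q j +g tvec L w1) i by rewrite e.
rewrite [RHS]tcoord_shift in e'; last by apply: leq_trans l2; rewrite leq_add2l.
have w2q : (w2 i <= tcoord (q j) i + w1 i)%N.
  by apply: leq_trans (h2 i) _; apply: leq_trans l1 _; rewrite leq_addr.
have vE : tcoord v i = (tcoord (q j) i + w1 i - w2 i)%N.
  rewrite -(modn_small (tcoord_lt v i)).
  rewrite -(@modn_small (tcoord (q j) i + w1 i - w2 i)%N L.+1); last first.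
    rewrite ltnS; apply: leq_trans (leq_subr _ _) _; apply: leq_trans l2.
    by rewrite leq_add2l.
  apply/eqP; rewrite -(eqn_modDr (w2 i)) subnK // -e' tcoord_add tcoord_tvec.
  by rewrite modnDmr modn_mod.
rewrite vE; split.
  by apply: leq_trans (leq_subr _ _) _; rewrite leq_add2l.
apply: leq_trans (leq_add (leqnn _) (h2 i)).
by rewrite subnK // leq_addr.
Qed.

Lemma nearset_self (I J : finType) (L : nat) (q : J -> torus I L) j : q j \in nearset q 0.
Proof.
by rewrite inE; apply/pboolP; exists j, (fun=> 0%N), (fun=> 0%N).
Qed.

Lemma card_nearset (I J : finType) (L : nat) (q : J -> torus I L) :
  injective q -> (#|J| <= #|nearset q 0|)%N.
Proof.
move=> qi; rewrite -cardsT -(card_imset _ qi); apply: subset_leq_card.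
by apply/subsetP => v /imsetP [j _ ->]; exact: nearset_self.
Qed.

Lemma choice_fun (A B : Type) (P : A -> B -> Prop) :
  (forall a, exists b, P a b) -> exists f : A -> B, forall a, P a (f a).
Proof.
move=> h; exists (fun a => proj1_sig (constructive_indefinite_description _ (h a))) => a.
by case: constructive_indefinite_description.
Qed.

(** The decay [g |k|^2] against the linear term [|p| |k|] confines the contact points with small
    slopes to a ball. *)
Lemma contact_small (I : finType) (F : vec I -> R) g sg k p del R0 :
  0 < g -> 0 <= del -> 0 < R0 -> 2 * (INR #|I| + 1) * del <= g * R0 ->
  sg <= g * (R0 * R0) / 2 ->
  (forall z, F z <= F (fun _ => 0) - g * dot z z) ->
  contact F sg k p -> (forall i, Rabs (p i) <= del) -> vnorm k <= R0.
Proof.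
move=> g0 d0 R00 dR sR Fg ct pd.
have pn := vnorm_coord_le d0 pd.
have h1 := ct (fun _ => 0); have h2 := Fg k.
have e0 : dot p (fun _ => 0) = 0 by apply: rsum0 => i; ring.
rewrite dotBr e0 in h1; rewrite -vnorm_sq in h2.
have h3 := cauchy_schwarz p k.
apply: Rnot_lt_le => hk.
have h4 : g * (vnorm k * vnorm k) <= vnorm p * vnorm k + sg by split_Rabs; lra.
have h5 : vnorm p * vnorm k <= (INR #|I| + 1) * del * vnorm k.
  by apply: Rmult_le_compat_r => //; exact: vnorm_ge0.
have h6 : R0 * R0 < vnorm k * vnorm k by nra.
have h7 : R0 * vnorm k < vnorm k * vnorm k by nra.
have h8 : 2 * (INR #|I| + 1) * del * vnorm k <= g * R0 * vnorm k.
  by apply: Rmult_le_compat_r => //; exact: vnorm_ge0.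
by nra.
Qed.

(** The affine function of the contact point has vanishing second differences, so only its four
    errors remain. *)
Lemma second_diff_bound (I : finType) (F : vec I -> R) C sg k p a z al be :
  0 <= C -> semiconvex F C -> contact F sg k p ->
  (forall i, Rabs (z i - k i) <= a) -> (forall i, Rabs (z i + al i - k i) <= a) ->
  (forall i, Rabs (z i + be i - k i) <= a) -> (forall i, Rabs (z i + al i + be i - k i) <= a) ->
  Rabs (F (vadd (vadd z al) be) - F (vadd z al) - (F (vadd z be) - F z))
    <= 4 * (C * INR #|I| * (a * a) + sg).
Proof.
move=> C0 sc ct h1 h2 h3 h4.
have k1 := contact_affine_abs C0 sc ct h1.
have k2 := @contact_affine_abs _ F C sg k p (vadd z al) a C0 sc ct h2.
have k3 := @contact_affine_abs _ F C sg k p (vadd z be) a C0 sc ct h3.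
have k4 := @contact_affine_abs _ F C sg k p (vadd (vadd z al) be) a C0 sc ct h4.
rewrite !dotBr !dotDr in k1 k2 k3 k4.
move: k1 k2 k3 k4; set B := C * _ * _ + _.
by split_Rabs; lra.
Qed.

Lemma osc_third (G : finZmodType) (u : G -> R) a b e S k y :
  osc_small u a b e S k y ->
  Rabs (fdiff (a *2^ k) (fdiff (a *2^ k) (fdiff (b *2^ k) u)) y)
    <= e * 4 ^ k.
Proof.
move=> [_ [h _]]; have p4 : 0 < 4 ^ k by apply: pow_lt; lra.
move: h; rewrite /sdiff; set f := fdiff _ (fdiff _ u).
rewrite /fdiff; move: (f y) (f (y +g a *2^ k)) => x x' h.
have -> : x' - x = - ((x / 4 ^ k - x' / 4 ^ k) * 4 ^ k) by field; lra.
by rewrite Rabs_Ropp Rabs_mult (Rabs_pos_eq (4 ^ k)); [apply: Rmult_le_compat_r; lra|lra].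
Qed.

(** Besides the coordinate directions, the sums of two of them are included: polarization needs
    third differences that repeat such a sum. *)
Definition dirw (I : finType) (a : I + I * I) : I -> nat :=
  match a with
  | inl i => fun l => (l == i : nat)
  | inr p => fun l => ((l == p.1) + (l == p.2))%N
  end.

Lemma dirw_le2 (I : finType) (a : I + I * I) l : (dirw a l <= 2)%N.
Proof. by case: a => [i|[i j]] /=; do ?case: (_ == _). Qed.

Lemma INR_expn2 k : INR (expn 2 k) = 2 ^ k.
Proof. by elim: k => [|k IH] //; rewrite expnS mult_INR IH /=; ring. Qed.

Lemma pow4 k : 4 ^ k = 2 ^ k * 2 ^ k.
Proof. by rewrite -Rpow_mult_distr; congr (_ ^ _); ring. Qed.

(** 81 is the square of 9: a point at distance [5 s] from a contact point, plus at most [4 s] from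
    two directions. *)
Definition sdiff_const (n C : R) : R := 4 * (81 * n * C + 1).

Definition tpos (I : finType) (L : nat) (R0 h : R) (v : torus I L) : vec I :=
  fun i => - (3 * R0) + h * INR (tcoord v i).

Lemma tpos_shift (I : finType) (L : nat) R0 h (v : torus I L) w :
  (forall i, (tcoord v i + w i <= L)%N) ->
  tpos R0 h (v +g tvec L w) = vadd (tpos R0 h v) (vscale h (nvec w)).
Proof.
move=> hw; apply: vec_ext => i; rewrite /tpos tcoord_shift // /vadd /vscale /nvec plus_INR.
ring.
Qed.

Definition lat_exp (I : finType) (L : nat) (x : torus I L) (k : nat) (t : I -> nat) : torus I L :=
  x +g tvec L (fun i => (t i * expn 2 k)%N).

Lemma lat_exp_step (I : finType) (L : nat) (x : torus I L) k t i :
  lat_exp x k (nstep t i) = lat_exp x k t +g tvec L (dirw (inl i)) *2^ k.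
Proof.
rewrite /lat_exp tvecM -GRing.addrA -tvecD; congr (_ +g tvec _ _).
by apply: functional_extensionality => j; rewrite /nstep mulnDl.
Qed.

(** Polarization expresses twice a mixed third difference through three third differences with a
    repeated direction, hence the factor [3 / 2]. It starts one step before the point in question,
    so the lattice is shifted by 1, and the cube of side [N + 2] contains all points that occur. *)
Lemma lattice_third (I : finType) (L N : nat) (x : torus I L) k (u : torus I L -> R) e S :
  (forall t, ncube (N + 2) t -> forall a b : I + I * I,
     osc_small u (tvec L (dirw a)) (tvec L (dirw b)) e S k (lat_exp x k t)) ->
  forall i j l t, ncube N t ->
  Rabs (ndiff i (ndiff j (ndiff l (fun t => u (lat_exp x k (fun i => (t i).+1))))) t)
    <= 3 / 2 * (e * 4 ^ k).
Proof.
move=> osc i j l t tN.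
pose E (i : I) := tvec L (dirw (inl i)) *2^ k.
pose Y (t : I -> nat) := lat_exp x k (fun i => (t i).+1).
have Ystep s i' : Y (nstep s i') = Y s +g E i'.
  by rewrite /Y -lat_exp_step; congr lat_exp.
have -> : ndiff i (ndiff j (ndiff l (fun t => u (Y t)))) t
    = fdiff (E i) (fdiff (E j) (fdiff (E l) u)) (Y t).
  by rewrite /ndiff /fdiff !Ystep.
(* The starting point of the polarization, one step back in direction [j]; thanks to the shift by 1
   the subtraction is never truncated. *)
pose t0 : I -> nat := fun l => ((t l).+1 - (l == j))%N.
have Yt : Y t = lat_exp x k t0 +g E j.
  rewrite -lat_exp_step; congr lat_exp; apply: functional_extensionality => l'.
  by rewrite /nstep /t0 subnK //; case: (_ == _).
have t0N : ncube (N + 2) t0.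
  move=> l'; rewrite /t0; apply: leq_trans (leq_subr _ _) _.
  by rewrite addn2 ltnS; apply: leq_trans (tN l') _; exact: leqnSn.
have t2N : ncube (N + 2) (fun l => (nstep t j l).+1).
  move=> l'; rewrite addn2 ltnS /nstep; case: (_ == _); last by rewrite addn0 (leq_trans (tN l')).
  by rewrite addn1 ltnS.
have Yt2 : lat_exp x k t0 +g E j +g E j = lat_exp x k (fun l => (nstep t j l).+1).
  by rewrite -Yt -Ystep.
have h1 := osc_third (osc _ t0N (inr (i, j)) (inl l)).
have h2 := osc_third (osc _ t2N (inl i) (inl l)).
have h3 := osc_third (osc _ t0N (inl j) (inl l)).
have eij : tvec L (dirw (inr (i, j))) *2^ k = E i +g E j.
  rewrite /E !tvecM -tvecD; congr tvec; apply: functional_extensionality => l'.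
  by rewrite /= mulnDl.
have := fdiff_polar (E i) (E j) (fdiff (E l) u) (lat_exp x k t0).
rewrite Yt2 -Yt; rewrite eij -/(E l) in h1; rewrite -/(E i) -/(E l) in h2.
rewrite -/(E j) -/(E l) in h3.
move: h1 h2 h3.
set a1 := fdiff (E i +g E j) _ _; set a2 := fdiff (E i) _ (lat_exp x k (fun _ => _)).
by set a3 := fdiff _ _ _; set a4 := fdiff _ _ _; split_Rabs; lra.
Qed.

(** * Contact points and the pigeonhole over scales *)

Lemma INR_le_leq a b : INR a <= INR b -> (a <= b)%N.
Proof. by move=> h; apply/leP; apply: INR_le. Qed.

Lemma INR_lt_ltn a b : INR a < INR b -> (a < b)%N.
Proof. by move=> h; apply/ltP; apply: INR_lt. Qed.

Lemma leq_INR a b : (a <= b)%N -> INR a <= INR b.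
Proof. by move=> h; apply: le_INR; apply/leP. Qed.

(* Contact points for slopes in a grid of mesh [2 del / P] lie in distinct cells of a space grid
   of mesh [h], because slopes depend on contact points in a Lipschitz way. *)
Lemma contact_cells (I : finType) (F : vec I -> R) g C del R0 kap P h sg :
  let n := INR #|I| in
  0 < g -> 0 <= C -> 0 < del -> 0 < R0 -> (0 < P)%N -> (0 < kap)%N ->
  2 * (n + 1) * del <= g * R0 -> h = 6 * R0 / INR (kap * P) -> h <= R0 / 4 ->
  3 * (4 * n * C + 3) * R0 / del < INR kap ->
  0 < sg -> sg <= h * h -> sg <= g * (R0 * R0) / 2 -> semiconvex F C ->
  (forall z, F z <= F (fun _ => 0) - g * dot z z) ->
  exists (k p : {ffun I -> 'I_P} -> vec I)
         (q : {ffun I -> 'I_P} -> torus I (kap * P).-1),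
  injective q /\
  forall j, contact F sg (k j) (p j) /\ (forall i, Rabs (p j i) <= del) /\
    forall i, 2 * R0 - h <= h * INR (tcoord (q j) i) <= 4 * R0 /\
      Rabs (tpos R0 h (q j) i - k j i) <= h.
Proof.
move=> n g0 C0 d0 R00 P0 kap0 dR hE hR kapE sg0 sgh sgR sc Fg.
have n0 : 0 <= n by exact: pos_INR.
have P0' : 0 < INR P by apply: lt_0_INR; apply/ltP.
have kap0' : 0 < INR kap by apply: lt_0_INR; apply/ltP.
have L0' : 0 < INR (kap * P) by rewrite mult_INR; nra.
have h0 : 0 < h by rewrite hE; apply: Rdiv_lt_0_compat; lra.
have hL : h * INR (kap * P) = 6 * R0 by rewrite hE; field; lra.
have L1 : ((kap * P).-1.+1 = kap * P)%N by rewrite prednK // muln_gt0 kap0.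
(* One slope per multi-index, spaced by [2 del / P] in the cube of half side [del]. *)
pose p (j : {ffun I -> 'I_P}) : vec I := fun i => del * (2 * INR (j i) / INR P - 1).
have pd j i : Rabs (p j i) <= del.
  rewrite /p Rabs_mult Rabs_pos_eq; last by lra.
  have h1 : 0 <= INR (j i) / INR P <= 1.
    have h2 := pos_INR (j i); have h3 : INR (j i) <= INR P by apply: leq_INR; exact: ltnW.
    split; first by apply: Rmult_le_pos => //; apply: Rlt_le; exact: Rinv_0_lt_compat.
    by apply: (Rmult_le_reg_r (INR P)) => //; rewrite /Rdiv Rmult_assoc Rinv_l; lra.
  have h2 : Rabs (2 * INR (j i) / INR P - 1) <= 1.
    have -> : 2 * INR (j i) / INR P = 2 * (INR (j i) / INR P) by field; lra.
    by apply: Rabs_le; lra.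
  by have := Rabs_pos (2 * INR (j i) / INR P - 1); nra.
have [k kP] : exists k : {ffun I -> 'I_P} -> vec I, forall j, contact F sg (k j) (p j).
  apply: (choice_fun (P := fun j k => contact F sg k (p j))) => j.
  by have [k [? _]] := contact_exists (p j) g0 sg0 Fg; exists k.
have kR j i : Rabs (k j i) <= R0.
  apply: Rle_trans (vnorm_coord _ i) _.
  by apply: (contact_small g0 (Rlt_le _ _ d0) R00 dR sgR Fg (kP j)).
have [qn qnP] : exists qn : {ffun I -> 'I_P} -> I -> nat, forall j i,
    INR (qn j i) <= (k j i + 3 * R0) / h < INR (qn j i) + 1.
  apply: (choice_fun (P := fun j (m : I -> nat) => forall i,
    INR (m i) <= (k j i + 3 * R0) / h < INR (m i) + 1)) => j.
  apply: (choice_fun (P := fun i m => INR m <= (k j i + 3 * R0) / h < INR m + 1)) => i.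
  apply: nat_floor.
  apply: Rmult_le_pos; first by have := kR j i; split_Rabs; lra.
  by apply: Rlt_le; exact: Rinv_0_lt_compat.
have qn1 j i : h * INR (qn j i) <= k j i + 3 * R0 < h * INR (qn j i) + h.
  have [h1 h2] := qnP j i; have e1 : h * ((k j i + 3 * R0) / h) = k j i + 3 * R0 by field; lra.
  by split; nra.
have qnL j i : (qn j i < (kap * P).-1.+1)%N.
  rewrite L1; apply: INR_lt_ltn; apply: (Rmult_lt_reg_l h) => //; rewrite hL.
  by have := qn1 j i; have := kR j i; split_Rabs; lra.
pose q j : torus I (kap * P).-1 := tvec _ (qn j).
have qv j i : tcoord (q j) i = qn j i by rewrite tcoord_tvec modn_small.
exists k, p, q; split; last first.
  move=> j; split=> //; split=> // i; rewrite /tpos qv.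
  by have := qn1 j i; have := kR j i; split_Rabs; lra.
move=> j j' jj; apply/ffunP => i; apply: val_inj.
have kk i' : Rabs (k j i' - k j' i') <= h.
  have := qn1 j i'; have := qn1 j' i'; have : qn j i' = qn j' i' by rewrite -!qv jj.
  by move=> ->; split_Rabs; lra.
have kk' i' : Rabs (k j' i' - k j i') <= h by rewrite Rabs_minus_sym.
have s1 := contact_slopes i C0 h0 sgh sc (kP j') (kP j) kk.
have s2 := contact_slopes i C0 h0 sgh sc (kP j) (kP j') kk'.
(* By the choice of [kap], slopes of contact points in one cell differ by less than the spacing of
   the slope grid, so they are equal. *)
have mesh : (4 * n * C + 3) * h < 2 * del / INR P.
  have e1 : (4 * n * C + 3) * h = (3 * (4 * n * C + 3) * R0 / del) * (2 * del / (INR kap * INR P)).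
    by rewrite hE mult_INR; field; repeat split; lra.
  have e2 : 2 * del / INR P = INR kap * (2 * del / (INR kap * INR P)) by field; lra.
  rewrite e1 e2; apply: Rmult_lt_compat_r => //; apply: Rdiv_lt_0_compat; nra.
have pp : p j i - p j' i = 2 * del / INR P * (INR (j i) - INR (j' i)).
  by rewrite /p; field; lra.
have D0 : 0 < 2 * del / INR P by apply: Rdiv_lt_0_compat; lra.
have step a b : (a < b)%N -> 2 * del / INR P * (INR a - INR b) <= - (2 * del / INR P).
  by move=> /leq_INR; rewrite S_INR => ?; nra.
case: (ltngtP (j i) (j' i)) => // /step; last by rewrite -/n in s1 s2; lra.
by rewrite -/n in s1 s2; lra.
Qed.

Lemma card_torus (I : finType) L : #|{: torus I L}| = expn L.+1 #|I|.
Proof. by have := card_ffun I 'I_L.+1; rewrite card_ord. Qed.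

(** The order of choices matters: the ratio [kap] of space cells to slope cells per axis fixes the
    fraction of cells that are hit, this fixes the number [M] of scales, and only then is the mesh
    made so fine that the coarsest scale is still below [h0]. *)
Lemma lattice_exists (I : finType) (F : vec I -> R) g C N del h0 :
  0 < g -> 0 <= C -> 0 < del -> 0 < h0 -> semiconvex F C ->
  (forall z, F z <= F (fun _ => 0) - g * dot z z) ->
  exists s sg y0 c b A, 0 < s <= h0 /\ 0 < sg <= s * s /\ msym A /\
    (forall i j, Rabs (A i j) <= sdiff_const (INR #|I|) C * (s * s)) /\
    (forall t, ncube N t ->
       Rabs (F (@lat_pt I y0 s (nvec t)) - qpoly c b A (nvec t)) <= s * s) /\
    (forall t, ncube N t -> exists k p, contact F sg k p /\
       (forall i, Rabs (p i) <= del) /\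
       forall i, Rabs (lat_pt y0 s (nvec t) i - k i) <= 5 * s).
Proof.
move=> g0 C0 d0 h00 sc Fg; pose n := INR #|I|; rewrite -/n.
have n0 : 0 <= n by exact: pos_INR.
pose R0 := 2 * (n + 1) * del / g + 1.
have R01 : 1 <= R0.
  suff: 0 <= 2 * (n + 1) * del / g by rewrite /R0; lra.
  by apply: Rmult_le_pos; [nra|apply: Rlt_le; exact: Rinv_0_lt_compat].
have dR : 2 * (n + 1) * del <= g * R0.
  have -> : g * R0 = 2 * (n + 1) * del + g by rewrite /R0; field; lra.
  by lra.
have [kap kapP] := archi (3 * (4 * n * C + 3) * R0 / del).
have nC0 : 0 <= n * C by nra.
have kap0 : (0 < kap)%N.
  apply: INR_lt_ltn; apply: Rle_lt_trans kapP; apply: Rmult_le_pos.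
    by rewrite /=; nra.
  by apply: Rlt_le; exact: Rinv_0_lt_compat.
have kap0' : 0 < INR kap by apply: lt_0_INR; apply/ltP.
pose C4 := sdiff_const n C.
have C40 : 0 < C4 by rewrite /C4 /sdiff_const; nra.
pose K := INR (#|I| * N); have K0 : 0 <= K by exact: pos_INR.
have K30 : 0 <= K ^ 3 by exact: pow_le.
(* Chosen so that the error of [near_quadratic] is at most [s^2]. *)
pose e := / (3 / 2 * K ^ 3 + 1).
have e0 : 0 < e by apply: Rinv_0_lt_compat; lra.
have Ke : K ^ 3 * (3 / 2 * e) <= 1.
  have : (3 / 2 * K ^ 3 + 1) * e = 1 by rewrite /e Rinv_r; lra.
  by lra.
(* [P^n] distinct cells are hit out of [(kap P)^n], a fraction independent of [P]. *)
pose c0 := / INR kap ^ #|I|.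
have c00 : 0 < c0 by apply: Rinv_0_lt_compat; apply: pow_lt.
have [M hM] := @good_scale (I + I * I)%type {ffun I -> 'I_(N + 2).+1} (N + 2) C4 e c0
   C40 e0 c00 (ltn_addl N (isT : (0 < 2)%N)).
pose b0 := Rmin (R0 / 2) h0.
have b00 : 0 < b0 by apply: Rmin_glb_lt; lra.
have bR : b0 <= R0 / 2 by exact: Rmin_l.
have bh : b0 <= h0 by exact: Rmin_r.
have M1 : 1 <= 2 ^ M by apply: pow_R1_Rle; lra.
pose NN := INR N + 20; have N0 : 0 <= INR N by exact: pos_INR.
have [P hP] := archi (6 * R0 * 2 ^ M * NN / (INR kap * b0)).
have kb : 0 < INR kap * b0 by nra.
have P0 : (0 < P)%N.
  apply: INR_lt_ltn; apply: Rle_lt_trans hP; apply: Rmult_le_pos.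
    by rewrite /= /NN; apply: Rmult_le_pos; nra.
  by apply: Rlt_le; exact: Rinv_0_lt_compat.
have P0' : 0 < INR P by apply: lt_0_INR; apply/ltP.
pose h := 6 * R0 / INR (kap * P).
have h0' : 0 < h by apply: Rdiv_lt_0_compat; [lra|rewrite mult_INR; nra].
have hL : h * INR (kap * P) = 6 * R0 by rewrite /h; field; rewrite mult_INR; nra.
have hM2 : h * 2 ^ M * NN <= b0.
  have e1 : h * 2 ^ M * NN = (6 * R0 * 2 ^ M * NN / (INR kap * b0)) * (b0 / INR P).
    by rewrite /h mult_INR; field; repeat split; lra.
  have e2 : b0 = INR P * (b0 / INR P) by field; lra.
  rewrite e1; apply: Rle_trans (_ : INR P * (b0 / INR P) <= _); last by lra.
  apply: Rmult_le_compat_r; last by lra.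
  by apply: Rlt_le; apply: Rdiv_lt_0_compat.
pose L := (kap * P).-1.
have L1 : (L.+1 = kap * P)%N by rewrite /L prednK // muln_gt0 kap0.
have pk k : (k <= M)%N -> 1 <= 2 ^ k <= 2 ^ M.
  move=> kM; split; first by apply: pow_R1_Rle; lra.
  by apply: Rle_pow; [lra|apply/leP].
have small k a : (k <= M)%N -> 0 <= a -> a <= NN -> h * (2 ^ k * a) <= b0.
  move=> kM a0 aN; have [p1 p2] := pk k kM.
  have : 2 ^ k * a <= 2 ^ M * NN by apply: Rmult_le_compat; lra.
  by nra.
have hb20 : h * 20 <= b0.
  have := small 0%N 20 isT; rewrite /NN /=; lra.
pose sg := Rmin (h * h) (g / 2).
have sg0 : 0 < sg by apply: Rmin_glb_lt; nra.
have sgh : sg <= h * h by exact: Rmin_l.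
have sgg : sg <= g / 2 by exact: Rmin_r.
have [kk [pp [q [qi qP]]]] : exists (k p : {ffun I -> 'I_P} -> vec I)
         (q : {ffun I -> 'I_P} -> torus I L),
  injective q /\
  forall j, contact F sg (k j) (p j) /\ (forall i, Rabs (p j i) <= del) /\
    forall i, 2 * R0 - h <= h * INR (tcoord (q j) i) <= 4 * R0 /\
      Rabs (tpos R0 h (q j) i - k j i) <= h.
  apply: (@contact_cells I F g C del R0 kap P h sg) => //; first by lra.
    by lra.
  by apply: Rle_trans sgg _; have : 1 <= R0 * R0 by [nra]; nra.
have nat_small k a : (k <= M)%N -> (a <= N + 10)%N -> h * INR (a * expn 2 k) <= b0.
  move=> kM aN; rewrite mult_INR INR_expn2 (Rmult_comm (INR a)); apply: small => //.
    exact: pos_INR.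
  by have := leq_INR aN; rewrite plus_INR /NN /=; lra.
have qrange k : (k <= M)%N -> forall j i, (4 * expn 2 k <= tcoord (q j) i)%N /\
    (tcoord (q j) i + 4 * expn 2 k <= L)%N.
  move=> kM j i; have [_ [_ /(_ i) [[q1 q2] _]]] := qP j.
  have h4 : h * INR (4 * expn 2 k) <= b0 by apply: nat_small => //; exact: leq_trans (leq_addl N 10).
  split; last rewrite -ltnS L1; [apply: INR_le_leq|apply: INR_lt_ltn].
    by apply: (Rmult_le_reg_l h) => //; lra.
  by rewrite plus_INR; apply: (Rmult_lt_reg_l h) => //; lra.
(* A point of [S k] is within [5 h 2^k] of a contact point in each coordinate, so second differences
   at scale [k] are bounded there. *)
pose S := nearset q.
have near k v : (k <= M)%N -> v \in S k -> exists j,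
   (forall i, h * INR (tcoord v i) <= 5 * R0) /\
   (forall i, Rabs (tpos R0 h v i - kk j i) <= 5 * (h * 2 ^ k)).
  move=> kM vS; have [j hj] := nearset_val (qrange k kM) vS; exists j.
  have main i : h * INR (tcoord v i) <= 5 * R0 /\ Rabs (tpos R0 h v i - kk j i) <= 5 * (h * 2 ^ k).
    have [_ [_ /(_ i) [[q1 q2] q3]]] := qP j.
    have [/leq_INR a1 /leq_INR a2] := hj i.
    have h4 : h * INR (4 * expn 2 k) <= b0 by apply: nat_small => //; exact: leq_trans (leq_addl N 10).
    rewrite plus_INR in a1; rewrite plus_INR in a2; rewrite mult_INR INR_expn2 in a1 a2 h4.
    have e4 : INR 4 = 4 by rewrite /=; ring.
    rewrite e4 in a1 a2 h4; have [p1 p2] := pk k kM.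
    have b1 := Rmult_le_compat_l _ _ _ (Rlt_le _ _ h0') a1.
    have b2 := Rmult_le_compat_l _ _ _ (Rlt_le _ _ h0') a2.
    have b3 : h <= h * 2 ^ k by nra.
    move: q3; rewrite /tpos => q3; split; [lra|split_Rabs; lra].
  by split=> i; case: (main i).
have shift k v w : (k <= M)%N -> v \in S k -> (forall i, (w i <= (N + 10) * expn 2 k)%N) ->
   tpos R0 h (v +g tvec L w) = vadd (tpos R0 h v) (vscale h (nvec w)).
  move=> kM vS wk; apply: tpos_shift => i.
  have [j [/(_ i) v5 _]] := near k v kM vS.
  rewrite -ltnS L1; apply: INR_lt_ltn; apply: (Rmult_lt_reg_l h) => //; rewrite hL plus_INR.
  have /(Rmult_le_compat_l _ _ _ (Rlt_le _ _ h0')) := leq_INR (wk i).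
  by have := nat_small k _ kM (leqnn (N + 10)); lra.
(* With this normalisation [sdiff u] is a difference quotient of [F] at step [h 2^k]. *)
pose u (v : torus I L) := F (tpos R0 h v) / (h * h).
pose dir (a : I + I * I) := tvec L (dirw a).
have dirM a k : dir a *2^ k = tvec L (fun i => (dirw a i * expn 2 k)%N) by rewrite /dir tvecM.
pose s k := h * 2 ^ k.
have s0 k : 0 < s k by apply: Rmult_lt_0_compat => //; apply: pow_lt; lra.
have ss k : s k * s k = h * h * 4 ^ k by rewrite /s pow4; ring.
have sgs k : sg <= s k * s k.
  rewrite ss; have : 1 <= 4 ^ k by apply: pow_R1_Rle; lra.
  by have : 0 < h * h by [nra]; nra.
have dw4 (a b : I + I * I) k i : (dirw a i * expn 2 k + dirw b i * expn 2 k <= 4 * expn 2 k)%N.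
  by rewrite -mulnDl leq_mul2r (leq_add (dirw_le2 a i) (dirw_le2 b i)) orbT.
have dw2 (a : I + I * I) k i : (dirw a i * expn 2 k <= 4 * expn 2 k)%N.
  by rewrite leq_mul2r (leq_trans (dirw_le2 a i)) ?orbT.
have leN10 k a : (a <= 4 * expn 2 k)%N -> (a <= (N + 10) * expn 2 k)%N.
  by move=> ha; apply: leq_trans ha _; rewrite leq_mul2r (@leq_trans 10) ?orbT // leq_addl.
have sdb k v a b : (k <= M)%N -> v \in S k ->
    Rabs (F (tpos R0 h (v +g dir a *2^ k +g dir b *2^ k))
      - F (tpos R0 h (v +g dir a *2^ k))
      - (F (tpos R0 h (v +g dir b *2^ k)) - F (tpos R0 h v))) <= C4 * (s k * s k).
  move=> kM vS; have [j [_ hj]] := near k v kM vS; have [ct _] := qP j.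
  rewrite !dirM -GRing.addrA -tvecD !(shift k v) //; try by move=> i; apply: leN10.
  set al := vscale h (nvec (fun i => (dirw a i * expn 2 k)%N)).
  set be := vscale h (nvec (fun i => (dirw b i * expn 2 k)%N)).
  have -> : vadd (tpos R0 h v) (vscale h (nvec (fun i => (dirw a i * expn 2 k + dirw b i * expn 2 k)%N)))
     = vadd (vadd (tpos R0 h v) al) be.
    by apply: vec_ext => i; rewrite /vadd /al /be /vscale /nvec plus_INR; ring.
  have dd (a' : I + I * I) i : 0 <= h * INR (dirw a' i * expn 2 k) <= 2 * s k.
    have h2 := leq_INR (dirw_le2 a' i); have h1 := pos_INR (dirw a' i).
    have e2 : INR 2 = 2 by []. rewrite e2 in h2.
    rewrite mult_INR INR_expn2; have := s0 k; rewrite /s => ?.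
    have -> : h * (INR (dirw a' i) * 2 ^ k) = INR (dirw a' i) * (h * 2 ^ k) by ring.
    by split; nra.
  have bnd := @second_diff_bound I F C sg (kk j) (pp j) (9 * s k) (tpos R0 h v) al be C0 sc ct.
  apply: Rle_trans (bnd _ _ _ _) _ => [i|i|i|i|]; last first.
  - rewrite /C4 /sdiff_const -/n; have := sgs k; nra.
  - by have := hj i; have := dd a i; have := dd b i; rewrite /al /be /vscale /nvec -/(s k);
       split_Rabs; lra.
  - by have := hj i; have := dd b i; rewrite /be /vscale /nvec -/(s k); split_Rabs; lra.
  - by have := hj i; have := dd a i; rewrite /al /vscale /nvec -/(s k); split_Rabs; lra.
  - by have := hj i; rewrite -/(s k); have := s0 k; split_Rabs; lra.
have H1 k v a b : (k <= M)%N -> v \in S k -> Rabs (sdiff u (dir a) (dir b) k v) <= C4.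
  move=> kM vS; have hb := sdb k v a b kM vS.
  rewrite /sdiff /fdiff /u.
  set x1 := F _ in hb *; set x2 := F _ in hb *; set x3 := F _ in hb *; set x4 := F _ in hb *.
  have -> : (x1 / (h * h) - x2 / (h * h) - (x3 / (h * h) - x4 / (h * h))) / 4 ^ k
     = (x1 - x2 - (x3 - x4)) * / (s k * s k).
    by rewrite ss; field; split; [apply: pow_nonzero|]; lra.
  have sk : 0 < s k * s k by have := s0 k; nra.
  rewrite Rabs_mult (Rabs_pos_eq (/ _)); last by apply: Rlt_le; exact: Rinv_0_lt_compat.
  apply: (Rmult_le_reg_r (s k * s k)) => //; rewrite Rmult_assoc Rinv_l; lra.
have zero_vec (v : torus I L) : v = v +g tvec L (fun _ => 0%N).
  apply: tcoord_inj => i; rewrite tcoord_shift ?addn0 //.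
  by rewrite -ltnS; exact: tcoord_lt.
have mono k v : v \in S k -> v \in S k.+1.
  by rewrite {1}(zero_vec v); apply: nearset_back.
have H2 k x a b : [|| x \in S k, x +g dir a *2^ k \in S k, x +g dir b *2^ k \in S k
     | x +g dir a *2^ k +g dir b *2^ k \in S k] -> x \in S k.+1.
  case/or4P => [| | |]; first exact: mono.
  - by rewrite dirM; apply: nearset_back => i.
  - by rewrite dirM; apply: nearset_back => i.
  - by rewrite !dirM -GRing.addrA -tvecD; apply: nearset_back => i.
(* The translations that fill a lattice cube. Since [N + 2 < 2^(N+2)], the boxes of [N + 2] scales
   later contain them. *)
pose tr (w : {ffun I -> 'I_(N + 2).+1}) := tvec L (fun i => (w i : nat)).
have H3 k x w : x \in S k -> x +g tr w *2^ k \in S (k + (N + 2))%N.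
  rewrite /tr tvecM; apply: nearset_fwd => i; rewrite -mulnDl expnD (mulnC (expn 2 k)) mulnA.
  rewrite leq_mul2r; apply/orP; right.
  have : (w i <= N + 2)%N by rewrite -ltnS; exact: ltn_ord.
  move=> wi; apply: leq_trans (_ : 4 * (N + 2).+1 <= _)%N; last first.
    by rewrite leq_mul2l ltn_expl.
  by rewrite mulnS leq_add2l (leq_trans wi) // leq_pmull.
have [k [x [kM [xS good]]]] : exists (k : nat) (x : torus I L), (k + (N + 2) <= M)%N /\ x \in S k /\
    forall w, x +g tr w *2^ k \in S k /\
    forall a b, osc_small u (dir a) (dir b) e S k (x +g tr w *2^ k).
  apply: (hM _ dir tr u S H1 (fun k x a b _ => @H2 k x a b) (fun k x _ => @mono k x)
    (fun k x w _ => @H3 k x w)).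
  have cS : (expn P #|I| <= #|S 0%N|)%N.
    by have := card_nearset qi; rewrite card_ffun card_ord.
  apply: Rle_trans (leq_INR cS); rewrite card_torus L1 expnMn mult_INR.
  have pE a b : INR (expn a b) = INR a ^ b.
    by elim: b => [|b IH] //; rewrite expnS mult_INR IH.
  rewrite !pE /c0 -Rmult_assoc Rinv_l; last by apply: pow_nonzero; lra.
  by lra.
have kM' : (k <= M)%N by apply: leq_trans kM; exact: leq_addr.
have good' t : ncube (N + 2) t -> lat_exp x k t \in S k /\
   forall a b, osc_small u (dir a) (dir b) e S k (lat_exp x k t).
  move=> tN; pose w : {ffun I -> 'I_(N + 2).+1} := [ffun i => inord (t i)].
  have -> : lat_exp x k t = x +g tr w *2^ k; last exact: good.
  rewrite /lat_exp /tr tvecM; congr (_ +g tvec _ _); apply: functional_extensionality => i.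
  by rewrite ffunE inordK // ltnS; exact: tN.
pose Y (t : I -> nat) := lat_exp x k (fun i => (t i).+1).
have YN (t : I -> nat) : ncube N t -> ncube (N + 2) (fun i => (t i).+1).
  by move=> tN i; rewrite addn2 ltnS (leq_trans (tN i)).
pose U t := u (Y t).
have third i j l t : ncube N t -> Rabs (ndiff i (ndiff j (ndiff l U)) t) <= 3 / 2 * (e * 4 ^ k).
  by apply: (lattice_third (N := N) (e := e) (S := S)) => t' /good' [_].
have e4 : 0 < 4 ^ k by apply: pow_lt; lra.
have nq := near_quadratic (eta := 3 / 2 * (e * 4 ^ k)) (N := N) (U := U).
have hh0 : 0 < h * h by nra.
(* The origin of the shifted lattice [Y], one step from [x] in every coordinate. *)
pose y0 := vadd (tpos R0 h x) (vscale (s k) (fun _ => 1)).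
have posY t : ncube N t -> tpos R0 h (Y t) = lat_pt y0 (s k) (nvec t).
  move=> tN; rewrite /Y /lat_exp (shift k x) //; last first.
    move=> i; rewrite leq_mul2r; apply/orP; right.
    by apply: leq_trans (YN _ tN i) _; rewrite leq_add2l.
  apply: vec_ext => i; rewrite /y0 /lat_pt /vadd /vscale /nvec mult_INR INR_expn2 S_INR /s; ring.
have zN : ncube N (@nzero I) by [].
pose sc2 (v : R) := h * h * v.
exists (s k), sg, y0, (h * h * U (@nzero I)), (vscale (h * h) (lat_lin U)), (mscale (h * h) (lat_hess U)).
split.
  split=> //; have := small k 1 kM' Rle_0_1; rewrite Rmult_1_r -/(s k) /NN; lra.
split; first by split.
split; first by move=> i j; rewrite /mscale lat_hess_sym.
split.
  move=> i j; have [yS _] := good' _ (YN _ zN); rewrite -/(Y _) in yS.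
  have := sdb k (Y (@nzero I)) (inl i) (inl j) kM' yS.
  have Ystep t i' : Y t +g dir (inl i') *2^ k = Y (nstep t i').
    by rewrite /Y -lat_exp_step; congr lat_exp.
  rewrite !Ystep /mscale /lat_hess /ndiff /U /u -/C4.
  set x1 := F _; set x2 := F _; set x3 := F _; set x4 := F _.
  have -> : h * h * (x1 / (h * h) - x2 / (h * h) - (x3 / (h * h) - x4 / (h * h)))
    = x1 - x2 - (x3 - x4) by field; lra.
  by [].
split=> t tN; last first.
  have [yS _] := good' _ (YN _ tN); rewrite -/(Y _) in yS.
  have [j [_ hj]] := near k _ kM' yS; have [ct [pd _]] := qP j.
  by exists (kk j), (pp j); split=> //; split=> // i; rewrite -posY //; exact: hj.
have := nq _ third t tN; rewrite -/K => /(_ _) hq.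
have -> : F (lat_pt y0 (s k) (nvec t)) = h * h * U t.
  by rewrite -posY // /U /u; field; lra.
have -> : qpoly (h * h * U (@nzero I)) (vscale (h * h) (lat_lin U)) (mscale (h * h) (lat_hess U)) (nvec t)
   = h * h * qpoly (U (@nzero I)) (lat_lin U) (lat_hess U) (nvec t).
  by rewrite /qpoly dotZl quad_mscale; field.
rewrite -Rmult_minus_distr_l Rabs_mult Rabs_pos_eq; last by lra.
rewrite ss; apply: Rmult_le_compat_l; first by lra.
apply: Rle_trans (hq _) _; first by nra.
have -> : K ^ 3 * (3 / 2 * (e * 4 ^ k)) = K ^ 3 * (3 / 2 * e) * 4 ^ k by ring.
by nra.
Qed.

(** The bound on [Z] does not depend on [eps]. This lets later constants be fixed before the
    precision is chosen. *)
Lemma approx_second_order (I : finType) (F : vec I -> R) g C eps :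
  0 < g -> 0 <= C -> 0 < eps <= 1 -> semiconvex F C ->
  (forall z, F z <= F (fun _ => 0) - g * dot z z) ->
  exists k b Z r, msym Z /\ (forall i j, Rabs (Z i j) <= sdiff_const (INR #|I|) C) /\
    vnorm k < eps /\ vnorm b < eps /\ 0 < r < eps /\
    F (fun _ => 0) - eps <= F k /\ (forall xi, quad Z xi <= eps * dot xi xi) /\
    forall e, vnorm e <= r ->
      Rabs (F (vadd k e) - F k - dot b e - quad Z e / 2) <= eps * (r * r).
Proof.
move=> g0 C0 [e0 e1] sc Fg; pose n := INR #|I|.
have n0 : 0 <= n by exact: pos_INR.
pose R0 := eps / 2.
have R00 : 0 < R0 by rewrite /R0; lra.
pose del := Rmin (eps / (2 * (n + 1))) (g * R0 / (2 * (n + 1))).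
have gR : 0 < g * R0 by nra.
have d0 : 0 < del by apply: Rmin_glb_lt; apply: Rdiv_lt_0_compat; lra.
have dE : (n + 1) * del <= eps / 2.
  have -> : eps / 2 = (n + 1) * (eps / (2 * (n + 1))) by field; lra.
  by apply: Rmult_le_compat_l; [lra|exact: Rmin_l].
have dR : 2 * (n + 1) * del <= g * R0.
  have -> : g * R0 = 2 * (n + 1) * (g * R0 / (2 * (n + 1))) by field; lra.
  by apply: Rmult_le_compat_l; [lra|exact: Rmin_r].
pose C4 := sdiff_const n C.
have nC : 0 <= n * C by nra.
have C40 : 0 <= C4 by rewrite /C4 /sdiff_const; nra.
pose cc := cell_const n C C4.
have cc1 : 4 <= cc.
  have : 0 <= C4 * (n + 1) * (n + 1) by apply: Rmult_le_pos; [nra|lra].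
  by rewrite /cc /cell_const; nra.
(* The lattice error is of order [cc s^2] and the ball has radius [a s]; this [m] makes [2 cc] at
   most [eps a^2 / 4]. *)
have [m hm] := archi (7 + 8 * cc / eps).
have q0 : 0 < 8 * cc / eps by apply: Rdiv_lt_0_compat; lra.
pose a := INR m - 6; have a1 : 1 < a by rewrite /a; lra.
have ma : 2 * cc <= eps / 4 * (a * a).
  have h1 : 8 * cc = eps * (8 * cc / eps) by field; lra.
  have h2 : 8 * cc / eps <= a * a by have : a <= a * a by [nra]; rewrite /a; lra.
  have : eps * (8 * cc / eps) <= eps * (a * a) by apply: Rmult_le_compat_l; lra.
  by lra.
pose D := 1 + (n + 1) * (C + C4 + 1).
have D1 : 1 <= D by rewrite /D; nra.
(* The second entry keeps the contact points in the ball of radius [R0]; the third makes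
   [r D <= eps / 4], which controls both [r] and the distance from [b'] to the slope [p]. *)
pose h0 := Rmin 1 (Rmin (g * (R0 * R0) / 2) (eps / (4 * a * D))).
have gRR : 0 < g * (R0 * R0) / 2 by nra.
have aD : 0 < 4 * a * D by nra.
have h00 : 0 < h0.
  by apply: Rmin_glb_lt; [lra|apply: Rmin_glb_lt => //; apply: Rdiv_lt_0_compat].
have hh1 : h0 <= 1 by exact: Rmin_l.
have hh2 : h0 <= g * (R0 * R0) / 2 by apply: Rle_trans (Rmin_r _ _) _; exact: Rmin_l.
have hh3 : h0 * (a * D) <= eps / 4.
  have -> : eps / 4 = eps / (4 * a * D) * (a * D) by field; lra.
  apply: Rmult_le_compat_r; first by nra.
  by apply: Rle_trans (Rmin_r _ _) _; exact: Rmin_r.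
have [s [sg [y0 [c [b [A [[s0 sh] [[sg0 sgs] [As [Ab [LQ CT]]]]]]]]]]] :=
  lattice_exists (2 * m) g0 C0 d0 h00 sc Fg.
have [k [b' [Z [Zs [Zb [[p [ct pd]] ex]]]]]] := lattice_to_ball
   C0 C40 s0 sgs sc (ltac:(rewrite /a in a1; lra) : 6 < INR m) ma As Ab LQ CT.
pose r := s * a; rewrite -/a -/r in ex.
have r0 : 0 < r by rewrite /r; nra.
have rD : r * D <= eps / 4.
  by apply: Rle_trans hh3; rewrite /r Rmult_assoc; apply: Rmult_le_compat_r => //; nra.
have re : r <= eps / 4 by nra.
have ss1 : s * s <= s by nra.
have sgr : sg <= eps / 8 * (r * r).
  have -> : eps / 8 * (r * r) = eps / 8 * (a * a) * (s * s) by rewrite /r; ring.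
  by have ss0 : 0 < s * s by [nra]; nra.
have [Zle bp] := contact_hessian C0 C40 r0 (conj e0 e1) sgr sc ct Zb ex.
have sgR : sg <= g * (R0 * R0) / 2 by lra.
have kR := contact_small g0 (Rlt_le _ _ d0) R00 dR sgR Fg ct pd.
have pn := vnorm_coord_le (Rlt_le _ _ d0) pd; rewrite -/n in pn.
have k0 := vnorm_ge0 k; have p0 := vnorm_ge0 p.
have bpn : vnorm (vsub b' p) <= (n + 1) * ((C + C4 + 1) * r).
  by apply: vnorm_coord_le => //; nra.
exists k, b', Z, r; split=> //; split=> //; split; first by rewrite /R0 in kR; lra.
split.
  have -> : b' = vadd (vsub b' p) p by vec_ring.
  have := vnormD (vsub b' p) p; rewrite /D in rD; nra.
split; first by lra.
split.
  have h1 := ct (fun _ => 0); rewrite dotBr in h1.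
  have e00 : dot p (fun _ => 0) = 0 by apply: rsum0 => i; ring.
  have h2 := cauchy_schwarz p k.
  have h3 : vnorm p * vnorm k <= eps / 2 * (eps / 2).
    by apply: Rmult_le_compat => //; lra.
  have : sg <= eps / 4.
    have : sg <= s * a by nra.
    by rewrite -/r; lra.
  by split_Rabs; nra.
split=> // e er; apply: Rle_trans (ex _ er) _.
by have : 0 < r * r by [nra]; nra.
Qed.

(** * Compactness and upper semicontinuity *)

Lemma inv_small e : 0 < e -> exists N : nat, forall n : nat, (N <= n)%N -> / INR n.+1 < e.
Proof.
move=> e0; have [N hN] := archi (/ e); exists N => n Nn.
have i0 := Rinv_0_lt_compat _ e0.
rewrite -(Rinv_inv e); apply: Rinv_lt_contravar.
  by apply: Rmult_lt_0_compat => //; apply: lt_0_INR; lia.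
have : INR N <= INR n by apply: le_INR; apply/leP.
by rewrite S_INR; lra.
Qed.

(** [psi] need not be increasing; [n <= psi n] suffices for limits. *)
Lemma real_subseq (u : nat -> R) B : (forall n, Rabs (u n) <= B) ->
  exists (psi : nat -> nat) l, (forall n, (n <= psi n)%N) /\
    forall e, 0 < e -> exists N : nat, forall n, (N <= n)%N -> Rabs (u (psi n) - l) < e.
Proof.
move=> uB; have [l lP] : exists l, ValAdh u l.
  apply: (Bolzano_Weierstrass u (fun x => - B <= x <= B)); first exact: compact_P3.
  by move=> n; have := uB n; split_Rabs; lra.
have /choice_fun [psi psiP] : forall n : nat, exists p : nat, (n <= p)%N /\ Rabs (u p - l) < / INR n.+1.
  move=> n; have i0 : 0 < / INR n.+1 by apply: Rinv_0_lt_compat; apply: lt_0_INR; lia.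
  have [|p [/leP np hp]] := lP (disc l (mkposreal _ i0)) n; last by exists p.
  by exists (mkposreal _ i0) => x.
exists psi, l; split=> [n|e e0]; first by case: (psiP n).
have [N hN] := inv_small e0; exists N => n Nn.
by apply: Rlt_trans (hN n Nn); case: (psiP n).
Qed.

Lemma bounded_subseq (I : finType) (x : nat -> vec I) B : (forall n, vnorm (x n) <= B) ->
  exists (phi : nat -> nat) (c : vec I), (forall n, (n <= phi n)%N) /\
    forall e, 0 < e -> exists N : nat, forall n, (N <= n)%N -> vnorm (vsub (x (phi n)) c) < e.
Proof.
move=> xB.
(* The extraction is refined one coordinate at a time along a list of indices. *)
have H (s : seq I) : exists (phi : nat -> nat) (c : vec I), (forall n, (n <= phi n)%N) /\
    forall e, 0 < e -> exists N : nat, forall n, (N <= n)%N -> forall i, i \in s ->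
      Rabs (x (phi n) i - c i) < e.
  elim: s => [|i s [phi [c [ph pc]]]].
    by exists id, (fun _ => 0); split=> // e _; exists 0%N.
  have uB n : Rabs (x (phi n) i) <= B by apply: Rle_trans (xB (phi n)); exact: vnorm_coord.
  have [psi [l [ps pl]]] := real_subseq uB.
  exists (phi \o psi), (fun j => if j == i then l else c j); split=> [n|e e0].
    exact: leq_trans (ps n) (ph _).
  have [N1 h1] := pc e e0; have [N2 h2] := pl e e0.
  exists (maxn N1 N2) => n; rewrite geq_max => /andP [n1 n2] j.
  rewrite inE; case: (eqVneq j i) => [-> _|_ /= js]; first exact: h2.
  by apply: h1 => //; exact: leq_trans n1 (ps n).
have [phi [c [ph pc]]] := H (enum I); exists phi, c; split=> // e e0.
have n0 := pos_INR #|I|; have e1 : 0 < e / (INR #|I| + 2) by apply: Rdiv_lt_0_compat; lra.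
have [N hN] := pc _ e1; exists N => n Nn.
apply: Rle_lt_trans (_ : (INR #|I| + 1) * (e / (INR #|I| + 2)) < _).
  apply: vnorm_coord_le => [|i]; first by lra.
  by apply: Rlt_le; apply: hN => //; rewrite mem_enum.
apply: (Rmult_lt_reg_r (INR #|I| + 2)); first by lra.
have -> : (INR #|I| + 1) * (e / (INR #|I| + 2)) * (INR #|I| + 2) = (INR #|I| + 1) * e.
  by field; lra.
by nra.
Qed.

Definition vclosed (I : finType) (K : vec I -> Prop) : Prop :=
  forall x, (forall r, 0 < r -> exists y, K y /\ vnorm (vsub y x) < r) -> K x.

Definition vusc (I : finType) (K : vec I -> Prop) (f : vec I -> R) : Prop :=
  forall x, K x -> forall e, 0 < e -> exists delta, 0 < delta /\
    forall y, K y -> vnorm (vsub y x) < delta -> f y < f x + e.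

Lemma usc_attain (I : finType) (K : vec I -> Prop) (f : vec I -> R) B x0 :
  K x0 -> (forall x, K x -> vnorm x <= B) -> vclosed K -> vusc K f ->
  exists x, K x /\ forall y, K y -> f y <= f x.
Proof.
move=> Kx0 KB Kc fu.
pose T := {x | K x}.
(* [f] is not known to be bounded above on [K], so near-maximisers are taken for [f] truncated at
   [n]; the truncation disappears once [n] exceeds the value under comparison. *)
have H (n : nat) : exists x : vec I, K x /\ forall y, K y -> Rmin (f y) (INR n) <= f x + / INR n.+1.
  have i0 : 0 < / INR n.+1 by apply: Rinv_0_lt_compat; apply: lt_0_INR; lia.
  have [[x Kx] hx] := @near_sup T (fun x => Rmin (f (sval x)) (INR n)) (exist _ x0 Kx0) (INR n) _
     (fun x => Rmin_r _ _) i0.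
  exists x; split=> // y Ky; apply: Rle_trans (hx (exist _ y Ky)) _ => /=.
  by apply: Rplus_le_compat_r; exact: Rmin_l.
have [x xP] := choice_fun H.
have xB n : vnorm (x n) <= B by apply: KB; case: (xP n).
have [phi [c [ph pc]]] := bounded_subseq xB.
have Kc' : K c.
  apply: Kc => r r0; have [N hN] := pc r r0.
  by exists (x (phi N)); split; [case: (xP (phi N))|exact: hN].
exists c; split=> // y Ky; apply: Rnot_lt_le => hy.
pose e := (f y - f c) / 2; have e0 : 0 < e by rewrite /e; lra.
have [delta [d0 hd]] := fu c Kc' e e0.
have [N1 h1] := pc _ d0; have [N2 h2] := inv_small e0; have [N3 h3] := archi (f y).
pose n := maxn N1 (maxn N2 N3).
have [n1 [n2 n3]] : (N1 <= n)%N /\ (N2 <= n)%N /\ (N3 <= n)%N.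
  by rewrite /n !leq_max !leqnn !orbT.
have [Kx /(_ y Ky)] := xP (phi n).
have -> : Rmin (f y) (INR (phi n)) = f y.
  apply: Rmin_left; apply: Rle_trans (Rlt_le _ _ h3) _; apply: le_INR; apply/leP.
  exact: leq_trans n3 (ph n).
have := h2 _ (leq_trans n2 (ph n)); have := hd _ Kx (h1 _ n1).
by rewrite /e; lra.
Qed.

(** * The theorem on sums *)

Lemma sup_convolution (I : finType) (S : vec I -> Prop) (f : vec I -> R) L x0 :
  S x0 -> (forall x, exists B, forall y, S y -> f y - L / 2 * sqn (vsub x y) <= B) ->
  exists fh : vec I -> R,
    (forall x y, S y -> f y - L / 2 * sqn (vsub x y) <= fh x) /\
    (forall x d, 0 < d -> exists y, S y /\ fh x <= f y - L / 2 * sqn (vsub x y) + d).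
Proof.
move=> Sx0 bd.
have H x : exists l, (forall y, S y -> f y - L / 2 * sqn (vsub x y) <= l) /\
   (forall d, 0 < d -> exists y, S y /\ l <= f y - L / 2 * sqn (vsub x y) + d).
  pose E r := exists y, S y /\ r = f y - L / 2 * sqn (vsub x y).
  have [B hB] := bd x.
  have [l [ub lub]] : {l | is_lub E l}.
    apply: completeness; first by exists B => r [y [Sy ->]]; exact: hB.
    by eexists; exists x0.
  exists l; split=> [y Sy|d d0]; first by apply: ub; exists y.
  apply: NNPP => hn; suff: l <= l - d by lra.
  apply: lub => r [y [Sy ->]]; apply: Rnot_lt_le => h; apply: hn; exists y; split=> //.
  by lra.
have [fh hf] := choice_fun H.
by exists fh; split=> [x y|x]; case: (hf x) => h1 h2; [exact: h1|exact: h2].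
Qed.

(** A near-optimal point for [z] is also admissible for [z + e] and [z - e], and the second
    difference of the quadratic kernel is exactly [- L |e|^2]. *)
Lemma sup_convolution_semiconvex (I : finType) (S : vec I -> Prop) (f fh : vec I -> R) L :
  (forall x y, S y -> f y - L / 2 * sqn (vsub x y) <= fh x) ->
  (forall x d, 0 < d -> exists y, S y /\ fh x <= f y - L / 2 * sqn (vsub x y) + d) ->
  semiconvex fh L.
Proof.
move=> h1 h2 z e; apply: Rnot_lt_le => hlt.
pose d := (- (L * dot e e) - (fh (vadd z e) + fh (vsub z e) - 2 * fh z)) / 4.
have d0 : 0 < d by rewrite /d; lra.
have [y [Sy hy]] := h2 z d d0.
have := h1 (vadd z e) y Sy; have := h1 (vsub z e) y Sy.
have -> : vsub (vadd z e) y = vadd (vsub z y) e.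
  by vec_ring.
have -> : vsub (vsub z e) y = vsub (vsub z y) e.
  by vec_ring.
move: hy; move: (vsub z y) => w.
have -> : sqn (vadd w e) = dot w w + 2 * dot w e + dot e e.
  by rewrite dotDr !dotDl (dotC e w); ring.
have -> : sqn (vsub w e) = dot w w - 2 * dot w e + dot e e.
  by rewrite dotBr !dotBl (dotC e w); ring.
by rewrite /d; lra.
Qed.

Definition mvec (I : finType) (A : mx I) (u : vec I) : vec I := fun i => rsum (fun j => A i j * u j).

Lemma mvec_bound (I : finType) (A : mx I) a u : 0 <= a -> (forall i j, Rabs (A i j) <= a) ->
  vnorm (mvec A u) <= (INR #|I| + 1) * (a * INR #|I| * vnorm u).
Proof.
move=> a0 Aa; have n0 := pos_INR #|I|; have u0 := vnorm_ge0 u.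
apply: vnorm_coord_le => [|i]; first by apply: Rmult_le_pos => //; nra.
apply: Rle_trans (Rabs_rsum _) _.
apply: Rle_trans (_ : rsum (fun j => a * Rabs (u j)) <= _).
  apply: rsum_le => j; rewrite Rabs_mult; have := Aa i j; have := Rabs_pos (u j).
  by have := Rabs_pos (A i j); nra.
by rewrite rsumZ Rmult_assoc; apply: Rmult_le_compat_l => //; exact: rsum_abs_le.
Qed.

Lemma bil_mvec (I : finType) (A : mx I) u v : msym A -> bil A u v = dot (mvec A u) v.
Proof.
move=> As; rewrite /bil rsum_exch /dot /mvec; apply: rsum_ext => i.
rewrite [RHS]Rmult_comm -rsumZ; apply: rsum_ext => j; rewrite As; ring.
Qed.

Lemma vusc_sub_cont (I : finType) (S K : vec I -> Prop) (f P : vec I -> R) :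
  (forall x, K x -> S x) -> vusc S f ->
  (forall x e, 0 < e -> exists d, 0 < d /\ forall y, vnorm (vsub y x) < d -> Rabs (P y - P x) < e) ->
  vusc K (fun x => f x - P x).
Proof.
move=> KS fu Pc x Kx e e0; have e2 : 0 < e / 2 by lra.
have [d1 [d10 h1]] := fu x (KS x Kx) _ e2; have [d2 [d20 h2]] := Pc x _ e2.
exists (Rmin d1 d2); split; first exact: Rmin_glb_lt.
move=> y Ky hy.
have := h1 y (KS y Ky) (Rlt_le_trans _ _ _ hy (Rmin_l _ _)).
have := h2 y (Rlt_le_trans _ _ _ hy (Rmin_r _ _)).
by split_Rabs; lra.
Qed.

Lemma quad_poly_cont (I : finType) (b : vec I) (A : mx I) (x0 : vec I) x e : msym A -> 0 < e ->
  exists d, 0 < d /\ forall y, vnorm (vsub y x) < d ->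
    Rabs (dot b (vsub y x0) + quad A (vsub y x0) / 2 - (dot b (vsub x x0) + quad A (vsub x x0) / 2)) < e.
Proof.
move=> As e0; pose n := INR #|I|; have n0 : 0 <= n by exact: pos_INR.
have [a [a0 Aa]] : exists a, 0 <= a /\ forall i j, Rabs (A i j) <= a.
  exists (rsum (fun p : I * I => Rabs (A p.1 p.2))); split.
    by apply: rsum_ge0 => p; exact: Rabs_pos.
  move=> i j; apply: (@rsum_term _ (fun p : I * I => Rabs (A p.1 p.2)) (i, j)) => p.
  exact: Rabs_pos.
pose w := vsub x x0.
pose B := vnorm b + vnorm (mvec A w) + a * n * n + 1.
have b0 := vnorm_ge0 b; have m0 := vnorm_ge0 (mvec A w).
have an : 0 <= a * n * n by apply: Rmult_le_pos => //; nra.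
have B1 : 1 <= B by rewrite /B; lra.
exists (Rmin 1 (e / B)); split.
  by apply: Rmin_glb_lt; [lra|apply: Rdiv_lt_0_compat; lra].
move=> y; set h := vsub y x => hy.
have h1 : vnorm h < 1 by apply: Rlt_le_trans hy _; exact: Rmin_l.
have h2 : vnorm h < e / B by apply: Rlt_le_trans hy _; exact: Rmin_r.
have -> : vsub y x0 = vadd w h by apply: vec_ext => i; rewrite /w /h /vadd /vsub; ring.
rewrite -/w dotDr quadD // bil_mvec //.
have -> : dot b w + dot b h + (quad A w + 2 * dot (mvec A w) h + quad A h) / 2
    - (dot b w + quad A w / 2) = dot b h + dot (mvec A w) h + quad A h / 2 by field.
have q1 := cauchy_schwarz b h; have q2 := cauchy_schwarz (mvec A w) h.
have q3 := quad_bound h a0 Aa; rewrite -vnorm_sq -/n in q3.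
have hn := vnorm_ge0 h.
have q4 : a * n * n * (vnorm h * vnorm h) <= a * n * n * vnorm h.
  by apply: Rmult_le_compat_l => //; nra.
have q5 : B * vnorm h < e.
  apply: (Rlt_le_trans _ (B * (e / B))); first by apply: Rmult_lt_compat_l; lra.
  by right; field; lra.
by rewrite /B in q5; split_Rabs; nra.
Qed.

(* A bound from above at a single positive scale is enough to produce a touching paraboloid. *)
Lemma touch_from_scale (I : finType) (S : vec I -> Prop) (f fh : vec I -> R) L k be (M : mx I) m e r :
  vclosed S -> vusc S f -> 0 < e -> 0 < r -> 0 <= m -> msym M -> (forall i j, Rabs (M i j) <= m) ->
  (forall x y, S y -> f y - L / 2 * sqn (vsub x y) <= fh x) ->
  (forall x d, 0 < d -> exists y, S y /\ fh x <= f y - L / 2 * sqn (vsub x y) + d) ->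
  (forall h, vnorm h <= r -> fh (vadd k h) <= fh k + dot be h + quad M h / 2 + e * (r * r)) ->
  let n := INR #|I| in
  exists x0 x p r', S x0 /\ S x /\ vnorm (vsub x x0) <= r /\
    fh k <= f x0 - L / 2 * sqn (vsub k x0) + e * (r * r) /\
    f x0 - vnorm be * r - m * n * n * (r * r) <= f x /\
    vnorm (vsub p be) <= (n + 1) * ((m + 8 * e) * n * r) /\ 0 < r' /\
    forall y, S y -> vnorm (vsub y x) < r' ->
      f y <= f x + dot p (vsub y x) + quad (madd M (mscale (8 * e) (@mid I))) (vsub y x) / 2.
Proof.
move=> Sc fu e0 r0 m0 Ms Mb h1 h2 up n.
have rr : 0 < r * r by nra.
have er : 0 < e * (r * r) by nra.
have [x0 [Sx0 hx0]] := h2 k _ er.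
(* The added curvature is worth [4 e r^2] on the sphere of radius [r], more than the error [2 e r^2]
   of [touch]; so the maximum over the ball is interior. *)
pose X := madd M (mscale (8 * e) (@mid I)).
have Xs : msym X by move=> i j; rewrite /X /madd /mscale Ms /mid eq_sym.
have Xq h : quad X h = quad M h + 8 * e * dot h h by rewrite /X quad_madd quad_mscale quad_mid.
have Xb i j : Rabs (X i j) <= m + 8 * e.
  rewrite /X /madd /mscale /mid; have := Mb i j.
  by case: (i == j); split_Rabs; lra.
(* Moving [k] and the near-optimal [x0] by the same vector leaves the kernel unchanged, so the upper
   expansion of [fh] at [k] passes to [f] at [x0]. *)
have touch h : vnorm h <= r -> S (vadd x0 h) ->
    f (vadd x0 h) <= f x0 + dot be h + quad M h / 2 + 2 * (e * (r * r)).
  move=> hr Sh; have := h1 (vadd k h) _ Sh; have := up h hr.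
  have -> : vsub (vadd k h) (vadd x0 h) = vsub k x0.
    by vec_ring.
  by lra.
pose K x := S x /\ vnorm (vsub x x0) <= r.
pose P x := dot be (vsub x x0) + quad X (vsub x x0) / 2.
have z0 : vsub x0 x0 = (fun _ => 0) by vec_ring.
have vz : vnorm (fun _ : I => 0) = 0.
  by rewrite vnorm_dot [dot _ _]rsum0 ?sqrt_0 // => i; ring.
have Pz : P x0 = 0.
  rewrite /P z0 [dot _ _]rsum0; last by move=> i; ring.
  by rewrite [quad _ _]rsum0 => [|i]; [field|rewrite rsum0 // => j; ring].
have Kx0 : K x0 by split=> //; rewrite z0 vz; lra.
have KB x : K x -> vnorm x <= vnorm x0 + r.
  move=> [_ hx]; have := vnormD (vsub x x0) x0.
  have -> : vadd (vsub x x0) x0 = x by vec_ring.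
  by lra.
have Kc : vclosed K.
  move=> x hx; split.
    by apply: Sc => d d0; have [y [[Sy _] hy]] := hx d d0; exists y.
  apply: Rnot_lt_le => hlt.
  have d0 : 0 < vnorm (vsub x x0) - r by lra.
  have [y [[_ hy] hyx]] := hx _ d0.
  by have := vnorm_tri x y x0; rewrite vsubC in hyx; lra.
have Ku : vusc K (fun x => f x - P x).
  apply: (vusc_sub_cont (S := S)) => //; first by move=> x [].
  by move=> x d d0; exact: quad_poly_cont.
have [x [Kx xmax]] := usc_attain Kx0 KB Kc Ku.
pose h := vsub x x0.
have xE : x = vadd x0 h by apply: vec_ext => i; rewrite /h /vadd /vsub; ring.
have [Sx hr] := Kx; rewrite -/h in hr.
have hmax := xmax _ Kx0; rewrite Pz in hmax.
have hlt : vnorm h < r.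
  apply: Rnot_le_lt => hge; have hE : vnorm h = r by lra.
  have Sh : S (vadd x0 h) by rewrite -xE.
  have := touch h hr Sh; rewrite -xE; rewrite /P -/h Xq -vnorm_sq hE in hmax.
  by lra.
exists x0, x, (vadd be (mvec X h)), (r - vnorm h); split=> //; split=> //; split=> //.
split=> //; split.
  have hb := cauchy_schwarz be h; have hq := quad_bound h m0 Mb.
  rewrite /P -/h Xq in hmax; rewrite -vnorm_sq -/n in hq.
  have hn := vnorm_ge0 h; have bn := vnorm_ge0 be.
  have t1 : vnorm be * vnorm h <= vnorm be * r by apply: Rmult_le_compat_l; lra.
  have t2 : m * n * n * (vnorm h * vnorm h) <= m * n * n * (r * r).
    apply: Rmult_le_compat_l; last by nra.
    by have n0 : 0 <= n := pos_INR _; apply: Rmult_le_pos => //; nra.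
  have := dot_ge0 h; split_Rabs; nra.
split.
  have -> : vsub (vadd be (mvec X h)) be = mvec X h.
    by vec_ring.
  have n0 : 0 <= n := pos_INR _.
  apply: Rle_trans (mvec_bound h (_ : 0 <= m + 8 * e) Xb) _; first by lra.
  apply: Rmult_le_compat_l; first by rewrite -/n; lra.
  by apply: Rmult_le_compat_l; [rewrite -/n; nra|lra].
split; first by lra.
move=> y Sy hy; pose w := vsub y x.
have yw : vsub y x0 = vadd h w by apply: vec_ext => i; rewrite /h /w /vadd /vsub; ring.
have Ky : K y by split=> //; rewrite yw; have := vnormD h w; rewrite /w; lra.
have := xmax _ Ky; rewrite /P yw -/h dotDr quadD // bil_mvec // -/X -/w dotDl; lra.
Qed.

(** * Functions of separate variables *)

Definition vcat (I J : finType) (u : vec I) (v : vec J) : vec (I + J)%type :=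
  fun a => match a with inl i => u i | inr j => v j end.
Definition vleft (I J : finType) (z : vec (I + J)%type) : vec I := fun i => z (inl i).
Definition vright (I J : finType) (z : vec (I + J)%type) : vec J := fun j => z (inr j).

Lemma dot_vcat (I J : finType) (z : vec (I + J)%type) u v :
  dot z (vcat u v) = dot (vleft z) u + dot (vright z) v.
Proof. exact: rsum_sum. Qed.

Lemma dot_split (I J : finType) (z w : vec (I + J)%type) :
  dot z w = dot (vleft z) (vleft w) + dot (vright z) (vright w).
Proof. exact: rsum_sum. Qed.

Lemma vleft_norm (I J : finType) (z : vec (I + J)%type) : vnorm (vleft z) <= vnorm z.
Proof.
apply: Rle_sqr (vnorm_ge0 z) _; rewrite !vnorm_sq dot_split.
by have := dot_ge0 (vright z); lra.
Qed.

Lemma vright_norm (I J : finType) (z : vec (I + J)%type) : vnorm (vright z) <= vnorm z.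
Proof.
apply: Rle_sqr (vnorm_ge0 z) _; rewrite !vnorm_sq dot_split.
by have := dot_ge0 (vleft z); lra.
Qed.

Lemma vcat_split (I J : finType) (z : vec (I + J)%type) : vcat (vleft z) (vright z) = z.
Proof. by apply: vec_ext => -[]. Qed.

Lemma quad_vcat (I J : finType) (M : mx (I + J)%type) u v : msym M ->
  quad M (vcat u v) = quad (fun i j => M (inl i) (inl j)) u
    + quad (fun i j => M (inr i) (inr j)) v
    + 2 * bil M (vcat u (fun _ => 0)) (vcat (fun _ => 0) v).
Proof.
move=> Ms; have -> : vcat u v = vadd (vcat u (fun _ => 0)) (vcat (fun _ => 0) v).
  by apply: vec_ext => -[i|j]; rewrite /vadd /vcat; ring.
rewrite quadD //.
have -> : quad M (vcat u (fun _ => 0)) = quad (fun i j => M (inl i) (inl j)) u.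
  rewrite /quad rsum_sum [X in _ + X]rsum0; last first.
    by move=> j; rewrite rsum0 // => i /=; ring.
  rewrite Rplus_0_r; apply: rsum_ext => i; rewrite rsum_sum [X in _ + X]rsum0 ?Rplus_0_r //.
  by move=> j /=; ring.
have -> : quad M (vcat (fun _ => 0) v) = quad (fun i j => M (inr i) (inr j)) v.
  rewrite /quad rsum_sum [X in X + _]rsum0; last first.
    by move=> j; rewrite rsum0 // => i /=; ring.
  rewrite Rplus_0_l; apply: rsum_ext => i; rewrite rsum_sum [X in X + _]rsum0 ?Rplus_0_l //.
  by move=> j /=; ring.
by ring.
Qed.

Lemma mx_entry_bound (I : finType) (A : mx I) : exists a, 0 <= a /\ forall i j, Rabs (A i j) <= a.
Proof.
exists (rsum (fun p : I * I => Rabs (A p.1 p.2))); split.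
  by apply: rsum_ge0 => p; exact: Rabs_pos.
move=> i j; apply: (@rsum_term _ (fun p : I * I => Rabs (A p.1 p.2)) (i, j)) => p.
exact: Rabs_pos.
Qed.

Lemma bil_norm_bound (I : finType) (A : mx I) a u v : 0 <= a ->
  (forall i j, Rabs (A i j) <= a) ->
  Rabs (bil A u v) <= a * INR #|I| * INR #|I| * (vnorm u * vnorm v).
Proof.
move=> a0 Aa; apply: Rle_trans (bil_bound u v a0 Aa) _.
have s0 (w : vec I) : 0 <= rsum (fun i => Rabs (w i)).
  by apply: rsum_ge0 => i; exact: Rabs_pos.
have := Rmult_le_compat_l _ _ _ a0
  (Rmult_le_compat _ _ _ _ (s0 u) (s0 v) (rsum_abs_le u) (rsum_abs_le v)).
by lra.
Qed.

(** Young's inequality on the cross term. The resulting constant dictates the strength [L] of the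
    regularisation in [sums_at_zero]. *)
Lemma quad_perturb (I : finType) (A : mx I) a th z e : 0 <= a -> 0 < th -> msym A ->
  (forall u v, Rabs (bil A u v) <= a * (vnorm u * vnorm v)) ->
  quad A (vadd z e) <= quad A z + th * dot z z + (a * a / th + a) * dot e e.
Proof.
move=> a0 th0 As Aa; rewrite quadD //.
have h1 := Aa z e; have h2 : Rabs (quad A e) <= a * (vnorm e * vnorm e) := Aa e e.
rewrite -!vnorm_sq.
have : 0 <= (th * vnorm z - a * vnorm e) * (th * vnorm z - a * vnorm e) / th.
  apply: Rmult_le_pos; first exact: Rle_0_sqr.
  by apply: Rlt_le; exact: Rinv_0_lt_compat.
have -> : (th * vnorm z - a * vnorm e) * (th * vnorm z - a * vnorm e) / th
  = th * (vnorm z * vnorm z) - 2 * (a * (vnorm z * vnorm e)) + a * a / th * (vnorm e * vnorm e).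
  by field; lra.
by split_Rabs; lra.
Qed.

Lemma semiconvexD (I : finType) (F G : vec I -> R) C D :
  semiconvex F C -> semiconvex G D -> semiconvex (fun z => F z + G z) (C + D).
Proof. by move=> hF hG z e; have := hF z e; have := hG z e; lra. Qed.

Lemma semiconvex_quad (I : finType) (A : mx I) c a : 0 <= a -> 0 <= c -> msym A ->
  (forall u v, Rabs (bil A u v) <= a * (vnorm u * vnorm v)) ->
  semiconvex (fun z => - (quad A z / 2 + c * dot z z)) (a + 2 * c).
Proof.
move=> a0 c0 As Aa z e.
have -> : vsub z e = vadd z (vscale (-1) e) by vec_ring.
have bE : bil A z (vscale (-1) e) = - bil A z e.
  rewrite bilC // [in RHS]bilC // /bil -rsumN; apply: rsum_ext => i; rewrite -rsumN.
  by apply: rsum_ext => j; rewrite /vscale; ring.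
have -> : quad A (vadd z (vscale (-1) e)) = quad A z - 2 * bil A z e + quad A e.
  by rewrite quadD // quadZ bE; ring.
have -> : sqn (vadd z (vscale (-1) e)) = dot z z - 2 * dot z e + dot e e.
  by rewrite dotDr !dotDl !dotZr !dotZl (dotC e z); ring.
have -> : sqn (vadd z e) = dot z z + 2 * dot z e + dot e e.
  by rewrite dotDr !dotDl (dotC e z); ring.
rewrite quadD //.
have : Rabs (quad A e) <= a * (vnorm e * vnorm e) := Aa e e.
by rewrite vnorm_sq; split_Rabs; lra.
Qed.

Lemma dot_vec0 (I : finType) (u : vec I) : dot u (fun _ => 0) = 0.
Proof. by apply: rsum0 => i; ring. Qed.

Lemma vnorm_vec0 (I : finType) : vnorm (fun _ : I => 0) = 0.
Proof. by rewrite vnorm_dot dot_vec0 sqrt_0. Qed.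

Lemma quad_vec0 (I : finType) (A : mx I) : quad A (fun _ => 0) = 0.
Proof. by rewrite /quad rsum0 // => i; rewrite rsum0 // => j; ring. Qed.

Lemma vadd0 (I : finType) (u : vec I) : vadd u (fun _ => 0) = u.
Proof. by vec_ring. Qed.

(** Increments in one variable give the separate expansions. Comparing them with the joint one shows
    that the mixed blocks of [M] are below the error, since a sum of functions of separate variables
    has no mixed term; three errors, doubled, give the 6. *)
Lemma separable_split (I J : finType) (f : vec I -> R) (g : vec J -> R) (k be : vec (I + J)%type)
  (M : mx (I + J)%type) r e : msym M -> 0 < r -> 0 <= e ->
  (forall h, vnorm h <= r ->
     Rabs (f (vleft (vadd k h)) + g (vright (vadd k h)) - (f (vleft k) + g (vright k))
        - dot be h - quad M h / 2) <= e * (r * r)) ->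
  [/\ forall h, vnorm h <= r ->
     f (vadd (vleft k) h) <= f (vleft k) + dot (vleft be) h
       + quad (fun i j => M (inl i) (inl j)) h / 2 + e * (r * r),
   forall h, vnorm h <= r ->
     g (vadd (vright k) h) <= g (vright k) + dot (vright be) h
       + quad (fun i j => M (inr i) (inr j)) h / 2 + e * (r * r) &
   forall u v, quad (fun i j => M (inl i) (inl j)) u + quad (fun i j => M (inr i) (inr j)) v
     <= quad M (vcat u v) + 6 * e * (dot u u + dot v v)].
Proof.
move=> Ms r0 e0 ex.
have nl (u : vec I) : vnorm (vcat u (fun _ : J => 0)) = vnorm u.
  by rewrite !vnorm_dot dot_vcat dot_vec0 Rplus_0_r.
have nr (v : vec J) : vnorm (vcat (fun _ : I => 0) v) = vnorm v.
  by rewrite !vnorm_dot dot_vcat dot_vec0 Rplus_0_l.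
have bz (u : vec (I + J)%type) : bil M u (fun _ => 0) = 0.
  by rewrite /bil rsum0 // => i; rewrite rsum0 // => j; ring.
have b0z (u : vec (I + J)%type) : bil M (fun _ => 0) u = 0 by rewrite bilC.
have z0 : vcat (fun _ : I => 0) (fun _ : J => 0) = (fun _ => 0).
  by apply: vec_ext => -[].
have vl u v : vleft (vadd k (vcat u v)) = vadd (vleft k) u by [].
have vr u v : vright (vadd k (vcat u v)) = vadd (vright k) v by [].
have exl h : vnorm h <= r -> Rabs (f (vadd (vleft k) h) - f (vleft k) - dot (vleft be) h
    - quad (fun i j => M (inl i) (inl j)) h / 2) <= e * (r * r).
  move=> hr; have := ex (vcat h (fun _ => 0)); rewrite nl => /(_ hr).
  rewrite vl vr vadd0 dot_vcat dot_vec0 quad_vcat // z0 bz quad_vec0.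
  by split_Rabs; lra.
have exr h : vnorm h <= r -> Rabs (g (vadd (vright k) h) - g (vright k) - dot (vright be) h
    - quad (fun i j => M (inr i) (inr j)) h / 2) <= e * (r * r).
  move=> hr; have := ex (vcat (fun _ => 0) h); rewrite nr => /(_ hr).
  rewrite vl vr vadd0 dot_vcat dot_vec0 quad_vcat // z0 b0z quad_vec0.
  by split_Rabs; lra.
split=> [h hr|h hr|u v]; first by have := exl h hr; split_Rabs; lra.
  by have := exr h hr; split_Rabs; lra.
pose w := vcat u v.
case: (Req_dec (vnorm w) 0) => [w0|wn].
  have wz := vnorm0P w0.
  have -> : u = (fun _ => 0) by apply: vec_ext => i; exact: (wz (inl i)).
  have -> : v = (fun _ => 0) by apply: vec_ext => j; exact: (wz (inr j)).
  by rewrite z0 !quad_vec0 !dot_vec0; lra.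
have wp : 0 < vnorm w by have := vnorm_ge0 w; lra.
pose l := r / vnorm w.
have lE : l * vnorm w = r by rewrite /l; field.
have l0 : 0 < l by apply: Rdiv_lt_0_compat.
have sE : vscale l w = vcat (vscale l u) (vscale l v) by apply: vec_ext => -[].
have wr : vnorm (vcat (vscale l u) (vscale l v)) <= r.
  by rewrite -sE vnormZ Rabs_pos_eq; lra.
have ul : vnorm (vscale l u) <= r by apply: Rle_trans wr; exact: (vleft_norm (vcat _ _)).
have vl' : vnorm (vscale l v) <= r by apply: Rle_trans wr; exact: (vright_norm (vcat _ _)).
have := ex _ wr; have := exl _ ul; have := exr _ vl'.
rewrite vl vr dot_vcat -sE quadZ !quadZ -/w.
set Qu := quad _ u; set Qv := quad _ v; set Q := quad M w => t1 t2 t3.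
have ww : dot u u + dot v v = vnorm w * vnorm w by rewrite vnorm_sq /w dot_vcat.
rewrite ww; apply: (Rmult_le_reg_l (l * l)); first by nra.
have -> : l * l * (Q + 6 * e * (vnorm w * vnorm w)) = l * l * Q + 6 * (e * (r * r)).
  by rewrite -lE; ring.
by split_Rabs; lra.
Qed.

Definition touches_above (I : finType) (S : vec I -> Prop) (f : vec I -> R) (x p : vec I) (X : mx I)
  : Prop :=
  exists r, 0 < r /\ forall y, S y -> vnorm (vsub y x) < r ->
      f y <= f x + dot p (vsub y x) + quad X (vsub y x) / 2.

Lemma vleft_vcat (I J : finType) (u : vec I) (v : vec J) : vleft (vcat u v) = u.
Proof. by []. Qed.

Lemma vright_vcat (I J : finType) (u : vec I) (v : vec J) : vright (vcat u v) = v.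
Proof. by []. Qed.

(** The summand 1 in the bound on [L] leaves a negative square in the conclusion, which later bounds
    the distance from a point to its near-optimal pair. *)
Lemma sum_perturb_bound (I J : finType) (S : vec I -> Prop) (S' : vec J -> Prop) f g
  (A : mx (I + J)%type) a th L z x y :
  0 <= a -> 0 < th -> msym A -> (forall u v, Rabs (bil A u v) <= a * (vnorm u * vnorm v)) ->
  (forall x y, S x -> S' y -> f x + g y <= quad A (vcat x y) / 2) -> S x -> S' y ->
  a * a / th + a + 1 <= L ->
  f x + g y - L / 2 * sqn (vsub z (vcat x y))
   <= quad A z / 2 + th / 2 * dot z z - sqn (vsub z (vcat x y)) / 2.
Proof.
move=> a0 th0 As Aa hfg Sx Sy hL; have h1 := hfg x y Sx Sy.
have h2 := quad_perturb z (vsub (vcat x y) z) a0 th0 As Aa.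
have e1 : vadd z (vsub (vcat x y) z) = vcat x y.
  by vec_ring.
have e2 : sqn (vsub (vcat x y) z) = sqn (vsub z (vcat x y)).
  by apply: rsum_ext => i; rewrite /vsub; ring.
rewrite e1 e2 in h2.
have := dot_ge0 (vsub z (vcat x y)); set D := dot _ _ in h2 *.
by move=> D0; nra.
Qed.

(** The theorem on sums at the origin, with values and slopes normalised to 0. The sup-convolutions
    of [f] and [g] are semiconvex and still below a slightly larger quadratic; subtracting more than
    that quadratic makes 0 a strict maximum, to which [approx_second_order] applies. *)
Lemma sums_at_zero (I J : finType) (S : vec I -> Prop) (S' : vec J -> Prop) f g
  (A : mx (I + J)%type) eps :
  msym A -> S (fun _ => 0) -> S' (fun _ => 0) -> f (fun _ => 0) = 0 -> g (fun _ => 0) = 0 ->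
  vclosed S -> vusc S f -> vclosed S' -> vusc S' g -> 0 < eps ->
  (forall x y, S x -> S' y -> f x + g y <= quad A (vcat x y) / 2) ->
  exists x y p q X Y, S x /\ S' y /\ vnorm x < eps /\ vnorm y < eps /\
    vnorm p < eps /\ vnorm q < eps /\ msym X /\ msym Y /\ - eps < f x + g y /\
    touches_above S f x p X /\ touches_above S' g y q Y /\
    forall u v, quad X u + quad Y v <= quad A (vcat u v) + eps * (dot u u + dot v v).
Proof.
move=> As S0 S'0 f0 g0 Sc fu S'c gu eps0 hfg.
have [a0 [a00 Ab]] := mx_entry_bound A.
pose N := INR #|{: I + J}|; have N0 : 0 <= N by exact: pos_INR.
pose a := a0 * N * N; have aa : 0 <= a by rewrite /a; apply: Rmult_le_pos => //; nra.
have Aa u v : Rabs (bil A u v) <= a * (vnorm u * vnorm v) by exact: bil_norm_bound.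
pose th := Rmin 1 (eps / 8).
have th0 : 0 < th by apply: Rmin_glb_lt; lra.
have th1 : th <= 1 by exact: Rmin_l.
have the : th <= eps / 8 by exact: Rmin_r.
pose L := a * a / th + a + 1.
have L0 : 1 <= L.
  suff : 0 <= a * a / th by rewrite /L; lra.
  by apply: Rmult_le_pos; [nra|apply: Rlt_le; exact: Rinv_0_lt_compat].
have key z x y : S x -> S' y -> f x + g y - L / 2 * sqn (vsub z (vcat x y))
   <= quad A z / 2 + th / 2 * dot z z - sqn (vsub z (vcat x y)) / 2.
  by move=> Sx Sy; apply: (sum_perturb_bound (S := S) (S' := S')) => //; rewrite /L; lra.
have split_sub (z : vec (I + J)%type) x y : sqn (vsub z (vcat x y))
   = sqn (vsub (vleft z) x) + sqn (vsub (vright z) y).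
  by rewrite dot_split.
have sub0 (T : finType) (u : vec T) : vsub u (fun _ => 0) = u.
  by vec_ring.
have [fh [fh1 fh2]] : exists fh : vec I -> R,
    (forall x y, S y -> f y - L / 2 * sqn (vsub x y) <= fh x) /\
    (forall x d, 0 < d -> exists y, S y /\ fh x <= f y - L / 2 * sqn (vsub x y) + d).
  apply: (sup_convolution S0) => x.
  exists (quad A (vcat x (fun _ => 0)) / 2
    + th / 2 * dot (vcat x (fun _ : J => 0)) (vcat x (fun _ => 0))) => y Sy.
  have := key (vcat x (fun _ => 0)) y (fun _ => 0) Sy S'0.
  rewrite split_sub g0 vleft_vcat vright_vcat sub0 dot_vec0.
  by have := dot_ge0 (vsub x y); lra.
have [gh [gh1 gh2]] : exists gh : vec J -> R,
    (forall x y, S' y -> g y - L / 2 * sqn (vsub x y) <= gh x) /\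
    (forall x d, 0 < d -> exists y, S' y /\ gh x <= g y - L / 2 * sqn (vsub x y) + d).
  apply: (sup_convolution S'0) => x.
  exists (quad A (vcat (fun _ => 0) x) / 2
    + th / 2 * dot (vcat (fun _ : I => 0) x) (vcat (fun _ => 0) x)) => y Sy.
  have := key (vcat (fun _ => 0) x) (fun _ => 0) y S0 Sy.
  rewrite split_sub f0 vleft_vcat vright_vcat sub0 dot_vec0.
  by have := dot_ge0 (vsub x y); lra.
(* The sum lies below [quad A z / 2 + th / 2 |z|^2], so subtracting [th |z|^2] leaves the decay
   [th / 2 |z|^2]. *)
pose F z := (fh (vleft z) + gh (vright z)) + - (quad A z / 2 + th * dot z z).
have scF : semiconvex F (L + (a + 2 * th)).
  apply: semiconvexD; last by apply: semiconvex_quad => //; lra.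
  have sf := sup_convolution_semiconvex fh1 fh2; have sg := sup_convolution_semiconvex gh1 gh2.
  move=> z e; have h1 : - (L * sqn (vleft e))
    <= fh (vleft (vadd z e)) + fh (vleft (vsub z e)) - 2 * fh (vleft z) := sf _ _.
  have h2 : - (L * sqn (vright e))
    <= gh (vright (vadd z e)) + gh (vright (vsub z e)) - 2 * gh (vright z) := sg _ _.
  by rewrite (dot_split e e); lra.
have upF z : fh (vleft z) + gh (vright z) <= quad A z / 2 + th / 2 * dot z z.
  apply: Rnot_lt_le => hlt.
  pose d := (fh (vleft z) + gh (vright z) - (quad A z / 2 + th / 2 * dot z z)) / 4.
  have d0 : 0 < d by rewrite /d; lra.
  have [x [Sx hx]] := fh2 (vleft z) d d0; have [y [Sy hy]] := gh2 (vright z) d d0.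
  have := key z x y Sx Sy; have := dot_ge0 (vsub z (vcat x y)); rewrite split_sub.
  by rewrite /d in hx hy; lra.
have z00 : vleft (fun _ : (I + J)%type => 0) = (fun _ => 0) by [].
have z01 : vright (fun _ : (I + J)%type => 0) = (fun _ => 0) by [].
have F0 : F (fun _ => 0) = 0.
  have h1 := fh1 (fun _ => 0) _ S0; have h2 := gh1 (fun _ => 0) _ S'0.
  rewrite sub0 dot_vec0 f0 in h1; rewrite sub0 dot_vec0 g0 in h2.
  have := upF (fun _ => 0); rewrite /F quad_vec0 dot_vec0.
  by rewrite z00 z01; lra.
have FF z : F z <= F (fun _ => 0) - th / 2 * dot z z.
  by rewrite F0 /F; have := upF z; lra.
pose C := L + (a + 2 * th); have C0 : 0 <= C by rewrite /C; lra.
pose C4 := sdiff_const N C.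
have C40 : 0 <= C4.
  have : 0 <= N * C by nra.
  by rewrite /C4 /sdiff_const; lra.
pose m := C4 + a0 + 2; have m0 : 0 <= m by rewrite /m; lra.
pose b1 := 3 + (N + 1) * (a0 * N).
have b10 : 3 <= b1.
  have : 0 <= a0 * N by nra.
  by rewrite /b1; nra.
pose BB := 20 + a + 2 * b1 + 2 * m * N * N + (N + 1) * ((m + 8) * N) + b1.
have mN : 0 <= 2 * m * N * N by apply: Rmult_le_pos => //; nra.
have mN2 : 0 <= (N + 1) * ((m + 8) * N) by apply: Rmult_le_pos; nra.
have BB1 : 20 <= BB by rewrite /BB; lra.
(* None of [m], [b1], [BB] depends on [e]. 112 is [7 * 16], so that [d2 <= 7 e] becomes a distance
   of at most [eps / 4]. *)
pose e := Rmin (eps / (4 * BB)) (Rmin 1 (eps * eps / 112)).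
have e0 : 0 < e.
  apply: Rmin_glb_lt; first by apply: Rdiv_lt_0_compat; lra.
  by apply: Rmin_glb_lt; nra.
have eB : e * BB <= eps / 4.
  have -> : eps / 4 = eps / (4 * BB) * BB by field; lra.
  by apply: Rmult_le_compat_r; [lra|exact: Rmin_l].
have e1 : e <= 1 by apply: Rle_trans (Rmin_r _ _) _; exact: Rmin_l.
have e2 : e <= eps * eps / 112 by apply: Rle_trans (Rmin_r _ _) _; exact: Rmin_r.
have th2 : 0 < th / 2 by lra.
have [k [b [Z [r [Zs [Zb [kn [bn [[r0 re] [Fk [Zle ex]]]]]]]]]]] :=
  approx_second_order th2 C0 (conj e0 e1) scF FF.
rewrite F0 -/N -/C -/C4 in Fk Zb.
(* The Hessian of the quadratic subtracted in [F] is restored. *)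
pose M := madd (madd Z A) (mscale (2 * th) (@mid (I + J)%type)).
have Ms : msym M by move=> i j; rewrite /M /madd /mscale Zs As /mid eq_sym.
have Mq h : quad M h = quad Z h + quad A h + 2 * th * dot h h.
  by rewrite /M !quad_madd quad_mscale quad_mid.
have Mb i j : Rabs (M i j) <= m.
  rewrite /M /madd /mscale /mid /m; have := Zb i j; have := Ab i j.
  by case: (i == j); split_Rabs; lra.
pose be := vadd b (vadd (mvec A k) (vscale (2 * th) k)).
have k0 := vnorm_ge0 k.
have kke : vnorm k * vnorm k <= e.
  have h := Rmult_le_compat _ _ _ _ k0 k0 (Rlt_le _ _ kn) (Rlt_le _ _ kn).
  by have := Rmult_le_compat_l _ _ _ (Rlt_le _ _ e0) e1; lra.
have ben : vnorm be <= e * b1.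
  apply: Rle_trans (vnormD _ _) _.
  have h1 := vnormD (mvec A k) (vscale (2 * th) k).
  rewrite vnormZ Rabs_pos_eq in h1; last by lra.
  have h2 := mvec_bound k a00 Ab; rewrite -/N in h2.
  have h3 : (N + 1) * (a0 * N * vnorm k) <= (N + 1) * (a0 * N * e).
    by apply: Rmult_le_compat_l; [lra|apply: Rmult_le_compat_l; [nra|lra]].
  have h4 : 2 * th * vnorm k <= 2 * e by nra.
  by rewrite /b1; lra.
have exM h : vnorm h <= r ->
   Rabs (fh (vleft (vadd k h)) + gh (vright (vadd k h)) - (fh (vleft k) + gh (vright k))
        - dot be h - quad M h / 2) <= e * (r * r).
  move=> hr; have := ex h hr; rewrite /F Mq quadD // bil_mvec //.
  have -> : dot be h = dot b h + (dot (mvec A k) h + 2 * th * dot k h).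
    by rewrite /be !dotDl dotZl.
  have -> : sqn (vadd k h) = dot k k + 2 * dot k h + dot h h.
    by rewrite dotDr !dotDl (dotC h k); ring.
  by split_Rabs; lra.
have [fup gup qsum] := separable_split Ms r0 (Rlt_le _ _ e0) exM.
have rr1 : r * r <= 1 by nra.
have card1 : INR #|I| <= N by apply: le_INR; apply/leP; rewrite card_sum leq_addr.
have card2 : INR #|J| <= N by apply: le_INR; apply/leP; rewrite card_sum leq_addl.
have [x0 [x [p [r1 [Sx0 [Sx [xx0 [hx0 [fx [pb [r10 tx]]]]]]]]]]] :=
  touch_from_scale Sc fu e0 r0 m0 (fun i j => Ms (inl i) (inl j)) (fun i j => Mb (inl i) (inl j))
    fh1 fh2 fup.
have [y0 [y [q [r2 [Sy0 [Sy [yy0 [hy0 [gy [qb [r20 ty]]]]]]]]]]] :=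
  touch_from_scale S'c gu e0 r0 m0 (fun i j => Ms (inr i) (inr j)) (fun i j => Mb (inr i) (inr j))
    gh1 gh2 gup.
have bel := vleft_norm be; have ber := vright_norm be.
have kl := vleft_norm k; have kr := vright_norm k.
have fk : - e + quad A k / 2 + th * dot k k <= fh (vleft k) + gh (vright k).
  by rewrite /F in Fk; lra.
have er2 : e * (r * r) <= e by have := Rmult_le_compat_l _ _ _ (Rlt_le _ _ e0) rr1; lra.
(* [k] nearly maximises [F] and [(x0, y0)] is nearly optimal for [k]; the negative square in [key]
   then forces the two to be close. *)
pose d2 := sqn (vsub k (vcat x0 y0)).
have d2E := split_sub k x0 y0.
have d2b : d2 <= 7 * e.
  have := key k x0 y0 Sx0 Sy0; rewrite -/d2 in d2E *.
  have kk : 0 <= th * dot k k by apply: Rmult_le_pos; [lra|exact: dot_ge0].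
  by rewrite d2E; lra.
have d2s : d2 <= eps / 4 * (eps / 4) by lra.
have close1 : vnorm (vsub (vleft k) x0) <= eps / 4.
  apply: Rle_sqr; first by lra.
  by rewrite vnorm_sq; have := dot_ge0 (vsub (vright k) y0); rewrite /d2 in d2s; lra.
have close2 : vnorm (vsub (vright k) y0) <= eps / 4.
  apply: Rle_sqr; first by lra.
  by rewrite vnorm_sq; have := dot_ge0 (vsub (vleft k) x0); rewrite /d2 in d2s; lra.
have ee : 20 * e <= eps / 4 by have := Rmult_le_compat_l _ _ _ (Rlt_le _ _ e0) BB1; lra.
have tri0 (T : finType) (u v w : vec T) : vnorm u <= vnorm (vsub u v) + vnorm (vsub v w) + vnorm w.
  have h1 := vnorm_tri u v w; have h2 := vnormD (vsub u w) w.
  have h3 : vadd (vsub u w) w = u by vec_ring.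
  by rewrite h3 in h2; lra.
have pbound (T : finType) : INR #|T| <= N ->
    (INR #|T| + 1) * ((m + 8 * e) * INR #|T| * r) <= e * ((N + 1) * ((m + 8) * N)).
  move=> tN; have t0 := pos_INR #|T|.
  have h1 : (m + 8 * e) * INR #|T| <= (m + 8) * N by apply: Rmult_le_compat; lra.
  have h2 : 0 <= (m + 8 * e) * INR #|T| by apply: Rmult_le_pos; lra.
  have h3 : (m + 8 * e) * INR #|T| * r <= (m + 8) * N * e by apply: Rmult_le_compat; lra.
  have h4 : 0 <= (m + 8 * e) * INR #|T| * r by apply: Rmult_le_pos; lra.
  have : (INR #|T| + 1) * ((m + 8 * e) * INR #|T| * r) <= (N + 1) * ((m + 8) * N * e).
    by apply: Rmult_le_compat; lra.
  by lra.
have mbound (T : finType) : INR #|T| <= N ->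
    m * INR #|T| * INR #|T| * (r * r) <= e * (m * N * N).
  move=> tN; have t0 := pos_INR #|T|.
  have h1 : m * INR #|T| <= m * N by apply: Rmult_le_compat_l.
  have h2 : m * INR #|T| * INR #|T| <= m * N * N.
    by apply: Rmult_le_compat => //; exact: Rmult_le_pos.
  have h3 : r * r <= e.
    have rle1 : r <= 1 by lra.
    by have := Rmult_le_compat _ _ _ _ (Rlt_le _ _ r0) (Rlt_le _ _ r0) (Rlt_le _ _ re) rle1; lra.
  have h4 : 0 <= m * INR #|T| * INR #|T| by do 2 apply: Rmult_le_pos => //.
  have := Rmult_le_compat _ _ _ _ h4 (Rlt_le _ _ (Rmult_lt_0_compat _ _ r0 r0)) h2 h3; lra.
have pI := pbound I card1; have pJ := pbound J card2.
have mI := mbound I card1; have mJ := mbound J card2.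
have ebb : e * b1 + e * ((N + 1) * ((m + 8) * N)) <= eps / 4.
  apply: Rle_trans eB; rewrite -Rmult_plus_distr_l.
  by apply: Rmult_le_compat_l; rewrite /BB; lra.
have sub_add (T : finType) (u v : vec T) : vnorm u <= vnorm (vsub u v) + vnorm v.
  have := vnormD (vsub u v) v.
  by have -> : vadd (vsub u v) v = u by [vec_ring].
exists x, y, p, q.
exists (madd (fun i j => M (inl i) (inl j)) (mscale (8 * e) (@mid I))).
exists (madd (fun i j => M (inr i) (inr j)) (mscale (8 * e) (@mid J))).
split=> //; split=> //.
split.
  by have := tri0 _ x x0 (vleft k); rewrite (vsubC x0); lra.
split.
  by have := tri0 _ y y0 (vright k); rewrite (vsubC y0); lra.
split; first by have := sub_add _ p (vleft be); lra.
split; first by have := sub_add _ q (vright be); lra.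
split; first by move=> i j; rewrite /madd /mscale Ms /mid eq_sym.
split; first by move=> i j; rewrite /madd /mscale Ms /mid eq_sym.
split.
  have bl : vnorm (vleft be) * r <= e * b1.
    have h : vnorm (vleft be) <= e * b1 by lra.
    have h1 : r <= 1 by lra.
    by have := Rmult_le_compat _ _ _ _ (vnorm_ge0 (vleft be)) (Rlt_le _ _ r0) h h1; lra.
  have br : vnorm (vright be) * r <= e * b1.
    have h : vnorm (vright be) <= e * b1 by lra.
    have h1 : r <= 1 by lra.
    by have := Rmult_le_compat _ _ _ _ (vnorm_ge0 (vright be)) (Rlt_le _ _ r0) h h1; lra.
  have qa : Rabs (quad A k) <= a * e.
    by apply: Rle_trans (Aa k k) _; exact: Rmult_le_compat_l.
  have kk0 : 0 <= th * dot k k by apply: Rmult_le_pos; [lra|exact: dot_ge0].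
  have d1 := dot_ge0 (vsub (vleft k) x0); have d3 := dot_ge0 (vsub (vright k) y0).
  have l1 : 0 <= L / 2 * sqn (vsub (vleft k) x0) by apply: Rmult_le_pos; lra.
  have l2 : 0 <= L / 2 * sqn (vsub (vright k) y0) by apply: Rmult_le_pos; lra.
  have big : e * (3 + a + 2 * b1 + 2 * (m * N * N)) <= eps / 4.
    by apply: Rle_trans eB; apply: Rmult_le_compat_l; rewrite /BB; lra.
  by split_Rabs; lra.
split; first by exists r1.
split; first by exists r2.
move=> u v; rewrite (quad_madd (fun i j => M (inl i) (inl j))).
rewrite (quad_madd (fun i j => M (inr i) (inr j))) !quad_mscale !quad_mid.
have := qsum u v; have := Zle (vcat u v); rewrite Mq.
have -> : sqn (vcat u v) = dot u u + dot v v by rewrite dot_vcat.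
have W0 : 0 <= dot u u + dot v v by have := dot_ge0 u; have := dot_ge0 v; lra.
have w1 : e * (dot u u + dot v v) <= eps / 80 * (dot u u + dot v v).
  by apply: Rmult_le_compat_r => //; lra.
have w2 : th * (dot u u + dot v v) <= eps / 8 * (dot u u + dot v v).
  by apply: Rmult_le_compat_r.
have := Rmult_le_pos _ _ (Rlt_le _ _ eps0) W0.
by lra.
Qed.

(** * Space-time points as vectors with one extra coordinate *)

Local Notation st I := (unit + I)%type.

Definition stpt (I : finType) (t : R) (x : vec I) : vec (st I) := vcat (fun _ => t) x.
Definition sttime (I : finType) (z : vec (st I)) : R := z (inl tt).
Definition stspace (I : finType) (z : vec (st I)) : vec I := vright z.

Lemma stpt_split (I : finType) (z : vec (st I)) : stpt (sttime z) (stspace z) = z.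
Proof. by apply: vec_ext => -[[]|i]. Qed.

(** * Test functions *)

Lemma derivable_quadratic (f : R -> R) t c1 c2 :
  (forall h, f (t + h) = f t + h * c1 + h * h * c2) -> derivable_pt_lim f t c1.
Proof.
move=> fE e e0; have c0 : 0 < Rabs c2 + 1 by have := Rabs_pos c2; lra.
have d0 : 0 < e / (Rabs c2 + 1) by apply: Rdiv_lt_0_compat.
exists (mkposreal _ d0) => h hn /= hd; rewrite fE.
have -> : (f t + h * c1 + h * h * c2 - f t) / h - c1 = h * c2 by field.
rewrite Rabs_mult; have := Rabs_pos c2; have := Rabs_pos h => h1 h2.
have : Rabs h * (Rabs c2 + 1) < e / (Rabs c2 + 1) * (Rabs c2 + 1) by apply: Rmult_lt_compat_r.
have -> : e / (Rabs c2 + 1) * (Rabs c2 + 1) = e by field; lra.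
by nra.
Qed.

Lemma derivable_eq (f : R -> R) t l l' : l = l' -> derivable_pt_lim f t l -> derivable_pt_lim f t l'.
Proof. by move=> ->. Qed.

Lemma jcont_ext (I : finType) (f g : R -> vec I -> R) :
  (forall t x, f t x = g t x) -> jcont f -> jcont g.
Proof.
by move=> h; have -> : g = f by do 2 (apply: functional_extensionality => ?); rewrite h.
Qed.

Lemma jcont_cst (I : finType) c : jcont (fun (_ : R) (_ : vec I) => c).
Proof. by move=> t x e e0; exists 1; split=> [|s y _ _]; [lra|rewrite Rminus_diag Rabs_R0]. Qed.

Lemma jcontD (I : finType) (f g : R -> vec I -> R) :
  jcont f -> jcont g -> jcont (fun t x => f t x + g t x).
Proof.
move=> hf hg t x e e0; have e2 : 0 < e / 2 by lra.
have [d1 [d10 h1]] := hf t x _ e2; have [d2 [d20 h2]] := hg t x _ e2.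
exists (Rmin d1 d2); split; first exact: Rmin_glb_lt.
move=> s y hs hy.
have := h1 s y (Rlt_le_trans _ _ _ hs (Rmin_l _ _)) (Rlt_le_trans _ _ _ hy (Rmin_l _ _)).
have := h2 s y (Rlt_le_trans _ _ _ hs (Rmin_r _ _)) (Rlt_le_trans _ _ _ hy (Rmin_r _ _)).
by split_Rabs; lra.
Qed.

Lemma jcontM (I : finType) (f g : R -> vec I -> R) :
  jcont f -> jcont g -> jcont (fun t x => f t x * g t x).
Proof.
move=> hf hg t x e e0; pose B := Rabs (f t x) + Rabs (g t x) + 1.
have B0 : 0 < B by have := Rabs_pos (f t x); have := Rabs_pos (g t x); rewrite /B; lra.
pose d := Rmin 1 (e / (2 * B)).
have d0 : 0 < d by apply: Rmin_glb_lt; [lra|apply: Rdiv_lt_0_compat; lra].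
have d1 : d <= 1 by exact: Rmin_l.
have dB : d * (2 * B) <= e.
  have -> : e = e / (2 * B) * (2 * B) by field; lra.
  by apply: Rmult_le_compat_r; [lra|exact: Rmin_r].
have [d2 [d20 h1]] := hf t x _ d0; have [d3 [d30 h2]] := hg t x _ d0.
exists (Rmin d2 d3); split; first exact: Rmin_glb_lt.
move=> s y hs hy.
have k1 := h1 s y (Rlt_le_trans _ _ _ hs (Rmin_l _ _)) (Rlt_le_trans _ _ _ hy (Rmin_l _ _)).
have k2 := h2 s y (Rlt_le_trans _ _ _ hs (Rmin_r _ _)) (Rlt_le_trans _ _ _ hy (Rmin_r _ _)).
have -> : f s y * g s y - f t x * g t x = (f s y - f t x) * g s y + f t x * (g s y - g t x) by ring.
apply: Rle_lt_trans (Rabs_triang _ _) _; rewrite !Rabs_mult.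
have gs : Rabs (g s y) <= Rabs (g t x) + 1 by split_Rabs; lra.
have := Rabs_pos (f s y - f t x); have := Rabs_pos (g s y - g t x).
have := Rabs_pos (f t x); have := Rabs_pos (g s y) => p1 p2 p3 p4.
have m1 : Rabs (f s y - f t x) * Rabs (g s y) <= d * (Rabs (g t x) + 1).
  by apply: Rmult_le_compat; lra.
have m2 : Rabs (f t x) * Rabs (g s y - g t x) <= Rabs (f t x) * d.
  by apply: Rmult_le_compat_l; lra.
by rewrite /B in dB; nra.
Qed.

Lemma jcont_coord (I : finType) i : jcont (fun (_ : R) (x : vec I) => x i).
Proof.
move=> t x e e0; exists e; split=> // s y _ hy.
by apply: Rle_lt_trans hy; exact: (vnorm_coord (vsub y x)).
Qed.

Lemma jcont_time (I : finType) (f : R -> R) : continuity f -> jcont (fun t (_ : vec I) => f t).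
Proof.
move=> fc t x e e0; have [d [d0 hd]] := fc t e e0; exists d; split=> // s y hs _.
case: (Req_dec s t) => [->|st]; first by rewrite Rminus_diag Rabs_R0.
by apply: hd; split=> //; split=> // h; apply: st.
Qed.

Lemma jcont_rsum (I J : finType) (F : J -> R -> vec I -> R) :
  (forall j, jcont (F j)) -> jcont (fun t x => rsum (fun j => F j t x)).
Proof.
move=> hF; rewrite /rsum.
have H (s : seq J) : jcont (fun t x => \big[Rplus/0]_(j <- s) F j t x).
  elim: s => [|j s IH].
    by apply: jcont_ext (@jcont_cst I 0) => t x; rewrite big_nil.
  apply: (jcont_ext (f := fun t x => F j t x + \big[Rplus/0]_(j <- s) F j t x)).
    by move=> t x; rewrite big_cons.
  by apply: jcontD.
exact: H.
Qed.

Lemma jcont_pow (I : finType) (f : R -> vec I -> R) n : jcont f -> jcont (fun t x => f t x ^ n).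
Proof. by move=> hf; elim: n => [|n IH]; [exact: jcont_cst|exact: jcontM]. Qed.

Lemma jcont_stpt (I : finType) (z0 : vec (st I)) a :
  jcont (fun t x => vsub (stpt t x) z0 a).
Proof.
apply: jcontD; last exact: jcont_cst.
case: a => [[]|i]; last exact: jcont_coord.
by apply: (jcont_time (f := id)); exact: (derivable_continuous _ derivable_id).
Qed.

(* The exponent is at least 2, so no truncated exponent occurs in the second derivative. *)
Definition growth (I : finType) (kap : R) (M : nat) (t : R) (x : vec I) : R :=
  exp (- kap * t) * (1 + dot x x) ^ M.+2.

Definition dgrowth (I : finType) (kap : R) (M : nat) (t : R) (x : vec I) : vec I :=
  fun i => exp (- kap * t) * (INR M.+2 * (1 + dot x x) ^ M.+1 * (2 * x i)).

Definition d2growth (I : finType) (kap : R) (M : nat) (t : R) (x : vec I) : mx I :=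
  fun i j => exp (- kap * t) * INR M.+2 *
    (INR M.+1 * (1 + dot x x) ^ M * (2 * x j) * (2 * x i) + (1 + dot x x) ^ M.+1 * (2 * mid i j)).

Definition test_fun (I : finType) b kap M (p : vec (st I)) (A : mx (st I)) z0 t
  (x : vec I) : R :=
  b * growth kap M t x + (dot p (vsub (stpt t x) z0) + quad A (vsub (stpt t x) z0) / 2).

Lemma dot_line (I : finType) (x : vec I) h i :
  sqn (vadd x (vscale h (ebasis i))) = dot x x + h * (2 * x i) + h * h.
Proof.
rewrite dotDr !dotDl !dotZr !dotZl (dotC (ebasis i)) !dot_ebasis /ebasis eqxx; ring.
Qed.

Lemma quad_line (I : finType) (p : vec I) (A : mx I) w h i : msym A ->
  dot p (vadd w (vscale h (ebasis i))) + quad A (vadd w (vscale h (ebasis i))) / 2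
  = (dot p w + quad A w / 2) + h * (p i + mvec A w i) + h * h * (A i i / 2).
Proof.
move=> As; rewrite dotDr dotZr dot_ebasis quadD // quadZ quad_ebasis bil_mvec //.
by rewrite dotZr dot_ebasis; field.
Qed.

Lemma pow_line (I : finType) (x : vec I) i n :
  derivable_pt_lim (fun h => (1 + sqn (vadd x (vscale h (ebasis i)))) ^ n)
    0 (INR n * (1 + dot x x) ^ n.-1 * (2 * x i)).
Proof.
pose u h := 1 + sqn (vadd x (vscale h (ebasis i))).
have u0 : u 0 = 1 + dot x x by rewrite /u dot_line; ring.
have du : derivable_pt_lim u 0 (2 * x i).
  by apply: (derivable_quadratic (c2 := 1)) => h; rewrite u0 /u dot_line Rplus_0_l; ring.
have := derivable_pt_lim_comp u (fun y => y ^ n) 0 _ _ du (derivable_pt_lim_pow (u 0) n).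
by rewrite u0 => h; exact: h.
Qed.

Lemma space_line (I : finType) t (x : vec I) h i z0 :
  vsub (stpt t (vadd x (vscale h (ebasis i)))) z0
  = vadd (vsub (stpt t x) z0) (vscale h (ebasis (inr i))).
Proof.
apply: vec_ext => -[u|j]; rewrite /vsub /vadd /vscale /stpt /vcat /ebasis /=; first by ring.
by rewrite (inj_eq (@inr_inj _ _)); ring.
Qed.

Lemma time_line (I : finType) t (x : vec I) h z0 :
  vsub (stpt (t + h) x) z0 = vadd (vsub (stpt t x) z0) (vscale h (ebasis (inl tt))).
Proof.
by apply: vec_ext => -[[]|j]; rewrite /vsub /vadd /vscale /stpt /vcat /ebasis /=; ring.
Qed.

(** Along a coordinate line the paraboloid is quadratic and [1 + |x|^2] is quadratic as well, so
    every derivative reduces to [derivable_quadratic] and the one-variable rules. *)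
Lemma test_fun_C12 (I : finType) b kap M (p : vec (st I)) (A : mx (st I)) z0 :
  msym A ->
  C12 (test_fun b kap M p A z0)
    (fun t x => b * (- kap * growth kap M t x)
       + (p (inl tt) + mvec A (vsub (stpt t x) z0) (inl tt)))
    (fun t x i => b * dgrowth kap M t x i
       + (p (inr i) + mvec A (vsub (stpt t x) z0) (inr i)))
    (fun t x i j => b * d2growth kap M t x i j + A (inr i) (inr j)).
Proof.
move=> As.
have cexp : jcont (fun t (_ : vec I) => exp (- kap * t)).
  apply: (jcont_time (f := fun t => exp (- kap * t))).
  apply: (continuity_comp (fun t => - kap * t) exp); last exact: derivable_continuous _ derivable_exp.
  by apply: continuity_scal; exact: derivable_continuous _ derivable_id.
have cdot : jcont (fun (_ : R) (x : vec I) => 1 + dot x x).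
  apply: jcontD; first exact: jcont_cst.
  by apply: jcont_rsum => i; apply: jcontM; exact: jcont_coord.
have cg : jcont (@growth I kap M) by apply: jcontM => //; exact: jcont_pow.
have cm a : jcont (fun t x => mvec A (vsub (stpt t x) z0) a).
  apply: jcont_rsum => c; apply: jcontM; [exact: jcont_cst|exact: jcont_stpt].
split.
  move=> t x; apply: derivable_pt_lim_plus.
    apply: derivable_pt_lim_scal.
    apply: (derivable_eq (l := - kap * exp (- kap * t) * (1 + dot x x) ^ M.+2 + exp (- kap * t) * 0)).
      by rewrite /growth; ring.
    apply: (derivable_pt_lim_mult (fun s => exp (- kap * s)) (fun _ => (1 + dot x x) ^ M.+2)).
      apply: (derivable_eq (l := exp (- kap * t) * (- kap * 1))); first by ring.
      apply: (derivable_pt_lim_comp (fun s => - kap * s) exp); last exact: derivable_pt_lim_exp.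
      by apply: (derivable_pt_lim_scal id); exact: derivable_pt_lim_id.
    exact: derivable_pt_lim_const.
  apply: (derivable_quadratic (c2 := A (inl tt) (inl tt) / 2)) => h.
  by rewrite time_line quad_line.
split.
  move=> t x i; apply: (derivable_pt_lim_plus
    (fun h => b * growth kap M t (vadd x (vscale h (ebasis i))))
    (fun h => dot p (vsub (stpt t (vadd x (vscale h (ebasis i)))) z0)
       + quad A (vsub (stpt t (vadd x (vscale h (ebasis i)))) z0) / 2)).
    apply: derivable_pt_lim_scal; apply: derivable_pt_lim_scal.
    exact: pow_line.
  apply: (derivable_quadratic (c2 := A (inr i) (inr i) / 2)) => h.
  by rewrite !space_line !quad_line //; ring.
split.
  move=> t x i j; apply: (derivable_pt_lim_plus
    (fun h => b * dgrowth kap M t (vadd x (vscale h (ebasis j))) i)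
    (fun h => p (inr i) + mvec A (vsub (stpt t (vadd x (vscale h (ebasis j)))) z0) (inr i))).
    rewrite /d2growth Rmult_assoc; apply: derivable_pt_lim_scal; apply: derivable_pt_lim_scal.
    pose f h := INR M.+2 * (1 + sqn (vadd x (vscale h (ebasis j)))) ^ M.+1.
    pose g h := 2 * (vadd x (vscale h (ebasis j))) i.
    have f0 : f 0 = INR M.+2 * (1 + dot x x) ^ M.+1 by rewrite /f dot_line; congr (_ * _ ^ _); ring.
    have g0 : g 0 = 2 * x i by rewrite /g /vadd /vscale; ring.
    apply: (derivable_eq (l := (INR M.+2 * (INR M.+1 * (1 + dot x x) ^ M * (2 * x j))) * g 0
       + f 0 * (2 * mid i j))).
      by rewrite f0 g0; ring.
    apply: (derivable_pt_lim_mult f g).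
      by apply: derivable_pt_lim_scal; exact: pow_line.
    apply: (derivable_quadratic (c2 := 0)) => h.
    by rewrite g0 /g /vadd /vscale /ebasis /mid; case: (i == j); ring.
  apply: (derivable_quadratic (c2 := 0)) => h.
  rewrite !space_line.
  have mv c : mvec A (vadd (vsub (stpt t x) z0) (vscale c (ebasis (inr j)))) (inr i)
    = mvec A (vsub (stpt t x) z0) (inr i) + c * A (inr i) (inr j).
    rewrite -[A (inr i) _](dot_ebasis (A (inr i))) -dotZr.
    by rewrite -[RHS](dotDr (A (inr i))).
  by rewrite !mv; ring.
split.
  apply: jcontD; first by apply: jcontM => //; exact: jcont_cst.
  apply: jcontD.
    by apply: jcont_rsum => a; apply: jcontM; [exact: jcont_cst|exact: jcont_stpt].
  apply: jcontM; last exact: jcont_cst.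
  apply: jcont_rsum => a; apply: jcont_rsum => c; apply: jcontM; last exact: jcont_stpt.
  by apply: jcontM; [exact: jcont_stpt|exact: jcont_cst].
split.
  apply: jcontD; last by apply: jcontD => //; exact: jcont_cst.
  apply: jcontM; first exact: jcont_cst.
  by apply: jcontM => //; exact: jcont_cst.
split=> i.
  apply: jcontD; last by apply: jcontD => //; exact: jcont_cst.
  apply: jcontM; first exact: jcont_cst.
  apply: jcontM => //; apply: jcontM; last by apply: jcontM; [exact: jcont_cst|exact: jcont_coord].
  by apply: jcontM; [exact: jcont_cst|exact: jcont_pow].
move=> j; apply: jcontD; last exact: jcont_cst.
apply: jcontM; first exact: jcont_cst.
apply: jcontM; first by apply: jcontM => //; exact: jcont_cst.
apply: jcontD.
  apply: jcontM; last by apply: jcontM; [exact: jcont_cst|exact: jcont_coord].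
  apply: jcontM; last by apply: jcontM; [exact: jcont_cst|exact: jcont_coord].
  by apply: jcontM; [exact: jcont_cst|exact: jcont_pow].
by apply: jcontM; [exact: jcont_pow|exact: jcont_cst].
Qed.

Lemma growth_pos (I : finType) kap M t (x : vec I) : 0 < growth kap M t x.
Proof.
apply: Rmult_lt_0_compat; first exact: exp_pos.
by apply: pow_lt; have := dot_ge0 x; lra.
Qed.

Lemma dgrowth_norm (I : finType) kap M t (x : vec I) :
  vnorm (dgrowth kap M t x) = exp (- kap * t) * (INR M.+2 * (1 + dot x x) ^ M.+1 * 2) * vnorm x.
Proof.
set c := exp _ * _.
have -> : dgrowth kap M t x = vscale c x.
  by apply: vec_ext => i; rewrite /dgrowth /vscale /c; ring.
rewrite vnormZ Rabs_pos_eq //; apply: Rmult_le_pos; first exact: Rlt_le (exp_pos _).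
apply: Rmult_le_pos; last by lra.
apply: Rmult_le_pos; first exact: pos_INR.
by apply: pow_le; have := dot_ge0 x; lra.
Qed.

Definition hgrowth (I : finType) (kap : R) (M : nat) (t : R) (x : vec I) : R :=
  exp (- kap * t) * INR M.+2 * ((4 * INR M.+1 + 2) * (1 + dot x x) ^ M.+1).

Lemma hgrowth_ge0 (I : finType) kap M t (x : vec I) : 0 <= hgrowth kap M t x.
Proof.
have := pos_INR M.+1; have := pos_INR M.+2; have := exp_pos (- kap * t) => h1 h2 h3.
have : 0 <= (1 + dot x x) ^ M.+1 by apply: pow_le; have := dot_ge0 x; lra.
by move=> h4; apply: Rmult_le_pos; apply: Rmult_le_pos; lra.
Qed.

Lemma d2growth_entry (I : finType) kap M t (x : vec I) i j :
  Rabs (d2growth kap M t x i j) <= hgrowth kap M t x.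
Proof.
have e0 := exp_pos (- kap * t); have n2 := pos_INR M.+2; have n1 := pos_INR M.+1.
have q0 := dot_ge0 x.
rewrite /d2growth /hgrowth Rabs_mult Rabs_pos_eq; last by apply: Rmult_le_pos; lra.
apply: Rmult_le_compat_l; first by apply: Rmult_le_pos; lra.
have p0 : 0 <= (1 + dot x x) ^ M by apply: pow_le; lra.
have xij : Rabs (x j * x i) <= dot x x.
  rewrite Rabs_mult -vnorm_sq.
  by apply: Rmult_le_compat; try exact: Rabs_pos; exact: vnorm_coord.
rewrite -tech_pow_Rmult; set P := (1 + dot x x) ^ M in p0 *.
have mm : 0 <= mid i j <= 1 by rewrite /mid; case: (_ == _); lra.
have h1 : Rabs (INR M.+1 * P * (2 * x j) * (2 * x i)) <= 4 * INR M.+1 * ((1 + dot x x) * P).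
  have -> : INR M.+1 * P * (2 * x j) * (2 * x i) = (4 * INR M.+1 * P) * (x j * x i) by ring.
  have c0 : 0 <= 4 * INR M.+1 * P by apply: Rmult_le_pos; lra.
  rewrite Rabs_mult (Rabs_pos_eq (4 * _ * _)) //.
  have := Rmult_le_compat_l _ _ _ c0 xij; lra.
have h2 : 0 <= (1 + dot x x) * P by apply: Rmult_le_pos; lra.
have h3 : Rabs ((1 + dot x x) * P * (2 * mid i j)) <= 2 * ((1 + dot x x) * P).
  by rewrite Rabs_pos_eq; nra.
apply: Rle_trans (Rabs_triang _ _) _; lra.
Qed.

Definition growth_const (c : R) (M : nat) : R :=
  4 * INR M.+2 + c * (3 * INR M.+2 * (4 * INR M.+1 + 2)).

(** The weights [1 + |x|] and [1 + |x|^2] of Assumption E match the degrees lost by differentiating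
    a power of [1 + |y|^2] once and twice. Hence the cost of the barrier is a multiple of the
    barrier. *)
Lemma growth_control (I : finType) kap M t c (x y : vec I) : 0 <= c -> vnorm (vsub x y) <= 1 ->
  (1 + vnorm x) * vnorm (dgrowth kap M t y) + (1 + vnorm x ^ 2) * (c * hgrowth kap M t y)
    <= growth_const c M * growth kap M t y.
Proof.
move=> c0 xy; have hx : vnorm x <= vnorm y + 1.
  have := vnormD (vsub x y) y.
  by have -> : vadd (vsub x y) y = x by [vec_ring]; lra.
have x0 := vnorm_ge0 x; have y0 := vnorm_ge0 y.
have e0 := exp_pos (- kap * t); have n2 := pos_INR M.+2; have n1 := pos_INR M.+1.
have q : dot y y = vnorm y * vnorm y by rewrite vnorm_sq.
rewrite dgrowth_norm /growth /hgrowth /growth_const -(tech_pow_Rmult _ M.+1).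
have p0 : 0 <= (1 + dot y y) ^ M.+1 by apply: pow_le; nra.
set P := (1 + dot y y) ^ M.+1 in p0 *; set E := exp _ in e0 *.
have B0 : 0 <= E * INR M.+2 * P by apply: Rmult_le_pos; nra.
have sq : 0 <= (vnorm y - 1) * (vnorm y - 1) by exact: Rle_0_sqr.
have xy' : vnorm x * vnorm y <= (vnorm y + 1) * vnorm y by apply: Rmult_le_compat_r.
have xx : vnorm x * vnorm x <= (vnorm y + 1) * (vnorm y + 1) by apply: Rmult_le_compat.
have yy : 0 <= vnorm y * vnorm y by exact: Rle_0_sqr.
have h1 : (1 + vnorm x) * vnorm y <= 2 * (1 + dot y y) by lra.
have h2 : 1 + vnorm x ^ 2 <= 3 * (1 + dot y y) by rewrite /= Rmult_1_r; lra.
have k0 : 0 <= c * (4 * INR M.+1 + 2) by apply: Rmult_le_pos; lra.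
have k1 := Rmult_le_compat_l _ _ _ B0 h1.
have k2 := Rmult_le_compat_l _ _ _ (Rmult_le_pos _ _ B0 k0) h2.
lra.
Qed.

Lemma growth_le (I : finType) kap M t (x : vec I) : 0 <= kap -> 0 <= t ->
  growth kap M t x <= (1 + dot x x) ^ M.+2.
Proof.
move=> k0 t0; rewrite /growth -[X in _ <= X]Rmult_1_l; apply: Rmult_le_compat_r.
  by apply: pow_le; have := dot_ge0 x; lra.
rewrite -exp_0; case: (Req_dec (kap * t) 0) => [e|ne].
  by right; congr exp; lra.
by left; apply: exp_increasing; nra.
Qed.

Lemma mnorm_entry_le (I : finType) (A : mx I) a : 0 <= a -> (forall i j, Rabs (A i j) <= a) ->
  mnorm A <= (INR #|{: I * I}| + 1) * a.
Proof.
move=> a0 Aa; have -> : mnorm A = vnorm (fun p : I * I => A p.1 p.2).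
  by rewrite /mnorm rsum_pair.
by apply: vnorm_coord_le => // -[i j].
Qed.

Lemma quad_sq (I : finType) (A : mx I) u : msym A -> quad (mmul A A) u = sqn (mvec A u).
Proof.
move=> As; rewrite quadE.
have e (v w : vec I) : dot v (mvec A w) = dot (mvec A v) w.
  by rewrite dotC -!bil_mvec // bilC.
rewrite -e; apply: rsum_ext => i; congr (_ * _).
rewrite /mvec /mmul; transitivity (rsum (fun j => rsum (fun k => A i k * A k j * u j))).
  by apply: rsum_ext => j; rewrite Rmult_comm -rsumZ; apply: rsum_ext => k; ring.
by rewrite rsum_exch; apply: rsum_ext => k; rewrite -rsumZ; apply: rsum_ext => j; ring.
Qed.

(** * Assumption E and touching paraboloids *)

Definition structure_bound (I : finType) (O : vec I -> Prop) (H : vec I -> vec I -> mx I -> R)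
  (al : R) : Prop :=
  forall x y, oclosure O x -> oclosure O y -> vnorm (vsub x y) <= 1 ->
  forall (p q : vec I) (Q : mx (I + I)%type), msym Q -> forall n : nat, (1 <= n)%N ->
  forall X Y : mx I, msym X -> msym Y -> mle (bdiag X Y) (An n Q) ->
  H y q Y - H x p X <=
      al * (vnorm (vsub x y) * (1 + vnorm q + INR n ^ 2 * vnorm (vsub x y))
                + (1 + vnorm x) * vnorm (vsub p q)
                + (1 + vnorm x ^ 2) * mnorm Q).

(* Constant families suffice, since the square of a symmetric matrix is nonnegative. *)
Lemma AssumptionE_const (I : finType) (O : vec I -> Prop) H : AssumptionE O H ->
  exists alpha, 0 < alpha /\ structure_bound O H alpha.
Proof.
move=> [al [al0 hE]]; exists al; split=> // x y Ox Oy xy p q Q Qs n n1 X Y Xs Ys XY.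
apply: Rnot_lt_le => hlt; set B := al * _ in hlt.
have Js : msym (@Jmat I) by move=> [i|i] [j|j] /=; rewrite /mid eq_sym.
have As : msym (An n Q) by move=> i j; rewrite /An /madd /mscale Js Qs.
have fam : forall eta, 0 < eta -> msym ((fun _ => X) eta) /\ msym ((fun _ => Y) eta) /\
    mle (bdiag ((fun _ => X) eta) ((fun _ => Y) eta))
      (madd (An n Q) (mscale eta (mmul (An n Q) (An n Q)))).
  move=> eta eta0; split=> //; split=> // xi; rewrite quad_madd quad_mscale quad_sq //.
  by have := XY xi; have := dot_ge0 (mvec (An n Q) xi); nra.
have e0 : 0 < (H y q Y - H x p X - B) / 2 by lra.
have [eta [_ heta]] := hE x y Ox Oy xy p q Q Qs n n1 (fun _ => X) (fun _ => Y) fam _ e0 1 Rlt_0_1.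
by move: heta; rewrite -/B; lra.
Qed.

Lemma vnorm_stpt_le (I : finType) s (y : vec I) z :
  vnorm (vsub (stpt s y) z) <= Rabs (s - sttime z) + vnorm (vsub y (stspace z)).
Proof.
have h1 := Rabs_pos (s - sttime z); have h2 := vnorm_ge0 (vsub y (stspace z)).
apply: Rle_sqr; first by lra.
rewrite vnorm_sq dot_split.
have -> : sqn (vleft (vsub (stpt s y) z)) = (s - sttime z) * (s - sttime z).
  by rewrite /dot rsum_unit.
have -> : sqn (vright (vsub (stpt s y) z))
  = vnorm (vsub y (stspace z)) * vnorm (vsub y (stspace z)) by rewrite vnorm_sq.
have : Rabs (s - sttime z) * Rabs (s - sttime z) = (s - sttime z) * (s - sttime z).
  by rewrite -Rabs_mult Rabs_pos_eq //; exact: Rle_0_sqr.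
by nra.
Qed.

Lemma test_fun_at (I : finType) b kap M p (A : mx (st I)) z :
  test_fun b kap M p A z (sttime z) (stspace z) = b * growth kap M (sttime z) (stspace z).
Proof.
rewrite /test_fun stpt_split (_ : vsub z z = fun _ => 0).
  by rewrite dot_vec0 quad_vec0; field.
by apply: vec_ext => a; rewrite /vsub; ring.
Qed.

Lemma mvec_self (I : finType) (A : mx (st I)) z a :
  mvec A (vsub (stpt (sttime z) (stspace z)) z) a = 0.
Proof. by rewrite stpt_split /mvec rsum0 // => c; rewrite /vsub; ring. Qed.

Definition stdomain (I : finType) (O : vec I -> Prop) (T : R) (z : vec (st I)) : Prop :=
  0 <= sttime z <= T /\ oclosure O (stspace z).

Lemma oclosure_sub (I : finType) (O : vec I -> Prop) x : O x -> oclosure O x.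
Proof.
move=> Ox r r0; exists x; split=> //.
rewrite (_ : vsub x x = fun _ => 0) ?vnorm_vec0 //.
by apply: vec_ext => a; rewrite /vsub; ring.
Qed.

(** A touching paraboloid plus the barrier is a test function. The radius is halved because a
    space-time distance is at most the sum of its time and space parts. *)
Lemma sub_touch (I : finType) (O : vec I -> Prop) T rho H w b kap M z p A :
  visc_sub rho H (fun t x => 0 <= t < T /\ oclosure O x) w ->
  stdomain O T z -> sttime z < T -> msym A ->
  touches_above (stdomain O T)
    (fun z => w (sttime z) (stspace z) - b * growth kap M (sttime z) (stspace z)) z p A ->
  rho * w (sttime z) (stspace z)
   - (b * (- kap * growth kap M (sttime z) (stspace z)) + p (inl tt))
   + H (stspace z) (fun i => b * dgrowth kap M (sttime z) (stspace z) i + p (inr i))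
       (fun i j => b * d2growth kap M (sttime z) (stspace z) i j + A (inr i) (inr j)) <= 0.
Proof.
move=> vs [zt zO] zT As [r [r0 hr]].
have := vs (sttime z) (stspace z) (conj (conj (proj1 zt) zT) zO) _ _ _ _
   (test_fun_C12 b kap M p z As).
rewrite mvec_self Rplus_0_r.
rewrite (_ : (fun i => b * dgrowth kap M (sttime z) (stspace z) i + (p (inr i)
     + mvec A (vsub (stpt (sttime z) (stspace z)) z) (inr i)))
   = (fun i => b * dgrowth kap M (sttime z) (stspace z) i + p (inr i))); last first.
  by apply: vec_ext => i; rewrite mvec_self Rplus_0_r.
apply; exists (r / 2); split; first by lra.
move=> s y [st yO] hs hy; rewrite test_fun_at.
have Sy : stdomain O T (stpt s y) by split=> //; rewrite /sttime /=; lra.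
have := hr _ Sy; have := vnorm_stpt_le s y z.
rewrite /test_fun -[sttime (stpt s y)]/s -[stspace (stpt s y)]/(y : vec I) => h1 h2.
have h3 : vnorm (vsub (stpt s y) z) < r by lra.
by have := h2 h3; lra.
Qed.

(** Touching [- w] from above is touching [w] from below, so barrier, slope and Hessian all enter
    with the opposite sign. *)
Lemma super_touch (I : finType) (O : vec I -> Prop) T rho H w b kap M z p A :
  visc_super rho H (fun t x => 0 <= t < T /\ O x) w ->
  stdomain O T z -> sttime z < T -> O (stspace z) -> msym A ->
  touches_above (stdomain O T)
    (fun z => - w (sttime z) (stspace z) - b * growth kap M (sttime z) (stspace z)) z p A ->
  rho * w (sttime z) (stspace z)
   + (b * (- kap * growth kap M (sttime z) (stspace z)) + p (inl tt))
   + H (stspace z) (fun i => - (b * dgrowth kap M (sttime z) (stspace z) i + p (inr i)))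
       (fun i j => - (b * d2growth kap M (sttime z) (stspace z) i j + A (inr i) (inr j))) >= 0.
Proof.
move=> vs [zt zO] zT Oz As [r [r0 hr]].
have Ns : msym (mscale (-1) A) by move=> i j; rewrite /mscale As.
have := vs (sttime z) (stspace z) (conj (conj (proj1 zt) zT) Oz) _ _ _ _
   (test_fun_C12 (- b) kap M (vscale (-1) p) z Ns).
rewrite mvec_self Rplus_0_r.
rewrite (_ : (fun i => - b * dgrowth kap M (sttime z) (stspace z) i + (vscale (-1) p (inr i)
     + mvec (mscale (-1) A) (vsub (stpt (sttime z) (stspace z)) z) (inr i)))
   = (fun i => - (b * dgrowth kap M (sttime z) (stspace z) i + p (inr i)))); last first.
  by apply: vec_ext => i; rewrite mvec_self /vscale; ring.
rewrite (_ : (fun i j => - b * d2growth kap M (sttime z) (stspace z) i j + mscale (-1) A (inr i) (inr j))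
   = (fun i j => - (b * d2growth kap M (sttime z) (stspace z) i j + A (inr i) (inr j)))); last first.
  by apply: functional_extensionality => i; apply: functional_extensionality => j; rewrite /mscale; ring.
have -> : - b * (- kap * growth kap M (sttime z) (stspace z)) + vscale (-1) p (inl tt)
  = - (b * (- kap * growth kap M (sttime z) (stspace z)) + p (inl tt)) by rewrite /vscale; ring.
move=> hh; suff lm : locmin_rel (fun t x => 0 <= t < T /\ O x)
   (fun s y => w s y - test_fun (- b) kap M (vscale (-1) p) (mscale (-1) A) z s y)
   (sttime z) (stspace z) by have := hh lm; lra.
exists (r / 2); split; first by lra.
move=> s y [st yO] hs hy; rewrite test_fun_at.
have Sy : stdomain O T (stpt s y).
  by split; [rewrite /sttime /=; lra|exact: oclosure_sub].
have := hr _ Sy; have := vnorm_stpt_le s y z.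
rewrite /test_fun dotZl quad_mscale -[sttime (stpt s y)]/s -[stspace (stpt s y)]/(y : vec I) => h1 h2.
have h3 : vnorm (vsub (stpt s y) z) < r by lra.
by have := h2 h3; lra.
Qed.

(** * Doubling of variables *)

(** If no [c] and [r] worked, there would be failures with [|v| <= eps / (n + 1)] and
    [eps < 1 / (n + 1)] for every [n], and a single small perturbation could pass through them
    all. *)
Lemma small_o_uniform (I : finType) (P : R -> vec I -> Prop) :
  (forall psi : R -> vec I, small_o psi -> exists r, 0 < r /\ forall eps, 0 < eps < r -> P eps (psi eps)) ->
  exists c r, 0 < c /\ 0 < r /\ forall eps v, 0 < eps < r -> vnorm v <= c * eps -> P eps v.
Proof.
move=> hP; apply: NNPP => hn.
have H (n : nat) : exists ev : R * vec I, 0 < ev.1 < / INR n.+1 /\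
    vnorm ev.2 <= / INR n.+1 * ev.1 /\ ~ P ev.1 ev.2.
  apply: NNPP => hh; apply: hn; have i0 : 0 < / INR n.+1.
    by apply: Rinv_0_lt_compat; apply: lt_0_INR; lia.
  exists (/ INR n.+1), (/ INR n.+1); split=> //; split=> // eps v e1 e2.
  by apply: NNPP => nP; apply: hh; exists (eps, v).
have [ev evP] := choice_fun H.
(* Several failures may share the same [eps]; [psi] selects one of them, and is 0 elsewhere. *)
have /choice_fun [psi psiP] : forall eps : R, exists v : vec I,
    (exists n, (ev n).1 = eps /\ v = (ev n).2) \/ ((forall n, (ev n).1 <> eps) /\ v = (fun _ => 0)).
  move=> eps; case: (classic (exists n, (ev n).1 = eps)) => [[n hn']|hno].
    by exists (ev n).2; left; exists n.
  by exists (fun _ => 0); right; split=> // n hn'; apply: hno; exists n.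
have so : small_o psi.
  move=> c c0; have [N hN] := inv_small c0.
  (* [d] is below the first [N] values of [eps], so a smaller [eps] belongs to a late failure, whose
     [v] is relatively small. *)
  have [d [d0 hd]] : exists d, 0 < d /\ forall n, (n < N)%N -> d <= (ev n).1.
    elim: (N) => [|k [d [d0 hd]]]; first by exists 1; split; [lra|].
    exists (Rmin d (ev k).1); split; first by apply: Rmin_glb_lt => //; case: (evP k) => [[]].
    move=> n; rewrite ltnS leq_eqVlt => /orP [/eqP ->|nk]; first exact: Rmin_r.
    by apply: Rle_trans (hd n nk); exact: Rmin_l.
  exists d; split=> // eps [e0 ed]; case: (psiP eps) => [[n [en ->]]|[_ ->]]; last first.
    by rewrite vnorm_vec0; nra.
  have [_ [h _]] := evP n; rewrite en in h; apply: Rle_trans h _; apply: Rmult_le_compat_r; first by lra.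
  case: (ltnP n N) => nN; first by have := hd n nN; rewrite en; lra.
  by apply: Rlt_le; exact: hN.
have [r [r0 hr]] := hP psi so.
have [N hN] := inv_small r0.
have [h1 [h2 h3]] := evP N.
have e1 : 0 < (ev N).1 < r by have := hN N (leqnn N); lra.
have := hr _ e1; case: (psiP (ev N).1) => [[n [en ->]]|[hno _]]; last by have := hno N.
by move=> h; have [_ [_ []]] := evP n; rewrite en.
Qed.

(* Interior points satisfy the boundary condition with zero shift, so the two cases merge. *)
Lemma boundary_shift (I : finType) (O : vec I -> Prop) T w t x :
  isopen O -> classR O T w -> 0 <= t < T -> oclosure O x ->
  exists (l : R -> vec I) (lam : R -> R) rB c M0 r,
    [/\ 0 < rB, 0 < c, 0 < M0 & 0 < r] /\
    (forall d, 0 < d -> exists eps, 0 < eps < d /\ vnorm (l eps) <= M0 * eps) /\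
    (forall y eps v, oclosure O y -> vnorm (vsub y x) < rB -> 0 < eps < r -> vnorm v <= c * eps ->
       O (vadd (vadd y (l eps)) v)) /\
    (forall eps, 0 < eps -> 0 <= lam eps) /\ lim0 lam 0 /\
    lim0 (fun eps => w (t + lam eps) (vadd x (l eps))) (w t x).
Proof.
move=> Oo cR tT Ox; case: (classic (O x)) => [xO|xnO].
  have [r0 [r00 hr]] := Oo x xO.
  exists (fun _ _ => 0), (fun _ => 0), (r0 / 2), 1, 1, (r0 / 2).
  split; first by split; lra.
  split.
    move=> d d0; exists (d / 2); split; first by lra.
    by rewrite vnorm_vec0; lra.
  split.
    move=> y eps v _ yx er vr; apply: hr.
    have -> : vsub (vadd (vadd y (fun _ => 0)) v) x = vadd (vsub y x) v.
      by vec_ring.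
    by have := vnormD (vsub y x) v; lra.
  split; first by move=> *; lra.
  split=> e e0; exists 1; split; try lra; move=> eps _.
    by rewrite Rminus_diag Rabs_R0.
  by rewrite Rplus_0_r vadd0 Rminus_diag Rabs_R0.
have [B [l [Bo [Bx [[M hM] [hpsi [lam [lam0 [lam1 lam2]]]]]]]]] := cR t x tT Ox xnO.
have [rB [rB0 hB]] := Bo x Bx.
have hP psi : small_o psi -> exists r, 0 < r /\ forall eps, 0 < eps < r ->
    forall y, oclosure O y -> B y -> O (vadd (vadd y (l eps)) (psi eps)).
  by move=> /hpsi [r [r0 hr]]; exists r; split=> // eps er y Oy By; exact: hr.
have [c [r [c0 [r0 hcr]]]] := @small_o_uniform I
  (fun eps v => forall y, oclosure O y -> B y -> O (vadd (vadd y (l eps)) v)) hP.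
exists l, lam, rB, c, (Rmax M 1), r.
split.
  by split=> //; apply: Rlt_le_trans (Rmax_r _ _); lra.
split.
  move=> d d0; have [eps [e0 he]] := hM d d0; exists eps; split=> //.
  have : / eps * vnorm (l eps) * eps <= Rmax M 1 * eps.
    by apply: Rmult_le_compat_r; [lra|have := Rmax_l M 1; lra].
  by have -> : / eps * vnorm (l eps) * eps = vnorm (l eps) by field; lra.
split; last by split.
by move=> y eps v Oy yx er vr; apply: hcr => //; exact: hB.
Qed.

Definition coercive (I : finType) (S : vec I -> Prop) (f : vec I -> R) : Prop :=
  (exists B, forall z, S z -> f z <= B) /\
  forall L, exists B, forall z, S z -> L <= f z -> vnorm z <= B.

(** Stated for [s = 1 + |x|^2 >= 1]: the difference is [s^m (C - b s^2)], which is positive only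
    while [s <= C / b]. *)
Lemma growth_coercive C b m : 0 <= C -> 0 < b ->
  (exists B, forall s, 1 <= s -> C * s ^ m - b * s ^ m.+2 <= B) /\
  forall L, exists B, forall s, 1 <= s -> L <= C * s ^ m - b * s ^ m.+2 -> s <= B.
Proof.
move=> C0 b0.
have E s : C * s ^ m - b * s ^ m.+2 = s ^ m * (C - b * (s * s)) by rewrite /=; ring.
have Cb : 0 <= C / b by apply: Rmult_le_pos => //; apply: Rlt_le; exact: Rinv_0_lt_compat.
split.
  have p0 : 0 <= C * (C / b) ^ m by apply: Rmult_le_pos => //; exact: pow_le.
  exists (C * (C / b) ^ m) => s s1.
  have sm : 0 < s ^ m by apply: pow_lt; lra.
  case: (Rle_dec C (b * (s * s))) => h.
    by rewrite E; apply: Rle_trans p0; nra.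
  have sC : s <= C / b.
    have : b * s <= C by nra.
    move=> h1; apply: (Rmult_le_reg_l b) => //.
    by have -> : b * (C / b) = C by field; lra.
  have := pow_incr s (C / b) m (conj (ltac:(lra) : 0 <= s) sC).
  have : 0 <= b * s ^ m.+2 by apply: Rmult_le_pos; [lra|apply: pow_le; lra].
  by nra.
move=> L; pose A := (C + Rabs L + 1) / b.
exists A => s s1 hs; apply: Rnot_lt_le => hlt.
have L0 := Rabs_pos L.
have bA : b * A = C + Rabs L + 1 by rewrite /A; field; lra.
have h1 : b * A < b * (s * s) by apply: Rmult_lt_compat_l => //; nra.
have sm : 1 <= s ^ m by apply: pow_R1_Rle.
rewrite E in hs; have h2 : C - b * (s * s) < - (Rabs L + 1) by lra.
have h3 : s ^ m * (C - b * (s * s)) <= 1 * (C - b * (s * s)).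
  by move: h2 sm; move: (C - b * (s * s)) (s ^ m) => X Y *; nra.
by split_Rabs; lra.
Qed.

Lemma cluster_close (I : finType) (z : nat -> vec I) (zeta : nat -> vec I) c phi :
  (forall n, (n <= phi n)%N) ->
  (forall e, 0 < e -> exists N : nat, forall n, (N <= n)%N -> vnorm (vsub (z (phi n)) c) < e) ->
  (forall n, vnorm (vsub (z n) (zeta n)) < / INR n.+1) ->
  forall e, 0 < e -> exists N : nat, forall n, (N <= n)%N -> vnorm (vsub (zeta (phi n)) c) < e.
Proof.
move=> ph hz hd e e0; have e2 : 0 < e / 2 by lra.
have [N1 h1] := hz _ e2; have [N2 h2] := inv_small e2.
exists (maxn N1 N2) => n; rewrite geq_max => /andP [n1 n2].
have := vnorm_tri (zeta (phi n)) (z (phi n)) c; rewrite (vsubC (zeta (phi n)) (z (phi n))).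
by have := h1 n n1; have := hd (phi n); have := h2 _ (leq_trans n2 (ph n)); lra.
Qed.

(** The usual compactness argument of doubling: nearly diagonal, nearly maximal pairs cluster at a
    maximum of [f + g], and the quadratic gap leaves only [z0]. Upper semicontinuity bounds the
    value from above. *)
Lemma penalty (I : finType) (S : vec I -> Prop) (f g : vec I -> R) z0 th :
  vclosed S -> vusc S f -> vusc S g -> coercive S f -> coercive S g -> S z0 -> 0 < th ->
  (forall z, S z -> f z + g z <= f z0 + g z0 - th * sqn (vsub z z0)) ->
  forall tau, 0 < tau -> exists d, 0 < d /\ forall z zeta, S z -> S zeta ->
    vnorm (vsub z zeta) < d -> f z0 + g z0 - d <= f z + g zeta ->
    [/\ vnorm (vsub z z0) < tau, vnorm (vsub zeta z0) < tau & f z + g zeta < f z0 + g z0 + tau].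
Proof.
move=> Sc fu gu [_ fc] [[Bg hBg] _] Sz0 th0 hmax tau tau0; apply: NNPP => hn.
have H (n : nat) : exists zz : vec I * vec I, [/\ S zz.1, S zz.2,
    vnorm (vsub zz.1 zz.2) < / INR n.+1, f z0 + g z0 - / INR n.+1 <= f zz.1 + g zz.2 &
    ~ [/\ vnorm (vsub zz.1 z0) < tau, vnorm (vsub zz.2 z0) < tau & f zz.1 + g zz.2 < f z0 + g z0 + tau]].
  apply: NNPP => hh; apply: hn; exists (/ INR n.+1); split.
    by apply: Rinv_0_lt_compat; apply: lt_0_INR; lia.
  by move=> z zeta Sz Szeta h1 h2; apply: NNPP => h3; apply: hh; exists (z, zeta).
have [zz zzP] := choice_fun H.
have [B hB] := fc (f z0 + g z0 - 1 - Bg).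
have zB n : vnorm (zz n).1 <= B.
  have [S1 S2 _ h _] := zzP n; apply: hB => //; have := hBg _ S2.
  have : / INR n.+1 <= 1.
    rewrite -[X in _ <= X]Rinv_1; apply: Rinv_le_contravar; first by lra.
    by rewrite S_INR; have := pos_INR n; lra.
  by lra.
have [phi [c [ph pc]]] := bounded_subseq zB.
have zd n : vnorm (vsub (zz n).1 (zz n).2) < / INR n.+1 by case: (zzP n).
have pc2 := @cluster_close I (fun n => (zz n).1) (fun n => (zz n).2) c phi ph pc zd.
have Sc' : S c.
  apply: Sc => r r0; have [N hN] := pc r r0.
  by exists (zz (phi N)).1; split; [case: (zzP (phi N))|exact: hN].
have lim e : 0 < e -> exists N : nat, forall n, (N <= n)%N ->
   [/\ vnorm (vsub (zz (phi n)).1 c) < e, vnorm (vsub (zz (phi n)).2 c) < e,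
     f (zz (phi n)).1 + g (zz (phi n)).2 < f c + g c + e & / INR (phi n).+1 < e].
  move=> e0; have e2 : 0 < e / 2 by lra.
  have [d1 [d10 h1]] := fu c Sc' _ e2; have [d2 [d20 h2]] := gu c Sc' _ e2.
  have [N1 k1] := pc _ d10; have [N2 k2] := pc2 _ d20.
  have [N3 k3] := pc _ e0; have [N4 k4] := pc2 _ e0; have [N5 k5] := inv_small e0.
  exists (maxn N1 (maxn N2 (maxn N3 (maxn N4 N5)))) => n.
  rewrite !geq_max => /and5P [n1 n2 n3 n4 n5]; split; [exact: k3|exact: k4| |].
    have [S1 S2 _ _ _] := zzP (phi n).
    by have := h1 _ S1 (k1 n n1); have := h2 _ S2 (k2 n n2); lra.
  by apply: k5; exact: leq_trans n5 (ph n).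
have cz : sqn (vsub c z0) <= 0.
  apply: Rnot_lt_le => hlt.
  pose e := th * sqn (vsub c z0) / 2.
  have e0 : 0 < e by rewrite /e; nra.
  have [N hN] := lim e e0; have [_ _ h3 h4] := hN N (leqnn N).
  have [_ _ _ h5 _] := zzP (phi N); have := hmax c Sc'; rewrite /e in h3 h4; lra.
have cE : c = z0.
  apply: vec_ext => i; have v0 : vnorm (vsub c z0) = 0.
    by rewrite vnorm_dot (_ : dot _ _ = 0) ?sqrt_0 //; have := dot_ge0 (vsub c z0); lra.
  by have := vnorm0P v0 i; rewrite /vsub; lra.
rewrite cE in lim; have [N hN] := lim tau tau0; have [h1 h2 h3 _] := hN N (leqnn N).
by have [_ _ _ _ []] := zzP (phi N).
Qed.

Lemma vclosed_pair (I J : finType) (S : vec I -> Prop) (S' : vec J -> Prop) :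
  vclosed S -> vclosed S' -> vclosed (fun Z : vec (I + J)%type => S (vleft Z) /\ S' (vright Z)).
Proof.
move=> Sc S'c Z hZ; split; [apply: Sc|apply: S'c] => r r0; have [Y [[Y1 Y2] hY]] := hZ r r0.
  by exists (vleft Y); split=> //; apply: Rle_lt_trans hY; exact: (vleft_norm (vsub Y Z)).
by exists (vright Y); split=> //; apply: Rle_lt_trans hY; exact: (vright_norm (vsub Y Z)).
Qed.

Definition Jquad (I : finType) (N : R) : mx (I + I)%type := mscale (N * N) (@Jmat I).

Lemma Jmat_sym (I : finType) : msym (@Jmat I).
Proof. by move=> [i|i] [j|j] /=; rewrite /mid eq_sym. Qed.

Lemma quad_Jmat (I : finType) (u v : vec I) :
  quad (@Jmat I) (vcat u v) = sqn (vsub u v).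
Proof.
have dl (w : vec I) i : rsum (fun j => mid i j * w j) = w i.
  rewrite -(rsum_delta w i); apply: rsum_ext => j; rewrite /mid eq_sym.
  by case: (j == i); ring.
rewrite quadE /dot rsum_sum -rsumD; apply: rsum_ext => i.
have -> : rsum (fun j => @Jmat I (inl i) j * vcat u v j) = u i - v i.
  rewrite rsum_sum /= dl; rewrite (_ : rsum _ = - v i) //.
  by rewrite -(dl v i) -rsumN; apply: rsum_ext => j; ring.
have -> : rsum (fun j => @Jmat I (inr i) j * vcat u v j) = v i - u i.
  rewrite rsum_sum /= dl; rewrite (_ : rsum _ = - u i); first by ring.
  by rewrite -(dl u i) -rsumN; apply: rsum_ext => j; ring.
by rewrite /vcat /vsub; ring.
Qed.

(** Coercivity bounds each variable on the set where the value exceeds that of a reference pair, so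
    the maximum over a product of balls is global. *)
Lemma doubling_max (I : finType) (S : vec I -> Prop) (f g : vec I -> R) z0 zeta0 v N :
  vclosed S -> vusc S f -> vusc S g -> coercive S f -> coercive S g -> S z0 -> S zeta0 ->
  let pen z zeta := N * N / 2 * sqn (vsub (vsub zeta z) v) in
  exists z zeta, [/\ S z, S zeta & forall y eta, S y -> S eta ->
    f y + g eta - pen y eta <= f z + g zeta - pen z zeta].
Proof.
move=> Sc fu gu [[Bf hBf] fc] [[Bg hBg] gc] Sz0 Szeta0 pen.
have pen0 y eta : 0 <= pen y eta.
  by apply: Rmult_le_pos; [nra|exact: dot_ge0].
pose ref := f z0 + g zeta0 - pen z0 zeta0.
have [B1 hB1] := fc (ref - Bg); have [B2 hB2] := gc (ref - Bf).
pose K (Z : vec (I + I)%type) := (S (vleft Z) /\ S (vright Z)) /\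
   ref <= f (vleft Z) + g (vright Z) - pen (vleft Z) (vright Z).
pose K' (Z : vec (I + I)%type) := (S (vleft Z) /\ S (vright Z)) /\
   (vnorm (vleft Z) <= B1 /\ vnorm (vright Z) <= B2).
have KK Z : K Z -> K' Z.
  move=> [[S1 S2] h]; split=> //; have := pen0 (vleft Z) (vright Z) => p0.
  by split; [apply: hB1 => //; have := hBg _ S2|apply: hB2 => //; have := hBf _ S1]; lra.
have K0 : K (vcat z0 zeta0) by split=> //; rewrite vleft_vcat vright_vcat /ref; lra.
have K'B Z : K' Z -> vnorm Z <= B1 + B2.
  move=> [_ [h1 h2]]; have n1 := vnorm_ge0 (vleft Z); have n2 := vnorm_ge0 (vright Z).
  apply: Rle_sqr; first by lra.
  by rewrite vnorm_sq dot_split -!vnorm_sq; nra.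
have ballc (J : finType) B : vclosed (fun z : vec J => vnorm z <= B).
  move=> z hz; apply: Rnot_lt_le => hlt; have d0 : 0 < vnorm z - B by lra.
  have [y [yB hy]] := hz _ d0; have := vnormD y (vsub z y); rewrite vsubC in hy.
  have -> : vadd y (vsub z y) = z by vec_ring.
  by lra.
have K'c : vclosed K'.
  move=> Z hZ; have c1 := vclosed_pair Sc Sc; have c2 := vclosed_pair (ballc I B1) (ballc I B2).
  by split; [apply: c1|apply: c2] => r r0; have [Y [[Y1 Y2] hY]] := hZ r r0; exists Y.
pose A := @Jquad I N.
have As : msym A by move=> i j; rewrite /A /Jquad /mscale Jmat_sym.
pose Zv := vcat v (fun _ : I => 0).
have penE Z : pen (vleft Z) (vright Z) = dot (fun _ => 0) (vsub Z (vscale (-1) Zv))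
    + quad A (vsub Z (vscale (-1) Zv)) / 2.
  rewrite dotC dot_vec0 /A /Jquad quad_mscale -(vcat_split (vsub _ _)) quad_Jmat /pen.
  have -> : sqn (vsub (vsub (vright Z) (vleft Z)) v)
    = sqn (vsub (vleft (vsub Z (vscale (-1) Zv))) (vright (vsub Z (vscale (-1) Zv)))).
    by apply: rsum_ext => i; rewrite /vsub /vleft /vright /vscale /Zv /vcat; ring.
  by field.
have fg : vusc K' (fun Z => f (vleft Z) + g (vright Z)).
  move=> Z [[S1 S2] _] e e0; have e2 : 0 < e / 2 by lra.
  have [d1 [d10 h1]] := fu _ S1 _ e2; have [d2 [d20 h2]] := gu _ S2 _ e2.
  exists (Rmin d1 d2); split; first exact: Rmin_glb_lt.
  move=> Y [[Y1 Y2] _] hY.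
  have := h1 _ Y1 (Rle_lt_trans _ _ _ (vleft_norm (vsub Y Z)) (Rlt_le_trans _ _ _ hY (Rmin_l _ _))).
  have := h2 _ Y2 (Rle_lt_trans _ _ _ (vright_norm (vsub Y Z)) (Rlt_le_trans _ _ _ hY (Rmin_r _ _))).
  by lra.
have Ku : vusc K' (fun Z => f (vleft Z) + g (vright Z) - pen (vleft Z) (vright Z)).
  apply: (vusc_sub_cont (S := K') (f := fun Z => f (vleft Z) + g (vright Z))
    (P := fun Z => pen (vleft Z) (vright Z))) => // Z e e0.
  have [d [d0 hd]] := quad_poly_cont (fun _ => 0) (vscale (-1) Zv) Z As e0.
  by exists d; split=> // Y hY; rewrite !penE; exact: hd.
have [Z [K'Z Zmax]] := usc_attain (KK _ K0) K'B K'c Ku.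
exists (vleft Z), (vright Z); have [[S1 S2] _] := K'Z; split=> // y eta Sy Seta.
have ZK0 := Zmax _ (KK _ K0); rewrite !vleft_vcat !vright_vcat -/ref in ZK0.
case: (Rle_dec ref (f y + g eta - pen y eta)) => h; last by lra.
by apply: (Zmax (vcat y eta)); apply: KK; split; rewrite ?vleft_vcat ?vright_vcat.
Qed.

Lemma dot_sqD (I : finType) (u w : vec I) :
  sqn (vadd u w) = dot u u + 2 * dot u w + dot w w.
Proof. by rewrite dotDr !dotDl (dotC w u); ring. Qed.

Lemma vaddK (I : finType) (u v : vec I) : vsub (vadd u v) u = v.
Proof. by vec_ring. Qed.

Lemma vsubK (I : finType) (u v : vec I) : vadd u (vsub v u) = v.
Proof. by vec_ring. Qed.

Lemma vclosed_shift (I : finType) (S : vec I -> Prop) z : vclosed S -> vclosed (fun h => S (vadd z h)).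
Proof.
move=> Sc h hh; apply: Sc => r r0; have [y [Sy hy]] := hh r r0; exists (vadd z y); split=> //.
by have -> : vsub (vadd z y) (vadd z h) = vsub y h by [vec_ring].
Qed.

Lemma vusc_shift (I : finType) (S : vec I -> Prop) f z c l : vusc S f ->
  vusc (fun h => S (vadd z h)) (fun h => f (vadd z h) - (c + dot l h)).
Proof.
move=> fu; apply: (vusc_sub_cont (S := fun h => S (vadd z h)) (f := fun h => f (vadd z h))
   (P := fun h => c + dot l h)) => // [x Sx e e0|x e e0].
  have [d [d0 hd]] := fu _ Sx e e0; exists d; split=> // y Sy hy; apply: hd => //.
  by have -> : vsub (vadd z y) (vadd z x) = vsub y x by [vec_ring].
have l0 := vnorm_ge0 l; exists (e / (vnorm l + 1)); split; first by apply: Rdiv_lt_0_compat; lra.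
move=> y hy; have -> : c + dot l y - (c + dot l x) = dot l (vsub y x) by rewrite dotBr; ring.
apply: Rle_lt_trans (cauchy_schwarz _ _) _.
have : (vnorm l + 1) * vnorm (vsub y x) < (vnorm l + 1) * (e / (vnorm l + 1)).
  by apply: Rmult_lt_compat_l => //; lra.
have -> : (vnorm l + 1) * (e / (vnorm l + 1)) = e by field; lra.
by have := vnorm_ge0 (vsub y x); lra.
Qed.

Lemma touches_shift (I : finType) (S : vec I -> Prop) f z c l h p X :
  touches_above (fun h => S (vadd z h)) (fun h => f (vadd z h) - (c + dot l h)) h p X ->
  touches_above S f (vadd z h) (vadd p l) X.
Proof.
move=> [r [r0 hr]]; exists r; split=> // y Sy hy.
have := hr (vsub y z); rewrite vsubK => /(_ Sy).
have -> : vsub (vsub y z) h = vsub y (vadd z h).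
  by vec_ring.
move=> /(_ hy); rewrite dotDl.
have -> : dot l (vsub y z) = dot l h + dot l (vsub y (vadd z h)).
  by rewrite -dotDr; congr dot; apply: vec_ext => i; rewrite /vsub /vadd; ring.
by lra.
Qed.

(** Subtracting from [f] and [g] the linear parts [l1], [l2] of the penalty at the maximum reduces
    the statement to [sums_at_zero] with matrix [N^2 J]. *)
Lemma doubling_sums (I : finType) (S : vec I -> Prop) f g z zeta v N e :
  vclosed S -> vusc S f -> vusc S g -> S z -> S zeta -> 0 < e ->
  let pen z zeta := N * N / 2 * sqn (vsub (vsub zeta z) v) in
  let d := vsub (vsub zeta z) v in
  (forall y eta, S y -> S eta -> f y + g eta - pen y eta <= f z + g zeta - pen z zeta) ->
  exists z' zeta' p q X Y, [/\ S z', S zeta', vnorm (vsub z' z) < e & vnorm (vsub zeta' zeta) < e] /\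
    [/\ vnorm (vsub p (vscale (- (N * N)) d)) < e, vnorm (vsub q (vscale (N * N) d)) < e,
        msym X, msym Y & f z + g zeta - e < f z' + g zeta'] /\
    [/\ touches_above S f z' p X, touches_above S g zeta' q Y &
      forall u w, quad X u + quad Y w <= N * N * sqn (vsub u w) + e * (dot u u + dot w w)].
Proof.
move=> Sc fu gu Sz Szeta e0 pen d hmax.
pose A := @Jquad I N; have As : msym A by move=> i j; rewrite /A /Jquad /mscale Jmat_sym.
pose l1 := vscale (- (N * N)) d; pose l2 := vscale (N * N) d.
pose f0 h := f (vadd z h) - (f z + dot l1 h); pose g0 k := g (vadd zeta k) - (g zeta + dot l2 k).
have ln : vnorm l1 = N * N * vnorm d by rewrite /l1 vnormZ Rabs_Ropp Rabs_pos_eq //; nra.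
have ln2 : vnorm l2 = N * N * vnorm d by rewrite /l2 vnormZ Rabs_pos_eq //; nra.
have D0 : 0 <= N * N * vnorm d by rewrite -ln; exact: vnorm_ge0.
(* Small enough that the linear parts change the values by less than [e] over the displacements [h]
   and [k]. *)
pose e' := e / (2 + 2 * (N * N * vnorm d)).
have e'0 : 0 < e' by apply: Rdiv_lt_0_compat; lra.
have e'E : e' * (2 + 2 * (N * N * vnorm d)) = e by rewrite /e'; field; lra.
have e'e : e' <= e by nra.
have hfg h k : S (vadd z h) -> S (vadd zeta k) -> f0 h + g0 k <= quad A (vcat h k) / 2.
  move=> Sh Sk; have := hmax _ _ Sh Sk; rewrite /pen.
  have -> : vsub (vsub (vadd zeta k) (vadd z h)) v = vadd d (vsub k h).
    by apply: vec_ext => i; rewrite /d /vsub /vadd; ring.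
  have -> : sqn (vadd d (vsub k h))
    = dot d d + 2 * (dot d k - dot d h) + sqn (vsub k h).
    by rewrite dot_sqD dotBr; ring.
  have -> : sqn (vsub k h) = sqn (vsub h k).
    by apply: rsum_ext => i; rewrite /vsub; ring.
  rewrite /A /Jquad quad_mscale quad_Jmat -/d /f0 /g0 /l1 /l2 !dotZl; lra.
have z0 (w : vec I) : vadd w (fun _ => 0) = w by exact: vadd0.
have S0 : S (vadd z (fun _ => 0)) by rewrite z0.
have S0' : S (vadd zeta (fun _ => 0)) by rewrite z0.
have f00 : f0 (fun _ => 0) = 0 by rewrite /f0 z0 dot_vec0; ring.
have g00 : g0 (fun _ => 0) = 0 by rewrite /g0 z0 dot_vec0; ring.
have [h [k [p [q [X [Y [Sh [Sk [hn [kn [pn [qn [Xs [Ys [val [tx [ty ineq]]]]]]]]]]]]]]]]] :=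
  @sums_at_zero I I (fun h => S (vadd z h)) (fun k => S (vadd zeta k)) f0 g0 A e' As
   S0 S0' f00 g00 (@vclosed_shift I S z Sc)
   (@vusc_shift I S f z (f z) l1 fu) (@vclosed_shift I S zeta Sc)
   (@vusc_shift I S g zeta (g zeta) l2 gu) e'0 hfg.
exists (vadd z h), (vadd zeta k), (vadd p l1), (vadd q l2), X, Y.
split; first by split=> //; rewrite vaddK; lra.
have pl (u w : vec I) : vsub (vadd u w) w = u by vec_ring.
split.
  split=> //; rewrite ?pl; try lra.
  have c1 := cauchy_schwarz l1 h; have c2 := cauchy_schwarz l2 k.
  rewrite ln in c1; rewrite ln2 in c2; rewrite /f0 /g0 in val.
  have m1 : N * N * vnorm d * vnorm h <= N * N * vnorm d * e' by apply: Rmult_le_compat_l; lra.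
  have m2 : N * N * vnorm d * vnorm k <= N * N * vnorm d * e' by apply: Rmult_le_compat_l; lra.
  by split_Rabs; lra.
split; [exact: touches_shift tx|exact: touches_shift ty|move=> u w].
apply: Rle_trans (ineq u w) _; rewrite /A /Jquad quad_mscale quad_Jmat.
apply: Rplus_le_compat_l; apply: Rmult_le_compat_r => //.
by have := dot_ge0 u; have := dot_ge0 w; lra.
Qed.

Lemma quad_bdiag (I : finType) (X Y : mx I) u v :
  quad (bdiag X Y) (vcat u v) = quad X u - quad Y v.
Proof.
rewrite /quad rsum_sum /Rminus -rsumN; congr (_ + _); apply: rsum_ext => i.
  rewrite rsum_sum [X in _ + X]rsum0 ?Rplus_0_r // => j /=; ring.
rewrite rsum_sum [X in X + _]rsum0 ?Rplus_0_l; last by move=> j /=; ring.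
by rewrite -rsumN; apply: rsum_ext => j /=; ring.
Qed.

Lemma quad_stspace (I : finType) (A : mx (st I)) u :
  quad A (stpt 0 u) = quad (fun i j => A (inr i) (inr j)) u.
Proof.
rewrite /quad rsum_sum [X in X + _]rsum0 ?Rplus_0_l; last first.
  by move=> j; rewrite rsum0 // => i; rewrite /stpt /=; ring.
apply: rsum_ext => i; rewrite rsum_sum [X in X + _]rsum0 ?Rplus_0_l //.
by move=> j; rewrite /stpt /=; ring.
Qed.

Lemma dot_stpt0 (I : finType) (u : vec I) : sqn (stpt 0 u) = dot u u.
Proof.
rewrite dot_vcat vleft_vcat vright_vcat (_ : dot (fun _ : unit => 0) _ = 0); first by ring.
exact: dot_vec0.
Qed.

Lemma d2growth_sym (I : finType) kap M t (x : vec I) : msym (d2growth kap M t x).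
Proof. by move=> i j; rewrite /d2growth /mid eq_sym; ring. Qed.

Lemma quad_fun_add (I : finType) b (A B : mx I) u :
  quad (fun i j => b * A i j + B i j) u = b * quad A u + quad B u.
Proof. by rewrite -quad_mscale -quad_madd. Qed.

Lemma quad_fun_opp (I : finType) (A : mx I) u : quad (fun i j => - A i j) u = - quad A u.
Proof.
by rewrite /quad -rsumN; apply: rsum_ext => i; rewrite -rsumN; apply: rsum_ext => j; ring.
Qed.

(** The two viscosity inequalities are subtracted and [structure_bound] is applied. The
    contributions of the barrier to the slopes difference and to [Q] are cancelled by its time
    derivative, by the hypothesis on [kap]; only its gradient at [y] survives, with the factor
    [|x - y|]. *)
Lemma touch_estimate (I : finType) (O : vec I -> Prop) T rho H w1 w2 al b kap M z zeta p q A B n e :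
  let cN := INR #|{: (I + I) * (I + I)}| + 1 in
  let x := stspace z in let y := stspace zeta in
  structure_bound O H al ->
  0 < al -> 0 <= b -> al * growth_const cN M <= kap -> 0 <= e -> (1 <= n)%N ->
  visc_sub rho H (fun t x => 0 <= t < T /\ oclosure O x) w1 ->
  visc_super rho H (fun t x => 0 <= t < T /\ O x) w2 ->
  stdomain O T z -> stdomain O T zeta -> sttime z < T -> sttime zeta < T -> O y ->
  vnorm (vsub x y) <= 1 -> msym A -> msym B ->
  touches_above (stdomain O T)
    (fun z => w1 (sttime z) (stspace z) - b * growth kap M (sttime z) (stspace z)) z p A ->
  touches_above (stdomain O T)
    (fun z => - w2 (sttime z) (stspace z) - b * growth kap M (sttime z) (stspace z)) zeta q B ->
  (forall u w, quad A u + quad B w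
     <= INR n * INR n * sqn (vsub u w) + e * (dot u u + dot w w)) ->
  rho * (w1 (sttime z) x - w2 (sttime zeta) y) <=
    p (inl tt) + q (inl tt) +
    al * (vnorm (vsub x y) * (1 + (b * vnorm (dgrowth kap M (sttime zeta) y) + vnorm (stspace q))
             + INR n ^ 2 * vnorm (vsub x y))
          + (1 + vnorm x) * vnorm (vadd (stspace p) (stspace q)) + (1 + vnorm x ^ 2) * (cN * e)).
Proof.
move=> cN x y hE al0 b0 hkap e0 n1 vs vS Sz Szeta zT zetaT Oy xy As Bs tz tzeta hAB.
have h1 := sub_touch vs Sz zT As tz; have h2 := super_touch vS Szeta zetaT Oy Bs tzeta.
rewrite -/x in h1; rewrite -/y in h2.
set t := sttime z in h1 *; set s := sttime zeta in h2 *.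
set pp := (fun i : I => b * dgrowth kap M t x i + p (inr i)) in h1.
set X := (fun i j : I => b * d2growth kap M t x i j + A (inr i) (inr j)) in h1.
set qq := (fun i : I => - (b * dgrowth kap M s y i + q (inr i))) in h2.
set Y := (fun i j : I => - (b * d2growth kap M s y i j + B (inr i) (inr j))) in h2.
(* Beyond [n^2 J], the matrix inequality has the error [e] and the Hessians of the two barriers;
   [bdiag] negates its second block, hence [- b]. *)
pose Q : mx (I + I)%type := madd (mscale e (@mid (I + I)%type))
   (bdiag (mscale b (d2growth kap M t x)) (mscale (- b) (d2growth kap M s y))).
have cN0 : 0 <= cN by have := pos_INR #|{: (I + I) * (I + I)}|; rewrite /cN; lra.
have Qs : msym Q.
  move=> [i|i] [j|j]; rewrite /Q /madd /mscale /mid /=.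
  - by rewrite (d2growth_sym _ _ _ _ i j) eq_sym.
  - by ring.
  - by ring.
  - by rewrite (d2growth_sym _ _ _ _ i j) eq_sym.
have Xs : msym X by move=> i j; rewrite /X d2growth_sym As.
have Ys : msym Y by move=> i j; rewrite /Y d2growth_sym Bs.
have XY : mle (bdiag X Y) (An n Q).
  move=> xi; rewrite -(vcat_split xi); set u := vleft xi; set v := vright xi.
  rewrite quad_bdiag /An !quad_madd !quad_mscale quad_bdiag quad_mid quad_Jmat.
  rewrite /Y quad_fun_opp /X !quad_fun_add !quad_mscale.
  have := hAB (stpt 0 u) (stpt 0 v); rewrite !quad_stspace !dot_stpt0.
  have -> : vsub (stpt 0 u) (stpt 0 v) = stpt 0 (vsub u v).
    by apply: vec_ext => -[[]|i]; rewrite /vsub /stpt /vcat //=; ring.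
  rewrite dot_stpt0 dot_vcat vleft_vcat vright_vcat.
  have -> : INR n ^ 2 = INR n * INR n by ring.
  by lra.
have hQ : mnorm Q <= cN * (e + b * (hgrowth kap M t x + hgrowth kap M s y)).
  have g1 := hgrowth_ge0 kap M t x; have g2 := hgrowth_ge0 kap M s y.
  have bg1 : 0 <= b * hgrowth kap M t x by apply: Rmult_le_pos.
  have bg2 : 0 <= b * hgrowth kap M s y by apply: Rmult_le_pos.
  apply: mnorm_entry_le; first by lra.
  have db t' x' i j : Rabs (b * d2growth kap M t' (x' : vec I) i j) <= b * hgrowth kap M t' x'.
    rewrite Rabs_mult Rabs_pos_eq //; apply: Rmult_le_compat_l => //; exact: d2growth_entry.
  move=> [i|i] [j|j]; rewrite /Q /madd /mscale /mid /bdiag; case: (_ == _).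
  - by have := db t x i j; split_Rabs; lra.
  - by have := db t x i j; split_Rabs; lra.
  - by split_Rabs; lra.
  - by split_Rabs; lra.
  - by split_Rabs; lra.
  - by split_Rabs; lra.
  - by have := db s y i j; split_Rabs; lra.
  - by have := db s y i j; split_Rabs; lra.
have h3 := hE x y (proj2 Sz) (proj2 Szeta) xy pp qq Q Qs n n1 X Y Xs Ys XY.
have x0 := vnorm_ge0 x.
have qn : vnorm qq <= b * vnorm (dgrowth kap M s y) + vnorm (stspace q).
  have -> : qq = vadd (vscale (- b) (dgrowth kap M s y)) (vscale (-1) (stspace q)).
    by apply: vec_ext => i; rewrite /qq /vadd /vscale /stspace /vright; ring.
  apply: Rle_trans (vnormD _ _) _; rewrite !vnormZ !Rabs_Ropp Rabs_R1 Rabs_pos_eq //.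
  by lra.
have pqn : vnorm (vsub pp qq) <= b * vnorm (dgrowth kap M t x) + b * vnorm (dgrowth kap M s y)
    + vnorm (vadd (stspace p) (stspace q)).
  have -> : vsub pp qq = vadd (vadd (vscale b (dgrowth kap M t x)) (vscale b (dgrowth kap M s y)))
      (vadd (stspace p) (stspace q)).
    by apply: vec_ext => i; rewrite /pp /qq /vadd /vsub /vscale /stspace /vright; ring.
  apply: Rle_trans (vnormD _ _) _; apply: Rplus_le_compat_r.
  by apply: Rle_trans (vnormD _ _) _; rewrite !vnormZ Rabs_pos_eq //; lra.
have xx : vnorm (vsub x x) <= 1.
  rewrite (_ : vsub x x = fun _ => 0) ?vnorm_vec0; first by lra.
  by vec_ring.
have c1 := growth_control kap M t cN0 xx; have c2 := growth_control kap M s cN0 xy.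
have G1 := growth_pos kap M t x; have G2 := growth_pos kap M s y.
have n0 := vnorm_ge0 (vsub x y).
have k1 : vnorm (vsub x y) * (1 + vnorm qq + INR n ^ 2 * vnorm (vsub x y))
  <= vnorm (vsub x y) * (1 + (b * vnorm (dgrowth kap M s y) + vnorm (stspace q))
       + INR n ^ 2 * vnorm (vsub x y)) by apply: Rmult_le_compat_l; lra.
have k2 := Rmult_le_compat_l (1 + vnorm x) _ _ (ltac:(lra)) pqn.
have k3 := Rmult_le_compat_l (1 + vnorm x ^ 2) _ _ (ltac:(nra)) hQ.
have k4 := Rmult_le_compat_l b _ _ b0 c1; have k5 := Rmult_le_compat_l b _ _ b0 c2.
have bG : 0 <= b * (growth kap M t x + growth kap M s y) by apply: Rmult_le_pos; lra.
have k6 := Rmult_le_compat_r _ _ _ bG hkap.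
move: h3 k1 k2 k3 k4 k5 k6.
set D1 := vnorm (dgrowth kap M t x); set D2 := vnorm (dgrowth kap M s y).
set E1 := hgrowth kap M t x; set E2 := hgrowth kap M s y.
set F1 := growth kap M t x; set F2 := growth kap M s y.
set V := vnorm (vsub x y) * _; set V' := vnorm (vsub x y) * _.
set W := vnorm (vadd (stspace p) (stspace q)).
set gc := growth_const cN M => h3 k1 k2 k3 k4 k5 k6.
have k7 : V + (1 + vnorm x) * vnorm (vsub pp qq) + (1 + vnorm x ^ 2) * mnorm Q
  <= V' + (1 + vnorm x) * W + (1 + vnorm x ^ 2) * (cN * e) + gc * (b * (F1 + F2)) by lra.
have k8 := Rmult_le_compat_l _ _ _ (Rlt_le _ _ al0) k7.
rewrite -/F1 in h1; rewrite -/F2 in h2.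
lra.
Qed.

(** [th = 0] serves to locate the maximum [z0]; for [w1] a positive [th] then makes this maximum
    strict. *)
Definition penalized (I : finType) (w : R -> vec I -> R) b kap M th (z0 z : vec (st I)) : R :=
  w (sttime z) (stspace z)
  - (b * growth kap M (sttime z) (stspace z) + th * sqn (vsub z z0)).

Lemma sttime_lip (I : finType) (y z : vec (st I)) :
  Rabs (sttime y - sttime z) <= vnorm (vsub y z).
Proof. exact: (vnorm_coord (vsub y z) (inl tt)). Qed.

Lemma stspace_lip (I : finType) (y z : vec (st I)) :
  vnorm (vsub (stspace y) (stspace z)) <= vnorm (vsub y z).
Proof. exact: (vright_norm (vsub y z)). Qed.

Lemma vclosed_stdomain (I : finType) (O : vec I -> Prop) T : vclosed (stdomain O T).
Proof.
move=> z hz; split.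
  split; apply: Rnot_lt_le => h.
    have d0 : 0 < - sttime z by lra.
    have [y [[[y0 _] _] hy]] := hz _ d0; have := sttime_lip y z; split_Rabs; lra.
  have d0 : 0 < sttime z - T by lra.
  by have [y [[[_ yT] _] hy]] := hz _ d0; have := sttime_lip y z; split_Rabs; lra.
move=> r r0; have r2 : 0 < r / 2 by lra.
have [y [[_ yO] hy]] := hz _ r2; have [x [Ox hx]] := yO _ r2; exists x; split=> //.
by have := vnorm_tri x (stspace y) (stspace z); have := stspace_lip y z; lra.
Qed.

Lemma jcont_vec (I : finType) (h : R -> vec I -> R) : jcont h -> forall (z : vec (st I)) e,
  0 < e -> exists d, 0 < d /\ forall y, vnorm (vsub y z) < d ->
    Rabs (h (sttime y) (stspace y) - h (sttime z) (stspace z)) < e.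
Proof.
move=> hc z e e0; have [d [d0 hd]] := hc (sttime z) (stspace z) e e0; exists d; split=> // y hy.
apply: hd; [exact: Rle_lt_trans (sttime_lip y z) hy|exact: Rle_lt_trans (stspace_lip y z) hy].
Qed.

Lemma jcont_growth (I : finType) kap M : jcont (@growth I kap M).
Proof.
have As : msym (mscale 0 (@mid (st I))) by move=> i j; rewrite /mscale; ring.
have [_ [_ [_ [h _]]]] := test_fun_C12 1 kap M (fun _ : (st I) => 0) (fun _ => 0) As.
apply: (jcont_ext _ h) => t x; rewrite /test_fun quad_mscale (dotC (fun _ => 0)) dot_vec0; field.
Qed.

Lemma penalized_usc (I : finType) (O : vec I -> Prop) T w b kap M th z0 :
  usc_on (fun t x => 0 <= t <= T /\ oclosure O x) w ->
  vusc (stdomain O T) (penalized w b kap M th z0).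
Proof.
move=> wu; apply: (vusc_sub_cont (S := stdomain O T) (f := fun z => w (sttime z) (stspace z))
  (P := fun z => b * growth kap M (sttime z) (stspace z) + th * sqn (vsub z z0))) => //.
  move=> z Sz e e0; have [d [d0 hd]] := wu _ _ Sz e e0; exists d; split=> // y Sy hy.
  by apply: hd => //; [exact: Rle_lt_trans (sttime_lip y z) hy|exact: Rle_lt_trans (stspace_lip y z) hy].
have As : msym (mscale (2 * th) (@mid (st I))).
  by move=> i j; rewrite /mscale /mid eq_sym.
move=> z e e0.
have [_ [_ [_ [h _]]]] := test_fun_C12 b kap M (fun _ : (st I) => 0) z0 As.
have [d [d0 hd]] := jcont_vec h z e0; exists d; split=> // y hy.
have := hd y hy; rewrite /test_fun !stpt_split !quad_mscale !quad_mid !(dotC (fun _ => 0)) !dot_vec0.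
have -> : forall D, 0 + 2 * th * D / 2 = th * D by move=> D; field.
by have -> : forall D, 0 + 2 * th * D / 2 = th * D by move=> D; field.
Qed.

Definition poly_bounded (I : finType) (O : vec I -> Prop) T (w : R -> vec I -> R) C m : Prop :=
  forall z, stdomain O T z ->
    Rabs (w (sttime z) (stspace z)) <= C * (1 + sqn (stspace z)) ^ m.

Lemma poly_growth_bounded (I : finType) (O : vec I -> Prop) T w : poly_growth O T w ->
  exists C k, 0 <= C /\ forall m, (k <= m)%N -> poly_bounded O T w C m.
Proof.
move=> [C [k h]]; exists (2 * Rabs C), k; split; first by have := Rabs_pos C; lra.
move=> m km z [zt zO]; apply: Rle_trans (h _ _ zt zO) _.
set x := stspace z; have x0 := vnorm_ge0 x; have q0 := dot_ge0 x.
have sq : 0 <= (vnorm x - 1) * (vnorm x - 1) by exact: Rle_0_sqr.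
have x1 : vnorm x <= 1 + dot x x by rewrite -vnorm_sq; lra.
have p1 : vnorm x ^ k <= (1 + dot x x) ^ k by apply: pow_incr.
have p2 : (1 + dot x x) ^ k <= (1 + dot x x) ^ m by apply: Rle_pow; [lra|apply/leP].
have p3 : 1 <= (1 + dot x x) ^ k by apply: pow_R1_Rle; lra.
have v0 : 0 <= vnorm x ^ k by exact: pow_le.
have c0 := Rabs_pos C; have c1 := Rle_abs C.
have h1 : C * (1 + vnorm x ^ k) <= Rabs C * (1 + vnorm x ^ k) by apply: Rmult_le_compat_r; lra.
have h2 : Rabs C * (1 + vnorm x ^ k) <= Rabs C * (2 * (1 + dot x x) ^ m).
  by apply: Rmult_le_compat_l; lra.
by lra.
Qed.

(** On [[0, T]] the factor of the barrier is at least [exp (- kap T)], which reduces the claim to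
    [growth_coercive]; time is bounded anyway. *)
Lemma penalized_coercive (I : finType) (O : vec I -> Prop) T w C m b kap th z0 :
  0 <= C -> poly_bounded O T w C m -> 0 < b -> 0 <= kap -> 0 <= th ->
  coercive (stdomain O T) (penalized w b kap m th z0).
Proof.
move=> C0 hw b0 k0 th0.
have bT : 0 < b * exp (- kap * T) by apply: Rmult_lt_0_compat => //; exact: exp_pos.
have [[B hB] hL] := growth_coercive m C0 bT.
have up z : stdomain O T z -> penalized w b kap m th z0 z <=
    C * (1 + sqn (stspace z)) ^ m
      - b * exp (- kap * T) * (1 + sqn (stspace z)) ^ m.+2.
  move=> Sz; have h1 := hw z Sz; rewrite /penalized.
  have h2 : 0 <= th * sqn (vsub z z0) by apply: Rmult_le_pos => //; exact: dot_ge0.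
  have h3 : exp (- kap * T) <= exp (- kap * sttime z).
    have [[_ zT] _] := Sz.
    case: (Req_dec (kap * T) (kap * sttime z)) => [e|ne].
      by right; congr exp; lra.
    by left; apply: exp_increasing; nra.
  have p0 : 0 <= (1 + sqn (stspace z)) ^ m.+2.
    by apply: pow_le; have := dot_ge0 (stspace z); lra.
  have h4 : b * (exp (- kap * T) * (1 + sqn (stspace z)) ^ m.+2)
     <= b * growth kap m (sttime z) (stspace z).
    by apply: Rmult_le_compat_l; [lra|apply: Rmult_le_compat_r].
  by split_Rabs; lra.
have s1 (z : vec (st I)) : 1 <= 1 + sqn (stspace z).
  by have := dot_ge0 (stspace z); lra.
split.
  by exists B => z Sz; apply: Rle_trans (up z Sz) _; exact: hB.
move=> L; have [B' hB'] := hL L; exists (Rabs T + (Rabs B' + 1)) => z Sz hz.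
have h1 := hB' _ (s1 z) (Rle_trans _ _ _ hz (up z Sz)).
have n1 : vnorm (stspace z) <= Rabs B' + 1.
  apply: Rle_sqr; first by have := Rabs_pos B'; lra.
  by rewrite vnorm_sq; have := Rle_abs B'; have := Rabs_pos B'; nra.
have := vnorm_stpt_le (sttime z) (stspace z) (fun _ => 0).
have sub0 (J : finType) (u : vec J) : vsub u (fun _ => 0) = u.
  by vec_ring.
rewrite stpt_split sub0 [stspace (fun _ => 0)](_ : _ = fun _ => 0) // sub0.
rewrite [sttime (fun _ => 0)]/(0) Rminus_0_r; have [[z0' zT] _] := Sz.
by have := Rle_abs T; rewrite (Rabs_pos_eq (sttime z)) //; lra.
Qed.

Lemma touches_unpenalize (I : finType) (S : vec (st I) -> Prop) w b kap M th z0 z p X :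
  touches_above S (penalized w b kap M th z0) z p X ->
  touches_above S (fun z => w (sttime z) (stspace z) - b * growth kap M (sttime z) (stspace z)) z
    (vadd p (vscale (2 * th) (vsub z z0))) (madd X (mscale (2 * th) (@mid (st I)))).
Proof.
move=> [r [r0 hr]]; exists r; split=> // y Sy hy; have := hr y Sy hy; rewrite /penalized.
rewrite quad_madd quad_mscale quad_mid dotDl dotZl.
have -> : sqn (vsub y z0) = sqn (vsub z z0)
    + 2 * dot (vsub z z0) (vsub y z) + sqn (vsub y z).
  rewrite -dot_sqD; congr dot; apply: vec_ext => i; rewrite /vsub /vadd; ring.
by lra.
Qed.

Lemma sum_attain (I : finType) (S : vec I -> Prop) f g z : vclosed S -> vusc S f -> vusc S g ->
  coercive S f -> coercive S g -> S z ->
  exists z0, S z0 /\ forall y, S y -> f y + g y <= f z0 + g z0.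
Proof.
move=> Sc fu gu [_ fc] [[B hB] _] Sz.
have [R hR] := fc (f z + g z - B).
pose K y := S y /\ vnorm y <= R.
have Kin y : S y -> f z + g z <= f y + g y -> K y.
  by move=> Sy hy; split=> //; apply: hR => //; have := hB y Sy; lra.
have Kz : K z by apply: Kin => //; lra.
have KB y : K y -> vnorm y <= R by case.
have Kc : vclosed K.
  move=> y hy; split.
    by apply: Sc => r r0; have [x [[Sx _] hx]] := hy r r0; exists x.
  apply: Rnot_lt_le => hlt; have d0 : 0 < vnorm y - R by lra.
  have [x [[_ xR] hx]] := hy _ d0; have := vnormD x (vsub y x); rewrite vsubK.
  by rewrite vsubC in hx; lra.
have Ku : vusc K (fun y => f y + g y).
  move=> x [Sx _] e e0; have e2 : 0 < e / 2 by lra.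
  have [d1 [d10 h1]] := fu x Sx _ e2; have [d2 [d20 h2]] := gu x Sx _ e2.
  exists (Rmin d1 d2); split; first exact: Rmin_glb_lt.
  move=> y [Sy _] hy.
  have := h1 y Sy (Rlt_le_trans _ _ _ hy (Rmin_l _ _)).
  by have := h2 y Sy (Rlt_le_trans _ _ _ hy (Rmin_r _ _)); lra.
have [z0 [[Sz0 _] hmax]] := usc_attain Kz KB Kc Ku; exists z0; split=> // y Sy.
case: (Rle_dec (f z + g z) (f y + g y)) => h; first by apply: hmax; exact: Kin.
by have := hmax z Kz; lra.
Qed.

Lemma scale_choice s eps : 0 < eps -> 2 * eps <= s ->
  exists N : nat, (1 <= N)%N /\ INR N * eps <= s /\ s / 2 <= INR N * eps.
Proof.
move=> e0 es; have q0 : 2 <= s / eps.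
  by apply: (Rmult_le_reg_r eps) => //; rewrite /Rdiv Rmult_assoc Rinv_l; lra.
have [N [h1 h2]] := nat_floor (ltac:(lra) : 0 <= s / eps).
have qE : s / eps * eps = s by field; lra.
have k1 : INR N * eps <= s / eps * eps by apply: Rmult_le_compat_r; lra.
have k2 : s / eps * eps < (INR N + 1) * eps by apply: Rmult_lt_compat_r.
exists N; split; last by split; lra.
by apply/ltP; apply: INR_lt; rewrite /=; lra.
Qed.

Definition core_const (al cN g M0 X1 : R) : R :=
  4 + al * ((M0 + 3) * (3 + g) + (M0 + 3) * (M0 + 3) + (1 + X1) * 4 + (1 + X1 * X1) * (cN * 3)).

(** The dangerous products are [D N^2 dn = (N D) (N dn)] and [D N^2 D = (N D)^2]: each factor is of
    order [s], so they are harmless although [N] is unbounded. *)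
Lemma core_arith al cN g M0 X1 s D N dn bD qn xn pq tt e1 :
  0 < al -> 0 <= cN -> 0 <= g -> 0 <= M0 -> 0 <= X1 -> 0 < s <= 1 -> 1 <= N ->
  0 <= D -> N * D <= (M0 + 3) * s -> 0 <= dn -> N * dn <= s -> 0 <= bD <= g -> 0 <= qn ->
  qn <= N * N * dn + 1 -> 0 <= xn <= X1 -> 0 <= pq <= 4 * s -> tt <= 4 * s -> 0 <= e1 <= 3 * s ->
  tt + al * (D * (1 + (bD + qn) + N ^ 2 * D) + (1 + xn) * pq + (1 + xn ^ 2) * (cN * e1))
  <= core_const al cN g M0 X1 * s.
Proof.
move=> al0 cN0 g0 M00 X10 [s0 s1] N1 D0 ND dn0 Ndn [bD0 bDg] qn0 qnb [xn0 xnX] [pq0 pqs] tts [e10 e1s].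
have Ds : D <= (M0 + 3) * s by nra.
have M3s : 0 <= (M0 + 3) * s by nra.
have ss : s * s <= s by nra.
have t1 : D * (2 + bD) <= (M0 + 3) * s * (2 + g) by apply: Rmult_le_compat; lra.
have t2 : D * (N * N * dn) <= (M0 + 3) * s.
  have -> : D * (N * N * dn) = (N * D) * (N * dn) by ring.
  have a1 : 0 <= N * D by nra. have a2 : 0 <= N * dn by nra.
  have : (N * D) * (N * dn) <= (M0 + 3) * s * s by apply: Rmult_le_compat.
  by nra.
have t3 : D * (N ^ 2 * D) <= (M0 + 3) * (M0 + 3) * s.
  have -> : D * (N ^ 2 * D) = (N * D) * (N * D) by ring.
  have a1 : 0 <= N * D by nra.
  have : (N * D) * (N * D) <= (M0 + 3) * s * ((M0 + 3) * s) by apply: Rmult_le_compat.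
  have : (M0 + 3) * (M0 + 3) * (s * s) <= (M0 + 3) * (M0 + 3) * s.
    by apply: Rmult_le_compat_l => //; nra.
  by lra.
have t4 : D * qn <= D * (N * N * dn + 1) by apply: Rmult_le_compat_l.
have t5 : (1 + xn) * pq <= (1 + X1) * (4 * s) by apply: Rmult_le_compat; lra.
have c3 : cN * e1 <= cN * (3 * s) by apply: Rmult_le_compat_l.
have c0 : 0 <= cN * e1 by nra.
have t6 : (1 + xn ^ 2) * (cN * e1) <= (1 + X1 * X1) * (cN * (3 * s)).
  by apply: Rmult_le_compat => //; nra.
have t7 : D * (1 + (bD + qn) + N ^ 2 * D) + (1 + xn) * pq + (1 + xn ^ 2) * (cN * e1)
  <= ((M0 + 3) * (3 + g) + (M0 + 3) * (M0 + 3) + (1 + X1) * 4 + (1 + X1 * X1) * (cN * 3)) * s by lra.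
have := Rmult_le_compat_l _ _ _ (Rlt_le _ _ al0) t7.
by rewrite /core_const; lra.
Qed.

Lemma penalized_drop (I : finType) w b kap M th (z0 z : vec (st I)) :
  penalized w b kap M th z0 z = penalized w b kap M 0 z0 z - th * sqn (vsub z z0).
Proof. by rewrite /penalized; ring. Qed.

Lemma vsub_self (I : finType) (z : vec I) : vsub z z = fun _ => 0.
Proof. by vec_ring. Qed.

(* The penalty is [N^2/2 |zeta - z - v|^2] in space-time, where [v] is the shift of class R at scale
   [eps] and [N] is about [s / eps]: then [N |x - y|] is of order [s], which makes the term
   [N^2 |x - y|^2] of Assumption E small although [x - y] is only of order [eps]. *)
Lemma doubling_estimate (I : finType) (O : vec I -> Prop) T rho H w1 w2 al b kap m C z0
  (l : R -> vec I) (lam : R -> R) rB c M0 r s :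
  let cN := INR #|{: (I + I) * (I + I)}| + 1 in
  let f1 := penalized w1 b kap m 0 z0 in
  let g := penalized (fun t x => - w2 t x) b kap m 0 z0 in
  let X1 := vnorm (stspace z0) + 1 in
  let gB := b * (growth_const 0 m * (1 + X1 * X1) ^ m.+2) in
  isopen O ->
  structure_bound O H al ->
  0 < al -> 0 < b -> 0 <= kap -> al * growth_const cN m <= kap -> 0 < rho -> 0 <= C ->
  usc_on (fun t x => 0 <= t <= T /\ oclosure O x) w1 ->
  usc_on (fun t x => 0 <= t <= T /\ oclosure O x) (fun t x => - w2 t x) ->
  poly_bounded O T w1 C m -> poly_bounded O T (fun t x => - w2 t x) C m ->
  visc_sub rho H (fun t x => 0 <= t < T /\ oclosure O x) w1 ->
  visc_super rho H (fun t x => 0 <= t < T /\ O x) w2 ->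
  stdomain O T z0 -> sttime z0 < T ->
  (forall z, stdomain O T z -> f1 z + g z <= f1 z0 + g z0) ->
  [/\ 0 < rB, 0 < c, 0 < M0 & 0 < r] ->
  (forall d, 0 < d -> exists eps, 0 < eps < d /\ vnorm (l eps) <= M0 * eps) ->
  (forall y eps v, oclosure O y -> vnorm (vsub y (stspace z0)) < rB -> 0 < eps < r ->
     vnorm v <= c * eps -> O (vadd (vadd y (l eps)) v)) ->
  (forall eps, 0 < eps -> 0 <= lam eps) -> lim0 lam 0 ->
  lim0 (fun eps => w2 (sttime z0 + lam eps) (vadd (stspace z0) (l eps)))
    (w2 (sttime z0) (stspace z0)) ->
  0 < s <= 1 ->
  rho * (f1 z0 + g z0) <= (core_const al cN gB M0 X1 + 2 * rho) * s.
Proof.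
move=> cN f1 g X1 gB Oo hE al0 b0 k0 hkap rho0 C0 u1 u2 pb1 pb2 vsub1 vsup Sz0 z0T hmax
  [rB0 c0 M00 r0] hl hO lam0 lam1 hw [s0 s1].
pose S := stdomain O T.
have Sc : vclosed S by exact: vclosed_stdomain.
pose f := penalized w1 b kap m s z0.
have fu : vusc S f by exact: penalized_usc.
have gu : vusc S g by exact: penalized_usc.
have fc : coercive S f by apply: (penalized_coercive z0 C0 pb1 b0 k0); lra.
have gc : coercive S g by apply: (penalized_coercive z0 C0 pb2 b0 k0); lra.
have fE z : f z = f1 z - s * sqn (vsub z z0) by exact: penalized_drop.
have fz0 : f z0 = f1 z0 by rewrite fE vsub_self dot_vec0; ring.
rewrite -fz0; set U0 := f z0 + g z0.
have smax z : S z -> f z + g z <= U0 - s * sqn (vsub z z0).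
  by move=> Sz; have := hmax z Sz; rewrite fE /U0 fz0; lra.
(* The target for [N |d|]: at most [s] for the final estimate, and at most [c s / 2] so that
   [N eps >= s / 2] yields [|d| <= c eps]. *)
pose k2 := Rmin (c * s / 2) s.
have k20 : 0 < k2 by apply: Rmin_glb_lt; nra.
have k2c : k2 <= c * s / 2 by exact: Rmin_l.
have k2s : k2 <= s by exact: Rmin_r.
have kk0 : 0 < k2 * k2 / 4 by nra.
pose tau := Rmin (Rmin (1 / 4) rB) (Rmin ((T - sttime z0) / 2) (k2 * k2 / 4)).
have tau0 : 0 < tau by apply: Rmin_glb_lt; apply: Rmin_glb_lt => //; lra.
have tau1 : tau <= 1 / 4 by apply: Rle_trans (Rmin_l _ _) _; exact: Rmin_l.
have tauB : tau <= rB by apply: Rle_trans (Rmin_l _ _) _; exact: Rmin_r.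
have tauT : tau <= (T - sttime z0) / 2 by apply: Rle_trans (Rmin_r _ _) _; exact: Rmin_l.
have tauk : tau <= k2 * k2 / 4 by apply: Rle_trans (Rmin_r _ _) _; exact: Rmin_r.
have [dp [dp0 hdp]] := penalty Sc fu gu fc gc Sz0 s0 smax tau0.
pose dd := Rmin (Rmin (k2 * k2 / 4) s) dp.
have dd0 : 0 < dd by apply: Rmin_glb_lt => //; apply: Rmin_glb_lt.
have ddk : dd <= k2 * k2 / 4 by apply: Rle_trans (Rmin_l _ _) _; exact: Rmin_l.
have dds : dd <= s by apply: Rle_trans (Rmin_l _ _) _; exact: Rmin_r.
have ddp : dd <= dp by exact: Rmin_r.
have [[Bf hBf] _] := fc; have [[Bg hBg] _] := gc.
have UB : U0 <= Bf + Bg by have := hBf _ Sz0; have := hBg _ Sz0; rewrite /U0; lra.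
(* A crude bound for the penalty from global upper bounds. It already brings [z] and [zeta] so close
   that [hdp] applies and improves it. *)
pose D1 := Bf + Bg - U0 + 1; have D10 : 1 <= D1 by rewrite /D1; lra.
have dd2 : 0 < dd / 2 by lra.
have [e1 [e10 he1]] := hw _ dd2.
have cont : jcont (fun t (x : vec I) => b * growth kap m t x).
  by apply: jcontM; [exact: jcont_cst|exact: jcont_growth].
have [e2 [e20 he2]] := jcont_vec cont z0 dd2.
pose e3 := Rmin (Rmin (e2 / 4) (dp / 4)) (T - sttime z0).
have e30 : 0 < e3 by apply: Rmin_glb_lt; [apply: Rmin_glb_lt|]; lra.
have e32 : e3 <= e2 / 4 by apply: Rle_trans (Rmin_l _ _) _; exact: Rmin_l.
have e3p : e3 <= dp / 4 by apply: Rle_trans (Rmin_l _ _) _; exact: Rmin_r.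
have e3T : e3 <= T - sttime z0 by exact: Rmin_r.
have [e4 [e40 he4]] := lam1 _ e30.
pose E := (8 * D1 + 1) / s.
have E0 : 0 < E by apply: Rdiv_lt_0_compat; lra.
pose emax := Rmin (Rmin (Rmin e1 e4) (Rmin r (s / 2))) (Rmin (e3 / M0) (dp / (4 * E))).
have emax0 : 0 < emax.
  do ![apply: Rmin_glb_lt] => //; try lra; apply: Rdiv_lt_0_compat; nra.
have [eps [[eps0 epsm] leps]] := hl _ emax0.
have m1 : eps < e1 by apply: Rlt_le_trans epsm _; do 2 apply: Rle_trans (Rmin_l _ _) _; exact: Rmin_l.
have m4 : eps < e4 by apply: Rlt_le_trans epsm _; do 2 apply: Rle_trans (Rmin_l _ _) _; exact: Rmin_r.
have mr : eps < r.
  by apply: Rlt_le_trans epsm _; apply: Rle_trans (Rmin_l _ _) _; apply: Rle_trans (Rmin_r _ _) _; exact: Rmin_l.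
have ms : eps < s / 2.
  by apply: Rlt_le_trans epsm _; apply: Rle_trans (Rmin_l _ _) _; apply: Rle_trans (Rmin_r _ _) _; exact: Rmin_r.
have mM : M0 * eps < e3.
  have h : eps < e3 / M0 by apply: Rlt_le_trans epsm _; apply: Rle_trans (Rmin_r _ _) _; exact: Rmin_l.
  have -> : e3 = M0 * (e3 / M0) by field; lra.
  by apply: Rmult_lt_compat_l.
have mE : E * eps < dp / 4.
  have h : eps < dp / (4 * E) by apply: Rlt_le_trans epsm _; apply: Rle_trans (Rmin_r _ _) _; exact: Rmin_r.
  have -> : dp / 4 = E * (dp / (4 * E)) by field; lra.
  by apply: Rmult_lt_compat_l.
have le0 := vnorm_ge0 (l eps).
have lamb : 0 <= lam eps < e3.
  have := he4 eps (conj eps0 m4); have := lam0 _ eps0; split_Rabs; lra.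
have [N [N1 [Ns Ns2]]] := scale_choice eps0 (ltac:(lra) : 2 * eps <= s).
have N1' : 1 <= INR N by have := le_INR 1 N (elimT leP N1); rewrite /=; lra.
pose v : vec (st I) := stpt (lam eps) (l eps).
have vn : vnorm v <= lam eps + vnorm (l eps).
  have := vnorm_stpt_le (lam eps) (l eps) (fun _ => 0).
  have -> : vsub (stpt (lam eps) (l eps)) (fun _ => 0) = v.
    by apply: vec_ext => i; rewrite /v /vsub; ring.
  have -> : vsub (l eps) (stspace (fun _ => 0)) = l eps.
    by apply: vec_ext => i; rewrite /vsub /stspace /vright; ring.
  by rewrite /sttime Rminus_0_r Rabs_pos_eq; lra.
(* The competitor [(z0, zr)] has zero penalty, and its value nearly attains [U0] by the convergence
   in class R and the continuity of the barrier. *)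
pose zr := vadd z0 v.
have zrt : sttime zr = sttime z0 + lam eps by [].
have zrx : stspace zr = vadd (stspace z0) (l eps) by [].
have vr0 : vnorm (fun _ : I => 0) <= c * eps by rewrite vnorm_vec0; apply: Rmult_le_pos; lra.
have Szr : S zr.
  have [[t1 t2] Ox0] := Sz0; split; first by rewrite zrt; lra.
  apply: oclosure_sub; rewrite zrx -(vadd0 (vadd _ _)); apply: hO => //.
  by rewrite vsub_self vnorm_vec0.
have gzr : g z0 - dd <= g zr.
  have h1 := he1 eps (conj eps0 m1).
  have h2 : vnorm (vsub zr z0) < e2 by rewrite /zr vaddK; lra.
  have h3 := he2 _ h2; rewrite /g /penalized zrt zrx in h3 *.
  by split_Rabs; lra.
have [z [zeta [Sz Szeta zmax]]] := doubling_max v (INR N) Sc fu gu fc gc Sz0 Szr.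
pose d := vsub (vsub zeta z) v.
have href := zmax _ _ Sz0 Szr.
have dz : vsub (vsub zr z0) v = fun _ => 0 by rewrite /zr vaddK vsub_self.
rewrite dz dot_vec0 Rmult_0_r Rminus_0_r -/d in href.
have dn0 := vnorm_ge0 d.
rewrite -vnorm_sq in href.
have NN0 : 0 <= INR N * INR N by apply: Rmult_le_pos; lra.
have pen0 : 0 <= INR N * INR N / 2 * (vnorm d * vnorm d) by apply: Rmult_le_pos; [lra|exact: Rmult_le_pos].
have Nd2 : INR N * vnorm d * (INR N * vnorm d) <= 2 * D1.
  have := hBf _ Sz; have := hBg _ Szeta; rewrite /D1 /U0; lra.
have dE : vnorm d <= E * eps.
  apply: Rle_sqr; first by apply: Rmult_le_pos; lra.
  apply: (Rmult_le_reg_l (INR N * INR N)); first by apply: Rmult_lt_0_compat; lra.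
  have e5 : E * (s / 2) = (8 * D1 + 1) / 2 by rewrite /E; field; lra.
  have e6 : E * (s / 2) <= E * (INR N * eps) by apply: Rmult_le_compat_l; lra.
  have e7 : (8 * D1 + 1) / 2 * ((8 * D1 + 1) / 2) <= E * (INR N * eps) * (E * (INR N * eps)).
    by apply: Rmult_le_compat; lra.
  have -> : INR N * INR N * (E * eps * (E * eps)) = E * (INR N * eps) * (E * (INR N * eps)) by ring.
  apply: Rle_trans e7.
  have -> : INR N * INR N * (vnorm d * vnorm d) = INR N * vnorm d * (INR N * vnorm d) by ring.
  by have := Rle_0_sqr D1; rewrite /Rsqr; lra.
have zzeta : vsub zeta z = vadd v d by apply: vec_ext => i; rewrite /d /vsub /vadd; ring.
have dist : vnorm (vsub z zeta) < dp.
  by rewrite vsubC zzeta; have := vnormD v d; lra.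
have [zt zetat Uub] := hdp z zeta Sz Szeta dist (ltac:(lra)).
(* The excess over the competitor is below [tau + dd], at most [k2^2 / 2], and it bounds half of
   [N^2 |d|^2]. *)
have Nd : INR N * vnorm d <= k2.
  apply: Rle_sqr; first by lra.
  rewrite -/U0 in Uub; rewrite /U0 in Uub; lra.
have dc : vnorm d <= c * eps.
  apply: (Rmult_le_reg_l (INR N)); first by lra.
  by have : c * (s / 2) <= c * (INR N * eps) by [apply: Rmult_le_compat_l; lra]; lra.
have sd : vnorm (stspace d) <= vnorm d by exact: vright_norm.
have zetax : stspace zeta = vadd (vadd (stspace z) (l eps)) (stspace d).
  apply: vec_ext => i; rewrite /stspace /vright /vadd /d /vsub /v /stpt /vcat; ring.
(* Here class R acts: [zeta] is [z] moved by the inward shift and a perturbation of size at most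
   [c eps]. *)
have Ozeta : O (stspace zeta).
  rewrite zetax; apply: hO => //; [by case: Sz| |lra].
  by apply: Rle_lt_trans (stspace_lip z z0) _; lra.
have [rO [rO0 hrO]] := Oo _ Ozeta.
(* The points supplied by the theorem on sums must stay in [O], before time [T], and within the
   order of [eps]. *)
pose e := Rmin (Rmin eps rO) (Rmin (1 / 4) ((T - sttime z0) / 2)).
have e0 : 0 < e by apply: Rmin_glb_lt; apply: Rmin_glb_lt => //; lra.
have ee : e <= eps by apply: Rle_trans (Rmin_l _ _) _; exact: Rmin_l.
have eO : e <= rO by apply: Rle_trans (Rmin_l _ _) _; exact: Rmin_r.
have e14 : e <= 1 / 4 by apply: Rle_trans (Rmin_r _ _) _; exact: Rmin_l.
have eT : e <= (T - sttime z0) / 2 by apply: Rle_trans (Rmin_r _ _) _; exact: Rmin_r.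
have [z' [zeta' [p [q [X [Y [[Sz' Szeta' zz' zetazeta'] [[pn qn Xs Ys val] [tz tzeta ineq]]]]]]]]] :=
  doubling_sums Sc fu gu Sz Szeta e0 zmax.
rewrite -/d in pn qn.
have c1 : vnorm (vsub z' z0) < 1 / 2 by have := vnorm_tri z' z z0; lra.
have c1T : vnorm (vsub z' z0) < T - sttime z0 by have := vnorm_tri z' z z0; lra.
have c2 : vnorm (vsub zeta' z0) < 1 / 2 by have := vnorm_tri zeta' zeta z0; lra.
have c2T : vnorm (vsub zeta' z0) < T - sttime z0 by have := vnorm_tri zeta' zeta z0; lra.
have z'T : sttime z' < T by have := sttime_lip z' z0; split_Rabs; lra.
have zeta'T : sttime zeta' < T by have := sttime_lip zeta' z0; split_Rabs; lra.
have Ozeta' : O (stspace zeta') by apply: hrO; apply: Rle_lt_trans (stspace_lip _ _) _; lra.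
pose x := stspace z'; pose y := stspace zeta'.
have xy1 : vnorm (vsub x y) <= 1.
  apply: Rle_trans (stspace_lip z' zeta') _; have := vnorm_tri z' z0 zeta'.
  by rewrite (vsubC z0); lra.
have xyd : vnorm (vsub x y) <= M0 * eps + vnorm d + 2 * e.
  have h1 := vnorm_tri x (stspace z) y; have h2 := vnorm_tri (stspace z) (stspace zeta) y.
  have h3 : vnorm (vsub (stspace z) (stspace zeta)) <= M0 * eps + vnorm d.
    rewrite vsubC zetax (_ : vsub _ (stspace z) = vadd (l eps) (stspace d)).
      by have := vnormD (l eps) (stspace d); lra.
    by vec_ring.
  have h4 := stspace_lip z' z; have h5 := stspace_lip zeta' zeta; rewrite vsubC in h5.
  by rewrite -/x -/y in h4 h5; lra.
have snorm (w : vec I) : vnorm (vsub w (stspace z0)) < 1 / 2 -> vnorm w <= X1.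
  by move=> hw'; have := vnormD (vsub w (stspace z0)) (stspace z0);
     rewrite (_ : vadd (vsub w (stspace z0)) (stspace z0) = w); [rewrite /X1; lra|
     apply: vec_ext => i; rewrite /vadd /vsub; ring].
have xX : vnorm x <= X1 by apply: snorm; apply: Rle_lt_trans (stspace_lip _ _) _.
have yX : vnorm y <= X1 by apply: snorm; apply: Rle_lt_trans (stspace_lip _ _) _.
pose A := madd X (mscale (2 * s) (@mid (st I))).
have As : msym A by move=> i j; rewrite /A /madd /mscale Xs /mid eq_sym.
pose p' := vadd p (vscale (2 * s) (vsub z' z0)).
have tz' := touches_unpenalize tz; rewrite -/A -/p' in tz'.
have tzeta' := touches_unpenalize tzeta.
have q0E : vadd q (vscale (2 * 0) (vsub zeta' z0)) = q.
  by vec_ring.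
have Y0E : madd Y (mscale (2 * 0) (@mid (st I))) = Y.
  by do 2 (apply: functional_extensionality => ?); rewrite /madd /mscale; ring.
rewrite q0E Y0E in tzeta'.
have hAB u w : quad A u + quad Y w
     <= INR N * INR N * sqn (vsub u w) + 3 * s * (dot u u + dot w w).
  rewrite /A quad_madd quad_mscale quad_mid; have := ineq u w.
  have u0 := dot_ge0 u; have w0 := dot_ge0 w.
  have : e * (dot u u + dot w w) <= s * (dot u u + dot w w) by apply: Rmult_le_compat_r; lra.
  have : 0 <= s * dot w w by apply: Rmult_le_pos; lra.
  by lra.
have s30 : 0 <= 3 * s by lra.
have main := touch_estimate hE al0 (Rlt_le _ _ b0) hkap s30 N1 vsub1 vsup Sz' Szeta' z'T zeta'T
   Ozeta' xy1 As Ys tz' tzeta' hAB.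
rewrite -/cN -/x -/y in main.
have z'1 : vnorm (vscale (2 * s) (vsub z' z0)) <= s.
  have s20 : 0 <= 2 * s by lra.
  rewrite vnormZ Rabs_pos_eq //.
  by have := Rmult_le_compat_l _ _ _ s20 (Rlt_le _ _ c1); lra.
have pq4 : vnorm (vadd p' q) <= 4 * s.
  have h1 := vnormD (vsub p (vscale (- (INR N * INR N)) d))
      (vadd (vsub q (vscale (INR N * INR N) d)) (vscale (2 * s) (vsub z' z0))).
  have h2 := vnormD (vsub q (vscale (INR N * INR N) d)) (vscale (2 * s) (vsub z' z0)).
  rewrite (_ : vadd p' q = vadd (vsub p (vscale (- (INR N * INR N)) d))
      (vadd (vsub q (vscale (INR N * INR N) d)) (vscale (2 * s) (vsub z' z0)))); first by lra.
  by apply: vec_ext => i; rewrite /p' /vadd /vsub /vscale; ring.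
have tt4 : p' (inl tt) + q (inl tt) <= 4 * s.
  have h : Rabs (p' (inl tt) + q (inl tt)) <= vnorm (vadd p' q) := vnorm_coord (vadd p' q) (inl tt).
  by have := Rle_abs (p' (inl tt) + q (inl tt)); lra.
have pqs : vnorm (vadd (stspace p') (stspace q)) <= 4 * s.
  exact: Rle_trans (vright_norm (vadd p' q)) pq4.
have qs : vnorm (stspace q) <= INR N * INR N * vnorm d + 1.
  have hq : vnorm (stspace q) <= vnorm q := vright_norm q.
  apply: Rle_trans hq _.
  have := vnormD (vsub q (vscale (INR N * INR N) d)) (vscale (INR N * INR N) d).
  have -> : vadd (vsub q (vscale (INR N * INR N) d)) (vscale (INR N * INR N) d) = q.
    by vec_ring.
  have h : vnorm (vscale (INR N * INR N) d) = INR N * INR N * vnorm d by rewrite vnormZ Rabs_pos_eq.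
  by rewrite h; lra.
have ND : INR N * vnorm (vsub x y) <= (M0 + 3) * s.
  have h1 : INR N * vnorm (vsub x y) <= INR N * (M0 * eps + vnorm d + 2 * e).
    by apply: Rmult_le_compat_l; lra.
  have h2 : INR N * e <= INR N * eps by apply: Rmult_le_compat_l; lra.
  have h3 : M0 * (INR N * eps) <= M0 * s by apply: Rmult_le_compat_l; lra.
  by lra.
have yy : vnorm (vsub y y) <= 1 by rewrite vsub_self vnorm_vec0; lra.
have gD : b * vnorm (dgrowth kap m (sttime zeta') y) <= gB.
  have h1 := growth_control kap m (sttime zeta') (Rle_refl 0) yy.
  have [[zt0 _] _] := Szeta'.
  have h2 := growth_le m y k0 zt0.
  have y0 := vnorm_ge0 y; have g0 := vnorm_ge0 (dgrowth kap m (sttime zeta') y).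
  have h3 : (1 + dot y y) ^ m.+2 <= (1 + X1 * X1) ^ m.+2.
    apply: pow_incr; rewrite -vnorm_sq; have h5 := Rmult_le_pos _ _ y0 y0.
    by have h6 := Rmult_le_compat _ _ _ _ y0 y0 yX yX; split; lra.
  have gc0 : 0 <= growth_const 0 m by rewrite /growth_const; have := pos_INR m.+2; lra.
  have h4 : growth_const 0 m * growth kap m (sttime zeta') y
     <= growth_const 0 m * (1 + X1 * X1) ^ m.+2 by apply: Rmult_le_compat_l; lra.
  apply: Rmult_le_compat_l; first by lra.
  have h5 : 0 <= vnorm y * vnorm (dgrowth kap m (sttime zeta') y) by apply: Rmult_le_pos.
  by lra.
have gD0 : 0 <= b * vnorm (dgrowth kap m (sttime zeta') y).
  by apply: Rmult_le_pos; [lra|exact: vnorm_ge0].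
have cN0 : 0 <= cN by have := pos_INR #|{: (I + I) * (I + I)}|; rewrite /cN; lra.
have X10 : 0 <= X1 by apply: Rle_trans xX; exact: vnorm_ge0.
have fin := @core_arith al cN gB M0 X1 s (vnorm (vsub x y)) (INR N) (vnorm d)
   (b * vnorm (dgrowth kap m (sttime zeta') y)) (vnorm (stspace q)) (vnorm x)
   (vnorm (vadd (stspace p') (stspace q))) (p' (inl tt) + q (inl tt)) (3 * s)
   al0 cN0 (Rle_trans _ _ _ gD0 gD) (Rlt_le _ _ M00) X10 (conj s0 s1) N1' (vnorm_ge0 _) ND
   dn0 (Rle_trans _ _ _ Nd k2s) (conj gD0 gD) (vnorm_ge0 _) qs (conj (vnorm_ge0 _) xX)
   (conj (vnorm_ge0 _) pqs) tt4 (conj s30 (Rle_refl _)).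
have low : U0 - 2 * s <= w1 (sttime z') x - w2 (sttime zeta') y.
  have G1 := growth_pos kap m (sttime z') (stspace z').
  have G2 := growth_pos kap m (sttime zeta') (stspace zeta').
  have bG1 : 0 <= b * growth kap m (sttime z') (stspace z') by apply: Rmult_le_pos; lra.
  have bG2 : 0 <= b * growth kap m (sttime zeta') (stspace zeta') by apply: Rmult_le_pos; lra.
  have q1 : 0 <= s * sqn (vsub z' z0) by apply: Rmult_le_pos; [lra|exact: dot_ge0].
  have f' : f z' <= w1 (sttime z') x by rewrite /f /penalized /x; lra.
  have g' : g zeta' <= - w2 (sttime zeta') y by rewrite /g /penalized /y; lra.
  by rewrite /U0; lra.
have := Rmult_le_compat_l _ _ _ (Rlt_le _ _ rho0) low.
by lra.
Qed.

Lemma comparison (I : finType) (O : vec I -> Prop) (T rho : R)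
  (H : vec I -> vec I -> mx I -> R) (w1 w2 : R -> vec I -> R) :
  isopen O -> 0 < rho -> AssumptionE O H ->
  usc_on (fun t x => 0 <= t <= T /\ oclosure O x) w1 ->
  visc_sub rho H (fun t x => 0 <= t < T /\ oclosure O x) w1 ->
  lsc_on (fun t x => 0 <= t <= T /\ oclosure O x) w2 ->
  visc_super rho H (fun t x => 0 <= t < T /\ O x) w2 ->
  poly_growth O T w1 -> poly_growth O T w2 ->
  classR O T w2 ->
  (forall x, oclosure O x -> w1 T x <= w2 T x) ->
  forall t x, 0 <= t <= T -> oclosure O x -> w1 t x <= w2 t x.
Proof.
move=> Oo rho0 hE u1 vsub1 l2 vsup pg1 pg2 cR hT t x tT Ox; apply: Rnot_lt_le => hlt.
pose cN := INR #|{: (I + I) * (I + I)}| + 1.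
have cN0 : 0 <= cN by have := pos_INR #|{: (I + I) * (I + I)}|; rewrite /cN; lra.
have [al [al0 hE']] := AssumptionE_const hE.
have [C1 [k1 [C10 hb1]]] := poly_growth_bounded pg1.
have [C2 [k2 [C20 hb2]]] := poly_growth_bounded pg2.
pose m := maxn k1 k2; pose C := C1 + C2; have C0 : 0 <= C by rewrite /C; lra.
have pw (z : vec (st I)) : 0 <= (1 + sqn (stspace z)) ^ m.
  by apply: pow_le; have := dot_ge0 (stspace z); lra.
have pb1 : poly_bounded O T w1 C m.
  move=> z Sz; apply: Rle_trans (hb1 m (leq_maxl _ _) z Sz) _.
  by apply: Rmult_le_compat_r => //; rewrite /C; lra.
have pb2 : poly_bounded O T (fun t x => - w2 t x) C m.
  move=> z Sz; rewrite Rabs_Ropp; apply: Rle_trans (hb2 m (leq_maxr _ _) z Sz) _.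
  by apply: Rmult_le_compat_r => //; rewrite /C; lra.
have u2 : usc_on (fun t x => 0 <= t <= T /\ oclosure O x) (fun t x => - w2 t x).
  move=> s y Sy e e0; have [d [d0 hd]] := l2 s y Sy e e0; exists d; split=> // s' y' S' h1 h2.
  by have := hd s' y' S' h1 h2; lra.
pose kap := al * growth_const cN m.
have k0 : 0 <= kap.
  have n1 := pos_INR m.+1; have n2 := pos_INR m.+2.
  have h : 0 <= cN * (3 * INR m.+2 * (4 * INR m.+1 + 2)).
    by apply: Rmult_le_pos => //; apply: Rmult_le_pos; lra.
  by apply: Rmult_le_pos; [lra|rewrite /growth_const; lra].
have G0 := growth_pos kap m t x.
(* The two barriers together cost half of the gap at [(t, x)], so the penalized maximum remains
   positive. *)
pose b := (w1 t x - w2 t x) / (4 * growth kap m t x).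
have b0 : 0 < b by apply: Rdiv_lt_0_compat; lra.
have bG : b * growth kap m t x = (w1 t x - w2 t x) / 4 by rewrite /b; field; lra.
pose zs := stpt t x; have Szs : stdomain O T zs by [].
pose f z0 := penalized w1 b kap m 0 z0.
pose g z0 := penalized (fun t x => - w2 t x) b kap m 0 z0.
have anyf z0 z1 z : f z0 z = f z1 z by rewrite /f /penalized; ring.
have anyg z0 z1 z : g z0 z = g z1 z by rewrite /g /penalized; ring.
have [z0 [Sz0 hmax]] := @sum_attain _ (stdomain O T) (f zs) (g zs) zs (@vclosed_stdomain I O T)
  (penalized_usc b kap m 0 zs u1) (penalized_usc b kap m 0 zs u2)
  (penalized_coercive zs C0 pb1 b0 k0 (Rle_refl 0)) (penalized_coercive zs C0 pb2 b0 k0 (Rle_refl 0)) Szs.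
have hmax0 z : stdomain O T z -> f z0 z + g z0 z <= f z0 z0 + g z0 z0.
  by rewrite (anyf z0 zs z) (anyg z0 zs z) (anyf z0 zs z0) (anyg z0 zs z0); exact: hmax.
have pos : (w1 t x - w2 t x) / 2 <= f z0 z0 + g z0 z0.
  apply: Rle_trans (hmax0 zs Szs); rewrite /f /g /penalized.
  rewrite (_ : stspace zs = x) // (_ : sttime zs = t) // bG; lra.
have [zt Ox0] := Sz0.
(* At time [T] the terminal inequality and the barriers make the value negative. *)
have z0T : sttime z0 < T.
  apply: Rnot_le_lt => h; have tE : sttime z0 = T by lra.
  have := hT _ Ox0; move: pos; rewrite /f /g /penalized tE.
  have := Rmult_lt_0_compat _ _ b0 (growth_pos kap m T (stspace z0)); lra.
have [l [lam [rB [c [M0 [r [pos4 [hl [hO [lam0 [lam1 hw]]]]]]]]]]] :=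
  boundary_shift Oo cR (conj (proj1 zt) z0T) Ox0.
have est s : 0 < s <= 1 -> _ := @doubling_estimate I O T rho H w1 w2 al b kap m C z0 l lam rB c M0 r s
  Oo hE' al0 b0 k0 (Rle_refl _) rho0 C0 u1 u2 pb1 pb2 vsub1 vsup Sz0 z0T hmax0 pos4 hl hO lam0 lam1 hw.
move: est; rewrite -/(f z0) -/(g z0); set K := core_const _ _ _ _ _ => est.
pose K' := Rabs K + 2 * rho; have K0 := Rabs_pos K; have K1 := Rle_abs K.
set V := f z0 z0 + g z0 z0 in pos est.
have V0 : 0 < V by lra.
have rV : 0 < rho * V by exact: Rmult_lt_0_compat.
(* [est] then reads [rho V <= rho V / 2], impossible for [V > 0]. *)
pose s := Rmin 1 (rho * V / (2 * K')).
have K'0 : 0 < K' by rewrite /K'; lra.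
have s0 : 0 < s by apply: Rmin_glb_lt; [lra|apply: Rdiv_lt_0_compat; lra].
have s1 : s <= 1 by exact: Rmin_l.
have h1 := est s (conj s0 s1).
have h2 : (K + 2 * rho) * s <= K' * s by apply: Rmult_le_compat_r; rewrite /K'; lra.
have h3 : K' * s <= rho * V / 2.
  have -> : rho * V / 2 = K' * (rho * V / (2 * K')) by field; lra.
  by apply: Rmult_le_compat_l; [lra|exact: Rmin_r].
by lra.
Qed.

Theorem mainTheorem17 (d : nat) (O : vec 'I_d -> Prop) (T rho : R)
  (H : vec 'I_d -> vec 'I_d -> mx 'I_d -> R) (w1 w2 : R -> vec 'I_d -> R) :
  isopen O -> 0 < rho ->
  Hcont H -> Hnonincr H -> AssumptionE O H ->
  usc_on (fun t x => 0 <= t <= T /\ oclosure O x) w1 ->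
  visc_sub rho H (fun t x => 0 <= t < T /\ oclosure O x) w1 ->
  lsc_on (fun t x => 0 <= t <= T /\ oclosure O x) w2 ->
  visc_super rho H (fun t x => 0 <= t < T /\ O x) w2 ->
  poly_growth O T w1 -> poly_growth O T w2 ->
  classR O T w2 ->
  (forall x, oclosure O x -> w1 T x <= w2 T x) ->
  forall t x, 0 <= t <= T -> oclosure O x -> w1 t x <= w2 t x.
Proof.
by move=> Oo rho0 _ _; exact: comparison.
Qed.
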